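(* For each $n$ let $X_n=(X_n(z))_{z\in\mathbb{Z}^2}$ be an i.i.d. array of nonnegative random variables, let $d_{X_n}$ be its lattice last passage metric on $\mathbb{Z}^2$, and let $m_n>0$, $a_n,b_n,c_n\in\mathbb{R}$ and $h_n:\mathbb{Z}^2\to\mathbb{R}$ be deterministic. For $p=(x,s)\in\mathbb{R}^2$ let $(p)_n=(\lfloor a_nx+b_ns\rfloor,\lfloor-c_ns\rfloor)\in\mathbb{Z}^2$ and let $d_n$ be the rescaled last passage model $$d_n(p;q)=m_nd_{X_n}\big((p)_n,(q)_n\big)+h_n((p)_n)-h_n((q)_n),\qquad p,q\in\mathbb{R}^2.$$ Let $\mathcal{L}$ be the directed landscape. Then $d_n$ converges in distribution to $\mathcal{L}$ in the hypograph topology provided that: (Mobile Tracy–Widom convergence) for any sequence $u_n\to u\in\mathbb{R}^4_\uparrow$, $d_n(u_n)$ converges in distribution to $\mathcal{L}(u)$; (Airy sheet convergence) for all $s<t$ in $\mathbb{R}$, $d_n(\cdot,s;\cdot,t)$ converges in distribution to $\mathcal{L}(\cdot,s;\cdot,t)$ in the graph topology.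
   Context: Lattice last passage metric: for $a,b\in\mathbb{Z}^2$, $d_X(a,b)=\max_\pi\sum_{z\in\pi,z\ne a}X(z)$ over lattice paths $\pi$ from $a$ to $b$ with steps in $\{(1,0),(0,-1)\}$, and $-\infty$ if there is no such path. Notation. $\mathbb{R}^4_\uparrow=\{(x,s;y,t)\in\mathbb{R}^4:s<t\}$, $\mathbb{R}^4_\circ=\{(p,q)\in\mathbb{R}^2\times\mathbb{R}^2:p\ne q\}$, $\bar{\mathbb{R}}=[-\infty,\infty]$; $a/(1+|a|):=\pm1$ for $a=\pm\infty$. Hypograph topology (functions $\mathbb{R}^4_\circ\to\bar{\mathbb{R}}$): $\mathfrak{h}f$ is the closure of $\{(r,a):a\le f(r)\}$ in $\mathbb{R}^4_\circ\times\bar{\mathbb{R}}$; with $E(r,a)=(r,|p-q|e^{-|r|}a/(1+|a|))$, $r=(p,q)$, the distance of $f,g$ is the Hausdorff distance between $E(\mathfrak{h}f)$ and $E(\mathfrak{h}g)$. Functions on $\mathbb{R}^4$ are restricted to $\mathbb{R}^4_\circ$. Graph topology (functions $\mathbb{R}^2\to\bar{\mathbb{R}}$): $\mathfrak{g}f$ is the closure of $\{(r,f(r))\}$ in $\mathbb{R}^2\times\bar{\mathbb{R}}$; with $E'(r,a)=(r,e^{-|r|}a/(1+|a|))$, the distance of $f,g$ is the Hausdorff distance between $E'(\mathfrak{g}f)$ and $E'(\mathfrak{g}g)$. Parabolic Airy line ensemble. The random continuous $\mathfrak{A}:\mathbb{N}\times\mathbb{R}\to\mathbb{R}$ with $\mathfrak{A}_1>\mathfrak{A}_2>\cdots$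 such that for any times $t_1,\dots,t_m$ the point process $\{(t_j,\mathfrak{A}_i(t_j)+t_j^2)\}$ is determinantal with the extended Airy kernel $K(s,x;t,y)=\int_0^\infty e^{-\lambda(s-t)}\mathrm{Ai}(x+\lambda)\mathrm{Ai}(y+\lambda)d\lambda$ for $s\ge t$, $-\int_{-\infty}^0e^{-\lambda(s-t)}\mathrm{Ai}(x+\lambda)\mathrm{Ai}(y+\lambda)d\lambda$ for $s<t$. For continuous $f=(f_i)$: $f[(x,n)\to(y,m)]=\sup\sum_{i=m}^n(f_i(t_{i-1})-f_i(t_i))$ over $x=t_n\le\dots\le t_{m-1}=y$. Airy sheet. The random continuous $\mathcal{S}:\mathbb{R}^2\to\mathbb{R}$ (unique in law) with $\mathcal{S}(\cdot+t,\cdot+t)\overset{d}{=}\mathcal{S}$ for all $t$, that can be coupled with $\mathfrak{A}$ so that $\mathcal{S}(0,\cdot)=\mathfrak{A}_1$ and for all $(x,y,z)\in\mathbb{Q}^+\times\mathbb{Q}^2$ a.s. for all sufficiently large (random) $k$, $\mathfrak{A}[(-\sqrt{k/(2x)},k)\to(z,1)]-\mathfrak{A}[(-\sqrt{k/(2x)},k)\to(y,1)]=\mathcal{S}(x,z)-\mathcal{S}(x,y)$. Airy sheet of scale $r$: $r\mathcal{S}(x/r^2,y/r^2)$. Directed landscape. The random $\mathcal{L}:\mathbb{R}^2\times\mathbb{R}^2\to\mathbb{R}\cup\{-\infty\}$ (unique in law), continuous and finite on $\mathbb{R}^4_\uparrow$, $0$ on the diagonal, $-\infty$ elsewhere; for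 disjoint $(s_i,t_i)$ the functions $\mathcal{L}(\cdot,s_i;\cdot,t_i)$ are independent Airy sheets of scale $(t_i-s_i)^{1/3}$; a.s. $\mathcal{L}(x,r;y,t)=\max_z[\mathcal{L}(x,r;z,s)+\mathcal{L}(z,s;y,t)]$ for all $r<s<t$, $x,y$. *)

(* Defs.v *)
From HB Require Import structures.
From mathcomp Require Import all_boot all_order all_algebra.
From mathcomp Require Import all_classical all_reals all_analysis.
From mathcomp Require Import measurable_realfun.
Set Implicit Arguments.
Unset Strict Implicit.
Unset Printing Implicit Defensive.
Import Order.TTheory GRing.Theory Num.Theory.
Import numFieldNormedType.Exports.
Local Open Scope classical_set_scope.
Local Open Scope ring_scope.

(* A random function on a set I is a map xi : T -> (I -> V) on a probability
   space T; "for all w" properties hold surely, {ae P, ...} almost surely.   *)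
Section random_functions.
Context {R : realType}.

(* The product sigma-algebra on V^I, generated by the evaluations. *)
Definition cylindrical (I : Type) d (V : measurableType d) :
    set_system (I -> V) :=
  <<s [set A | exists i (B : set V), measurable B /\
                 A = [set f : I -> V | B (f i)]] >>.

Definition random_function d (T : measurableType d) (I : Type) d'
    (V : measurableType d') (xi : T -> I -> V) : Prop :=
  forall i, measurable_fun [set: T] (fun w => xi w i).

Definition random_continuous d (T : measurableType d) (I : topologicalType)
    (xi : T -> I -> R) : Prop :=
  random_function xi /\ forall w, continuous (xi w).

Definition same_law d (T : measurableType d) (P : probability T R)
    d' (T' : measurableType d') (P' : probability T' R) (I : Type)
    dV (V : measurableType dV) (xi : T -> I -> V) (xi' : T' -> I -> V) : Prop :=
  forall A, cylindrical A -> P (xi @^-1` A) = P' (xi' @^-1` A).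

(* Mutual independence of random elements xi i of a space S with sigma-algebra
   G: the product rule for every finite subfamily.                            *)
Definition independent d (T : measurableType d) (P : probability T R)
    (I : eqType) (S : Type) (G : set_system S) (xi : I -> T -> S) : Prop :=
  forall (s : seq I) (A : I -> set S), uniq s -> (forall i, G (A i)) ->
    P (\bigcap_(i in [set` s]) (xi i @^-1` A i)) =
    (\big[mule/1]_(i <- s) P (xi i @^-1` A i))%E.

Definition iid_array d (T : measurableType d) (P : probability T R)
    (I : eqType) (X : T -> I -> R) : Prop :=
  [/\ random_function X,
      independent P (@measurable _ R) (fun i w => X w i) &
      forall i j (B : set R), measurable B ->
        P [set w | B (X w i)] = P [set w | B (X w j)]].

(* Convergence in distribution xi n -> xi' in a space S whose continuous
   real functions are the members of C. The xi n may live on different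
   probability spaces. Measurability of C-functions of xi n and xi' says that
   these are random elements of S.                                            *)
Definition cvg_in_distribution (S : Type) (C : set (S -> R))
    (d : nat -> measure_display) (T : forall n, measurableType (d n))
    (P : forall n, probability (T n) R) (xi : forall n, T n -> S)
    d' (T' : measurableType d') (P' : probability T' R) (xi' : T' -> S)
    : Prop :=
  forall F : S -> R, C F -> (exists M, forall s, `|F s| <= M) ->
    [/\ forall n, measurable_fun [set: T n] (F \o xi n),
        measurable_fun [set: T'] (F \o xi') &
        ('E_(P n)[F \o xi n] @[n --> \oo] --> 'E_P'[F \o xi'])%E].

(* Continuity for the topology of an extended pseudometric. *)
Definition dist_continuous (S : Type) (dist : S -> S -> \bar R)
    (F : S -> R) : Prop :=
  forall f (e : R), 0 < e -> exists2 delta : R, 0 < delta &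
    forall g, (dist f g < delta%:E)%E -> `|F f - F g| < e.

End random_functions.

Section plane.
Context (R : realType).

(* A point (x, s; y, t) of R^4 is ((x, s), (y, t)). *)
Definition R4up : set ((R * R) * (R * R)) := [set u | u.1.2 < u.2.2].
Definition R4o : set ((R * R) * (R * R)) := [set u | u.1 <> u.2].

(* Euclidean norms; the library norm on products is the maximum norm. *)
Definition norm2 (p : R * R) : R := Num.sqrt (p.1 ^+ 2 + p.2 ^+ 2).
Definition norm4 (r : (R * R) * (R * R)) : R :=
  Num.sqrt (norm2 r.1 ^+ 2 + norm2 r.2 ^+ 2).

Definition hausdorff_dist (V : Type) (dist : V -> V -> R) (A B : set V)
    : \bar R :=
  maxe (ereal_sup [set ereal_inf [set (dist a b)%:E | b in B] | a in A])
       (ereal_sup [set ereal_inf [set (dist a b)%:E | a in A] | b in B]).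

(* The closure is taken in R4o * \bar R, hence the intersection. *)
Definition hypograph (f : (R * R) * (R * R) -> \bar R)
    : set ((R * R) * (R * R) * \bar R) :=
  closure [set ra | R4o ra.1 /\ (ra.2 <= f ra.1)%E] `&` [set ra | R4o ra.1].

(* contract a = a / (1 + |a|), with values +1 and -1 at +oo and -oo. *)
Definition hypo_embed (ra : (R * R) * (R * R) * \bar R)
    : (R * R) * (R * R) * R :=
  (ra.1, norm2 (ra.1.1 - ra.1.2) * expR (- norm4 ra.1) * contract ra.2).

Definition hypo_dist (f g : (R * R) * (R * R) -> \bar R) : \bar R :=
  hausdorff_dist
    (fun u v => Num.sqrt (norm4 (u.1 - v.1) ^+ 2 + (u.2 - v.2) ^+ 2))
    (hypo_embed @` hypograph f) (hypo_embed @` hypograph g).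

Definition graph_closure (f : R * R -> \bar R) : set (R * R * \bar R) :=
  closure [set ra | ra.2 = f ra.1].

Definition graph_embed (ra : R * R * \bar R) : R * R * R :=
  (ra.1, expR (- norm2 ra.1) * contract ra.2).

Definition graph_dist (f g : R * R -> \bar R) : \bar R :=
  hausdorff_dist
    (fun u v => Num.sqrt (norm2 (u.1 - v.1) ^+ 2 + (u.2 - v.2) ^+ 2))
    (graph_embed @` graph_closure f) (graph_embed @` graph_closure g).

Definition hypo_continuous : set (((R * R) * (R * R) -> \bar R) -> R) :=
  dist_continuous hypo_dist.
Definition graph_continuous : set ((R * R -> \bar R) -> R) :=
  dist_continuous graph_dist.

(* (x, y) |-> f (x, s; y, t) *)
Definition time_slice (s t : R) (f : (R * R) * (R * R) -> \bar R)
    (xy : R * R) : \bar R := f ((xy.1, s), (xy.2, t)).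

End plane.

Section last_passage.
Context {R : realType}.

Definition lattice_step : rel (int * int) :=
  [rel u v | (v == (u.1 + 1, u.2)) || (v == (u.1, u.2 - 1))].

(* The path a :: p visits a only at its start, so the sum over p omits
   exactly z = a. There are finitely many paths from a to b, so the supremum
   is a maximum unless there is none, when it is -oo.                       *)
Definition lattice_lpp (X : int * int -> R) (a b : int * int) : \bar R :=
  ereal_sup [set (\sum_(z <- p) X z)%:E |
             p in [set p | path lattice_step a p /\ last a p = b]].

Definition lattice_point (a b c : R) (p : R * R) : int * int :=
  (Num.floor (a * p.1 + b * p.2), Num.floor (- (c * p.2))).

Definition rescaled_lpp (X : int * int -> R) (m a b c : R)
    (h : int * int -> R) (u : (R * R) * (R * R)) : \bar R :=
  let p := lattice_point a b c u.1 in
  let q := lattice_point a b c u.2 in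
  (m%:E * lattice_lpp X p q + (h p - h q)%:E)%E.

(* f[(x, n) -> (y, m)] for 1 <= m <= n; -oo if y < x. *)
Definition line_lpp (f : nat -> R -> R) (x : R) (n : nat) (y : R) (m : nat)
    : \bar R :=
  ereal_sup [set (\sum_(m <= i < n.+1) (f i (t i.-1) - f i (t i)))%:E |
             t in [set t : nat -> R | [/\ t n = x, t m.-1 = y &
               forall i, (m <= i <= n)%N -> t i <= t i.-1]]].

End last_passage.

Section determinantal.
Context {R : realType}.

Fixpoint iterated_integral d (E : measurableType d)
    (mu : {measure set E -> \bar R}) (B : seq (set E)) (f : seq E -> R)
    : \bar R :=
  if B is B0 :: B' then
    (\int[mu]_(z in B0) iterated_integral mu B' (fun zs => f (z :: zs)))%E
  else (f [::])%:E.

Definition kernel_det (E : pointedType) (K : E -> E -> R) (zs : seq E) : R :=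
  \det (\matrix_(i < size zs, j < size zs)
          K (nth point zs i) (nth point zs j)).

(* The point process (pts w i)_i on E is determinantal with kernel K and
   reference measure mu: for all B_1, ..., B_k in the given class of
   (relatively compact) sets, the expected number of k-tuples of distinct
   points with l-th point in B_l is
   \int_(B_1 * ... * B_k) det (K (z_i, z_j)) mu(dz_1) ... mu(dz_k).        *)
Definition determinantal d (T : measurableType d) (P : probability T R)
    dE (E : measurableType dE) (mu : {measure set E -> \bar R})
    (bnd : set_system E) (K : E -> E -> R) (I : choiceType)
    (pts : T -> I -> E) : Prop :=
  forall B : seq (set E),
    (forall l, (l < size B)%N ->
       measurable (nth set0 B l) /\ bnd (nth set0 B l)) ->
    (\int[P]_w counting [set s : seq I | [/\ uniq s, size s = size B &
        forall l i, (l < size B)%N -> nth set0 B l (pts w (nth i s l))]])%E =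
    iterated_integral mu B (kernel_det K).

(* Ai x = (1 / pi) \int_0^oo cos (u^3 / 3 + x u) du, an improper integral. *)
Definition airy (x : R) : R :=
  pi^-1 * lim ((\int[lebesgue_measure]_(u in `[0, M])
                  cos (u ^+ 3 / 3 + x * u)) @[M --> +oo]).

Definition extended_airy_kernel (p q : R * R) : R :=
  let: (s, x) := p in let: (t, y) := q in
  let f (l : R) := expR (- (l * (s - t))) * airy (x + l) * airy (y + l) in
  if t <= s then \int[lebesgue_measure]_(l in `[0, +oo[) f l
  else - \int[lebesgue_measure]_(l in `]-oo, 0]) f l.

(* (sum of the Dirac masses at the elements of ts) * Lebesgue *)
Definition times_measure (ts : seq R) :=
  (msum (fun j => dirac (nth 0%R ts j) : {measure set R -> \bar R}) (size ts)
     \x (@lebesgue_measure R))%E.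

End determinantal.

Section limit_objects.
Context {R : realType}.

(* Lines are numbered from 1; A w 0 is irrelevant. *)
Definition parabolic_airy_line_ensemble d (T : measurableType d)
    (P : probability T R) (A : T -> nat -> R -> R) : Prop :=
  [/\ forall i, (0 < i)%N -> random_continuous (fun w => A w i),
      forall w i t, (0 < i)%N -> A w i.+1 t < A w i t &
      forall ts : seq R, uniq ts ->
        determinantal P (times_measure ts) [set B : set (R * R) | bounded_set B]
          extended_airy_kernel
          (fun w (ij : nat * 'I_(size ts)) =>
             let t := nth 0 ts ij.2 in (t, A w ij.1.+1 t + t ^+ 2))].

Definition airy_sheet d (T : measurableType d) (P : probability T R)
    (S : T -> R * R -> R) : Prop :=
  [/\ random_continuous S,
      forall t, same_law P P (fun w xy => S w (xy.1 + t, xy.2 + t)) S &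
      exists d' (T' : measurableType d') (P' : probability T' R)
        (A : T' -> nat -> R -> R) (S' : T' -> R * R -> R),
        [/\ parabolic_airy_line_ensemble P' A,
            random_continuous S', same_law P' P S' S,
            {ae P', forall w, forall y, S' w (0, y) = A w 1 y} &
            forall x y z : rat, 0 < x -> {ae P', forall w,
              \forall k \near \oo,
                let x0 := - Num.sqrt (k%:R / (2 * ratr x)) in
                (line_lpp (A w) x0 k (ratr z) 1 -
                 line_lpp (A w) x0 k (ratr y) 1)%E =
                (S' w (ratr x, ratr z) - S' w (ratr x, ratr y))%:E}]].

(* Values in \bar R because slices of a directed landscape are compared. *)
Definition airy_sheet_of_scale d (T : measurableType d) (P : probability T R)
    (r : R) (M : T -> R * R -> \bar R) : Prop :=
  exists2 S : T -> R * R -> R, airy_sheet P S &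
    forall w xy, M w xy = (r * S w (xy.1 / r ^+ 2, xy.2 / r ^+ 2))%:E.

Definition directed_landscape d (T : measurableType d) (P : probability T R)
    (L : T -> (R * R) * (R * R) -> \bar R) : Prop :=
  [/\ random_function L,
      forall w u, R4up u -> {for u, continuous (L w)} /\ L w u \is a fin_num,
      forall w u, ~ R4up u -> L w u = if u.1 == u.2 then 0%E else -oo%E,
      forall k (s t : 'I_k -> R), (forall i, s i < t i) ->
        trivIset setT (fun i => `]s i, t i[%classic) ->
        independent P (@cylindrical (R * R) _ (\bar R))
          (fun i w => time_slice (s i) (t i) (L w)) /\
        forall i, airy_sheet_of_scale P ((t i - s i) `^ 3^-1)
                    (fun w => time_slice (s i) (t i) (L w)) &
      {ae P, forall w, forall r s t x y : R, r < s -> s < t ->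
        let f z := (L w ((x, r), (z, s)) + L w ((z, s), (y, t)))%E in
        (forall z, f z <= L w ((x, r), (y, t)))%E /\
        exists z, f z = L w ((x, r), (y, t))}].

End limit_objects.

(* Main.v *)
(** Everything is expressed through expectations of functionals that are Lipschitz in the contracted
values [contract (f u)], so that no tightness argument and no coupling is needed.

Airy sheet convergence gives convergence of the values of d_n at finitely many points of one time
strip, since a value is squeezed between Lipschitz functionals of the closed graph. The one-point
law of the Airy line ensemble gives |L(x,s;y,t) / r + ((y-x)/r^2)^2| = O(1) in probability,
uniformly, where r = (t-s)^(1/3); the parabola then forces the vertical speed c_n to tend to
infinity, so disjoint time strips use disjoint rows and are independent. The triangle inequality
and the metric composition law of L extend finite-dimensional convergence to any finite set
of points: if Y <= X and E Y is close to E X, then Y is close to X.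

For suprema over balls, the start point of a good pair is explored from the last lattice site
backwards and the end point forwards: as in Ottaviani's inequality, an independent short connection
to a nearby grid point is not too negative, so the supremum over a ball is dominated in law, up to
a small error, by the maximum over the grid points of a slightly larger ball. A bounded continuous
functional of the hypograph is a monotone limit of Lipschitz ones, and these depend, up to a small
error, only on the suprema over finitely many balls. *)

Require Import Defs.
From HB Require Import structures.
From mathcomp Require Import all_boot all_order all_algebra.
From mathcomp Require Import all_classical all_reals all_analysis.
From mathcomp Require Import measurable_realfun.
From mathcomp Require Import finmap ring lra zify.
Import Order.TTheory GRing.Theory Num.Theory.
Import numFieldNormedType.Exports.
Local Open Scope classical_set_scope.
Local Open Scope ring_scope.
Set Implicit Arguments.
Unset Strict Implicit.
Unset Printing Implicit Defensive.

(** * Expectations *)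

Section expectation.
Context {R : realType} d (T : measurableType d) (P : probability T R).
Implicit Types f g : T -> R.

(** The number of lattice points in a ball grows with [n], so a union bound over them is hopeless.
    In Ottaviani's inequality the error is the failure probability of one short connection, and
    convergence along all sequences [u_n] makes that uniform over a compact set of connections. The
    price is a larger ball on the grid side; it is absorbed by a radius at which the mean supremum
    of the landscape barely changes.

    Between points, [d_n] is controlled by the triangle inequality, which bounds it from below only.
    Hence every comparison is between a variable and an almost minorant whose mean has the right
    limit. Strips that touch share a row, so independence first requires a gap in time, which the
    triangle inequality then closes.

    The tails use one time and at most two points of the determinantal process: symmetry of the
    kernel bounds the second factorial moment by the square of the first. Since the intensity is the
    same for all ensembles and times, the constants can be read off a single one. *)

Definition ev f : R := \int[P]_w f w.

Definition bdd_meas f : Prop :=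
  measurable_fun setT f /\ exists M, forall w, `|f w| <= M.

Lemma bdd_meas_integrable f : bdd_meas f -> P.-integrable setT (EFin \o f).
Proof.
move=> [mf [M fM]]; apply: measurable_bounded_integrable => //.
  by apply: fin_num_fun_lty; exact: fin_num_measure.
exists M; split; first exact: num_real.
by move=> x Mx w _; exact: le_trans (fM w) (ltW Mx).
Qed.

Lemma ev_expectation f : bdd_meas f -> 'E_P[f]%E = (ev f)%:E.
Proof.
move=> bf; rewrite unlock /ev /Rintegral fineK//.
exact: integrable_fin_num (bdd_meas_integrable bf).
Qed.

Lemma bdd_meas_cst (r : R) : bdd_meas (fun=> r).
Proof. by split; [exact: measurable_cst|exists `|r|]. Qed.

Lemma bdd_measD f g : bdd_meas f -> bdd_meas g -> bdd_meas (fun w => f w + g w).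
Proof.
move=> [mf [M fM]] [mg [N gN]]; split; first exact: measurable_funD.
by exists (M + N) => w; rewrite (le_trans (ler_normD _ _)) ?lerD.
Qed.

Lemma bdd_measM f g : bdd_meas f -> bdd_meas g -> bdd_meas (fun w => f w * g w).
Proof.
move=> [mf [M fM]] [mg [N gN]]; split; first exact: measurable_funM.
by exists (M * N) => w; rewrite normrM ler_pM.
Qed.

Lemma bdd_measZ (k : R) f : bdd_meas f -> bdd_meas (fun w => k * f w).
Proof. exact: bdd_measM (bdd_meas_cst k). Qed.

Lemma bdd_measN f : bdd_meas f -> bdd_meas (fun w => - f w).
Proof.
move=> bf; rewrite (_ : (fun _ => _) = (fun w => -1 * f w)); last first.
  by apply/funext => w; rewrite mulN1r.
exact: bdd_measZ.
Qed.

Lemma bdd_measB f g : bdd_meas f -> bdd_meas g -> bdd_meas (fun w => f w - g w).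
Proof. by move=> bf bg; apply: bdd_measD => //; exact: bdd_measN. Qed.

Lemma bdd_meas_norm f : bdd_meas f -> bdd_meas (fun w => `|f w|).
Proof.
move=> [mf [M fM]]; split; first exact: measurableT_comp.
by exists M => w; rewrite normr_id.
Qed.

Lemma bdd_meas_sum (I : eqType) (s : seq I) (f : I -> T -> R) :
  (forall i, i \in s -> bdd_meas (f i)) -> bdd_meas (fun w => \sum_(i <- s) f i w).
Proof.
elim: s => [|i s IH] H.
  by under eq_fun do rewrite big_nil; exact: bdd_meas_cst.
under eq_fun do rewrite big_cons; apply: bdd_measD.
  by apply: H; rewrite mem_head.
by apply: IH => j js; apply: H; rewrite inE js orbT.
Qed.

Lemma bdd_meas_prod (I : eqType) (s : seq I) (f : I -> T -> R) :
  (forall i, i \in s -> bdd_meas (f i)) -> bdd_meas (fun w => \prod_(i <- s) f i w).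
Proof.
elim: s => [|i s IH] H.
  by under eq_fun do rewrite big_nil; exact: bdd_meas_cst.
under eq_fun do rewrite big_cons; apply: bdd_measM.
  by apply: H; rewrite mem_head.
by apply: IH => j js; apply: H; rewrite inE js orbT.
Qed.

Lemma bdd_meas_indic A : measurable A -> bdd_meas (\1_A : T -> R).
Proof.
move=> mA; split; first exact: measurable_indic.
by exists 1 => w; rewrite indicE ger0_norm// lern1 leq_b1.
Qed.

Lemma ev_cst (r : R) : ev (fun=> r) = r.
Proof.
rewrite /ev Rintegral_cst// -[RHS]mulr1; congr (r * _).
by transitivity (fine (1%:E : \bar R)) => //; congr fine; exact: probability_setT.
Qed.

Lemma evD f g : bdd_meas f -> bdd_meas g -> ev (fun w => f w + g w) = ev f + ev g.
Proof. by move=> /bdd_meas_integrable bf /bdd_meas_integrable bg; exact: RintegralD. Qed.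

Lemma evB f g : bdd_meas f -> bdd_meas g -> ev (fun w => f w - g w) = ev f - ev g.
Proof. by move=> /bdd_meas_integrable bf /bdd_meas_integrable bg; exact: RintegralB. Qed.

Lemma evZ (k : R) f : bdd_meas f -> ev (fun w => k * f w) = k * ev f.
Proof. by move=> /bdd_meas_integrable bf; exact: RintegralZl. Qed.

Lemma ev_sum (I : eqType) (s : seq I) (f : I -> T -> R) :
  (forall i, i \in s -> bdd_meas (f i)) ->
  ev (fun w => \sum_(i <- s) f i w) = \sum_(i <- s) ev (f i).
Proof.
elim: s => [|i s IH] H.
  by under eq_fun do rewrite big_nil; rewrite ev_cst big_nil.
under eq_fun do rewrite big_cons; rewrite big_cons evD; last first.
- by apply: bdd_meas_sum => j js; apply: H; rewrite inE js orbT.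
- by apply: H; rewrite mem_head.
by rewrite IH// => j js; apply: H; rewrite inE js orbT.
Qed.

Lemma ev_le f g : bdd_meas f -> bdd_meas g -> (forall w, f w <= g w) -> ev f <= ev g.
Proof.
by move=> /bdd_meas_integrable bf /bdd_meas_integrable bg fg; exact: le_Rintegral.
Qed.

Lemma ev_ge0 f : (forall w, 0 <= f w) -> 0 <= ev f.
Proof. by move=> f0; exact: Rintegral_ge0. Qed.

Lemma ev_dist f g (e : R) : bdd_meas f -> bdd_meas g ->
  (forall w, `|f w - g w| <= e) -> `|ev f - ev g| <= e.
Proof.
move=> bf bg fg; rewrite -evB// ler_norml; apply/andP; split.
  rewrite -(ev_cst (- e)); apply: ev_le; [exact: bdd_meas_cst|exact: bdd_measB|].
  by move=> w; have := fg w; rewrite ler_norml => /andP[].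
rewrite -(ev_cst e); apply: ev_le; [exact: bdd_measB|exact: bdd_meas_cst|].
by move=> w; have := fg w; rewrite ler_norml => /andP[].
Qed.

Lemma ev_dist_le f g h : bdd_meas f -> bdd_meas g -> bdd_meas h ->
  (forall w, `|f w - g w| <= h w) -> `|ev f - ev g| <= ev h.
Proof.
move=> bf bg bh fg; rewrite -evB// ler_norml; apply/andP; split.
  rewrite -[- ev h]mulN1r -evZ//; apply: ev_le; [exact: bdd_measZ|exact: bdd_measB|].
  by move=> w; have := fg w; rewrite ler_norml mulN1r => /andP[].
apply: ev_le => //; first exact: bdd_measB.
by move=> w; have := fg w; rewrite ler_norml => /andP[].
Qed.

Lemma ev_indic A : measurable A -> ev (\1_A) = fine (P A).
Proof. by move=> mA; rewrite /ev /Rintegral integral_indic// setIT. Qed.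

Lemma ev_dominated_cvg (f_ : nat -> T -> R) f (M : R) :
  (forall k, measurable_fun setT (f_ k)) -> (forall k w, `|f_ k w| <= M) ->
  {ae P, forall w, f_ k w @[k --> \oo] --> f w} -> measurable_fun setT f ->
  ev (f_ k) @[k --> \oo] --> ev f.
Proof.
move=> mf fM fcvg mf'.
have [| | | | |intf _ H] := @dominated_convergence _ _ _ P setT measurableT
  (fun k => EFin \o f_ k) (EFin \o f) (cst M%:E).
- by move=> k; exact/measurable_EFinP.
- exact/measurable_EFinP.
- by apply: filterS fcvg => w fw _; apply: cvg_EFin => //; exact: nearW.
- exact: finite_measure_integrable_cst.
- by apply: aeW => w k _; rewrite lee_fin fM.
by apply: fine_cvg; rewrite fineK//; exact: integrable_fin_num intf.
Qed.

Lemma ae_eq_ev f g : measurable_fun setT f -> measurable_fun setT g ->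
  {ae P, forall w, f w = g w} -> ev f = ev g.
Proof.
move=> mf mg fg; rewrite /ev /Rintegral; congr fine.
apply: ae_eq_integral => //; try exact/measurable_EFinP.
by apply: filterS fg => w + _ => ->.
Qed.

End expectation.

(** The sum counts the integers in [[0, N x[], so it lies between [N x] and [N x + 1]. It turns
    statements about the level sets of a variable into statements about its mean. *)
Lemma staircase {R : realType} (x : R) (N : nat) : (0 < N)%N -> 0 <= x <= 1 ->
  x <= N%:R^-1 * \sum_(k <- iota 0 N) (k%:R / N%:R < x)%R%:R <= x + N%:R^-1.
Proof.
move=> N0 /andP[x0 x1]; have NR : 0 < N%:R :> R by rewrite ltr0n.
pose S (n : nat) (y : R) : R := \sum_(k <- iota 0 n) ((k%:R : R) < y)%R%:R.
have H (y : R) (n : nat) : 0 <= y ->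
    [/\ Num.min y n%:R <= S n y, S n y <= y + 1 & S n y <= n%:R].
  move=> y0; elim: n => [|n [h1 h2 h3]].
    by rewrite /S big_nil ge_min lexx orbT; split => //; lra.
  have -> : S n.+1 y = S n y + ((n%:R : R) < y)%R%:R.
    by rewrite /S -[in LHS]addn1 iotaD big_cat/= big_seq1 add0n.
  rewrite -natr1; case: ltP => [ny|yn] /=.
    rewrite min_r in h1; last exact: ltW.
    split; [rewrite ge_min; apply/orP; right| |]; lra.
  rewrite min_l// in h1; split; [rewrite ge_min; apply/orP; left| |]; lra.
have [] := H (N%:R * x) N (mulr_ge0 (ltW NR) x0).
rewrite (_ : S N _ = \sum_(k <- iota 0 N) (k%:R / N%:R < x)%R%:R);
  last by apply: eq_bigr => k _; rewrite ltr_pdivrMr// mulrC.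
rewrite min_l; last by rewrite ler_piMr// ltW.
move=> h1 h2 _; rewrite mulrC ler_pdivlMr// ler_pdivrMr// mulrDl mulVf ?gt_eqF//.
by rewrite ![x * _]mulrC h1 h2.
Qed.

(** * From independent level sets to products of means *)

Section independence.
Context {R : realType} d (T : measurableType d) (P : probability T R).

Let lev (g : T -> R) (c : R) : T -> R := fun w => (c < g w)%R%:R.

Lemma bdd_meas_level (g : T -> R) (c : R) : measurable_fun setT g ->
  bdd_meas (fun w => (c < g w)%R%:R : R).
Proof.
move=> mg; rewrite (_ : (fun _ => _) = \1_(g @^-1` `]c, +oo[)).
  by apply: bdd_meas_indic; rewrite -[_ @^-1` _]setTI; exact: mg.
apply/funext => w; rewrite indicE; congr (nat_of_bool _)%:R; apply/idP/idP.
  by move=> cg; apply/mem_set; rewrite /= in_itv/= cg.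
by move/set_mem; rewrite /= in_itv/= andbT.
Qed.

(** Only the product rule for superlevel sets is assumed. Their indicators are replaced by the
    variables one index at a time: [g j] is within [1 / N] of an average of indicators of its
    superlevel sets, and the rule with such an indicator in place of [g j] is available at every
    level. *)
Lemma ev_prod_indep (I : eqType) (s : seq I) (g : I -> T -> R) : uniq s ->
  (forall i, measurable_fun setT (g i)) -> (forall i w, 0 <= g i w <= 1) ->
  (forall c : I -> R, ev P (fun w => \prod_(i <- s) (c i < g i w)%R%:R) =
     \prod_(i <- s) ev P (fun w => (c i < g i w)%R%:R)) ->
  ev P (fun w => \prod_(i <- s) g i w) = \prod_(i <- s) ev P (g i).
Proof.
move=> us mg g01 H.
(* At the indices of [t] the variable itself, at the others the indicator of level [c i]. The
   induction on [t] keeps [c] free, since one step uses the rule at all the levels [k / N] of the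
   index [j]. *)
pose F (c : I -> R) (t : seq I) i : T -> R := if i \in t then g i else lev (g i) (c i).
have bg i : bdd_meas (g i).
  by split => //; exists 1 => w; have /andP[? ?] := g01 i w; rewrite ger0_norm.
have bF c t i : bdd_meas (F c t i).
  by rewrite /F; case: ifP => // _; exact: bdd_meas_level.
have F01 c t i w : 0 <= F c t i w <= 1.
  by rewrite /F; case: ifP => // _; rewrite /lev; case: ltP => _; rewrite !lexx ler01.
suff K t c : ev P (fun w => \prod_(i <- s) F c t i w) = \prod_(i <- s) ev P (F c t i).
  have := K s (fun=> 0); rewrite !big_seq => E.
  transitivity (ev P (fun w => \prod_(i <- s) F (fun=> 0) s i w)).
    congr ev; apply/funext => w; rewrite !big_seq; apply: eq_bigr => i si.
    by rewrite /F si.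
  rewrite [LHS]E; apply: eq_bigr => i si; by rewrite /F si.
elim: t c => [|j t IH] c; first exact: H.
have [jt|jt] := boolP (j \in t).
  rewrite (_ : F c (j :: t) = F c t); first exact: IH.
  by apply/funext => i; rewrite /F inE; case: eqP => [->|//]; rewrite jt.
have [js|js] := boolP (j \in s); last first.
  have E i : i \in s -> F c (j :: t) i = F c t i.
    by move=> si; rewrite /F inE; case: eqP => // ij; rewrite -ij si in js.
  transitivity (ev P (fun w => \prod_(i <- s) F c t i w)).
    by congr ev; apply/funext => w; rewrite !big_seq; apply: eq_bigr => i /E ->.
  by rewrite IH !big_seq; apply: eq_bigr => i /E ->.
pose ck N k : I -> R := fun i => if i == j then k%:R / N%:R else c i.
pose rest w := \prod_(i <- rem j s) F c t i w.
have remj i : i \in rem j s -> (i == j) = false.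
  by rewrite mem_rem_uniq// => /andP[/negbTE ].
have FE i : i \in rem j s -> F c (j :: t) i = F c t i.
  by move=> /remj ij; rewrite /F in_cons ij.
have FkE N k i : i \in rem j s -> F (ck N k) t i = F c t i.
  by move=> /remj ij; rewrite /F /ck /lev ij.
have Fj : F c (j :: t) j = g j by rewrite /F mem_head.
have Fkj N k : F (ck N k) t j = lev (g j) (k%:R / N%:R).
  by rewrite /F (negbTE jt) /ck eqxx.
have E1 w : \prod_(i <- s) F c (j :: t) i w = g j w * rest w.
  rewrite (big_rem j)//= Fj; congr (_ * _); rewrite /rest big_seq [RHS]big_seq.
  by apply: eq_bigr => i /FE ->.
have E2 : \prod_(i <- s) ev P (F c (j :: t) i) =
    ev P (g j) * \prod_(i <- rem j s) ev P (F c t i).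
  rewrite (big_rem j)//= Fj; congr (_ * _); rewrite big_seq [RHS]big_seq.
  by apply: eq_bigr => i /FE ->.
have E3 N k w : \prod_(i <- s) F (ck N k) t i w = (k%:R / N%:R < g j w)%R%:R * rest w.
  rewrite (big_rem j)//= Fkj; congr (_ * _); rewrite /rest big_seq [RHS]big_seq.
  by apply: eq_bigr => i /FkE ->.
have E4 N k : \prod_(i <- s) ev P (F (ck N k) t i) =
    ev P (fun w => (k%:R / N%:R < g j w)%R%:R) * \prod_(i <- rem j s) ev P (F c t i).
  rewrite (big_rem j)//= Fkj; congr (_ * _); rewrite big_seq [RHS]big_seq.
  by apply: eq_bigr => i /FkE ->.
have rest01 w : 0 <= rest w <= 1.
  apply/andP; split; first by apply: prodr_ge0 => i _; have /andP[] := F01 c t i w.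
  by apply: prodr_ile1 => i _; exact: F01.
have brest : bdd_meas rest by apply: bdd_meas_prod => i _; exact: bF.
set Q := \prod_(i <- rem j s) ev P (F c t i) in E2 E4 *.
have Q01 : 0 <= Q <= 1.
  apply/andP; split.
    by apply: prodr_ge0 => i _; apply: ev_ge0 => w; have /andP[] := F01 c t i w.
  apply: prodr_ile1 => i _; apply/andP; split.
    by apply: ev_ge0 => w; have /andP[] := F01 c t i w.
  rewrite -[leRHS](ev_cst P 1); apply: ev_le => //; first exact: bdd_meas_cst.
  by move=> w; have /andP[] := F01 c t i w.
rewrite E2 (_ : (fun w => _) = (fun w => g j w * rest w)); last exact/funext.
apply/eqP; rewrite -subr_eq0 -normr_le0; apply/ler_addgt0Pl => e e0; rewrite addr0.
pose N := (Num.trunc (2 / e)).+1; have N0 : 0 < N%:R :> R by rewrite ltr0n.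
have Ne : 2 * N%:R^-1 <= e.
  rewrite ler_pdivrMr// mulrC -ler_pdivrMr// ltW// /N -addn1 natrD natr1.
  by rewrite truncnS_gt.
pose A w := N%:R^-1 * \sum_(k <- iota 0 N) (k%:R / N%:R < g j w)%R%:R : R.
have bl k : bdd_meas (fun w => (k%:R / N%:R < g j w)%R%:R : R) by exact: bdd_meas_level.
have bA : bdd_meas A by apply: bdd_measZ; apply: bdd_meas_sum => k _; exact: bl.
have AE w : `|g j w - A w| <= N%:R^-1.
  by have /andP[h1 h2] := staircase (ltn0Sn _ : (0 < N)%N) (g01 j w);
     rewrite ler_norml /A; apply/andP; split; lra.
have EA : ev P (fun w => A w * rest w) = ev P A * Q.
  transitivity (ev P (fun w => N%:R^-1 * \sum_(k <- iota 0 N)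
      \prod_(i <- s) F (ck N k) t i w)).
    congr ev; apply/funext => w; rewrite /A -mulrA mulr_suml; congr (_ * _).
    by apply: eq_bigr => k _; rewrite E3.
  have bk k : bdd_meas (fun w => \prod_(i <- s) F (ck N k) t i w).
    by apply: bdd_meas_prod => i _; exact: bF.
  rewrite evZ; last by apply: bdd_meas_sum => k _.
  rewrite ev_sum// /A evZ; last by apply: bdd_meas_sum => k _.
  rewrite ev_sum// -mulrA mulr_suml; congr (_ * _).
  by apply: eq_bigr => k _; rewrite IH E4.
rewrite (_ : _ - _ = (ev P (fun w => g j w * rest w) - ev P (fun w => A w * rest w))
   - (ev P (g j) - ev P A) * Q); last by rewrite EA; ring.
apply: le_trans (ler_normB _ _) _.
have h1 : `|ev P (fun w => g j w * rest w) - ev P (fun w => A w * rest w)| <= N%:R^-1.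
  apply: ev_dist; [exact: bdd_measM|exact: bdd_measM|move=> w].
  rewrite -mulrBl normrM (le_trans _ (AE w))// ler_piMr//.
  by have /andP[? ?] := rest01 w; rewrite ger0_norm.
have h2 : `|(ev P (g j) - ev P A) * Q| <= N%:R^-1.
  rewrite normrM (le_trans _ (ev_dist P (bg j) bA AE))// ler_piMr//.
  by case/andP: Q01 => ? ?; rewrite ger0_norm.
lra.
Qed.

End independence.

(** * The contraction of the extended reals *)

Definition clamp {R : realType} (lo hi x : R) : R := Num.max lo (Num.min hi x).

Ltac case_clamp :=
  rewrite /clamp;
  repeat match goal with |- context [Num.min ?a ?b] => case: (leP a b) => ? end;
  repeat match goal with |- context [Num.max ?a ?b] => case: (leP a b) => ? end.

Section contraction.
Context {R : realType}.
Implicit Types (x y : \bar R) (a b : R).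
Local Notation c := (@contract R).

Lemma contract_ge_N1 x : -1 <= c x.
Proof. by have := contract_le1 x; rewrite ler_norml => /andP[]. Qed.

Lemma contract_le_1 x : c x <= 1.
Proof. by have := contract_le1 x; rewrite ler_norml => /andP[]. Qed.

Lemma contract_dist2 x y : `|c x - c y| <= 2.
Proof.
have := contract_ge_N1 x; have := contract_ge_N1 y.
have := contract_le_1 x; have := contract_le_1 y.
by rewrite ler_norml => *; apply/andP; split; lra.
Qed.

Lemma contract_fin a b : c a%:E - c b%:E =
  (a - b + (a * `|b| - b * `|a|)) / ((1 + `|a|) * (1 + `|b|)).
Proof. by rewrite /contract; field; apply/andP; split; rewrite gt_eqF// ltr_wpDr. Qed.

(** For [a] and [b] of one sign the lower bound is an equality; for opposite signs the numerator
    exceeds [a - b] by [2 a |b|]. The two bounds yield the Lipschitz constants of [contract] and of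
    its inverse on bounded sets. *)
Lemma contract_fin_bounds a b : b <= a ->
  (a - b) / ((1 + `|a|) * (1 + `|b|)) <= c a%:E - c b%:E <= a - b.
Proof.
move=> ba; rewrite contract_fin.
have a0 : 0 < 1 + `|a| by rewrite ltr_wpDr.
have b0 : 0 < 1 + `|b| by rewrite ltr_wpDr.
have ab0 : 0 < (1 + `|a|) * (1 + `|b|) by rewrite mulr_gt0.
rewrite ler_pM2r ?invr_gt0// ler_pdivrMr// mulrC.
case: (ger0P a) ba a0 b0 ab0 => ha; case: (ger0P b) => hb ba a0 b0 ab0.
- have : 0 <= (a - b) * (a + b + a * b) by rewrite mulr_ge0 ?subr_ge0// !addr_ge0 ?mulr_ge0.
  by move=> h; apply/andP; split; lra.
- have h : 0 <= a * - b by rewrite mulr_ge0// oppr_ge0 ltW.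
  have : 0 <= (a - b) * (a * - b) by rewrite mulr_ge0 ?subr_ge0.
  have := sqr_ge0 a; have := sqr_ge0 b; rewrite !expr2.
  by move=> ? ? ?; apply/andP; split; lra.
- by exfalso; lra.
- have h : 0 <= - a * - b by rewrite mulr_ge0// oppr_ge0 ltW.
  have : 0 <= (a - b) * (- a - b + - a * - b).
    by rewrite mulr_ge0 ?subr_ge0//; lra.
  by move=> ?; apply/andP; split; lra.
Qed.

Lemma contract_lip1 a b : `|c a%:E - c b%:E| <= `|a - b|.
Proof.
wlog ba : a b / b <= a.
  move=> H; have [/H//|/ltW/H] := leP b a.
  by rewrite distrC => h; rewrite (le_trans h)// distrC.
have /andP[h1 h2] := contract_fin_bounds ba.
rewrite [leRHS]ger0_norm ?subr_ge0// ger0_norm//.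
by rewrite subr_ge0 le_contract lee_fin.
Qed.

Lemma contract_expansive (M : R) a b : `|a| <= M -> `|b| <= M ->
  `|a - b| <= (1 + M) ^+ 2 * `|c a%:E - c b%:E|.
Proof.
wlog ba : a b / b <= a.
  move=> H aM bM; have [/H//|/ltW/H] := leP b a; first exact.
  by rewrite distrC => h; rewrite (le_trans (h _ _))// (distrC (c b%:E)).
move=> aM bM; have /andP[h1 h2] := contract_fin_bounds ba.
rewrite ger0_norm ?subr_ge0// ger0_norm; last by rewrite subr_ge0 le_contract lee_fin.
have M0 : 0 <= M by exact: le_trans aM.
apply: (@le_trans _ _ ((1 + M) ^+ 2 * ((a - b) / ((1 + `|a|) * (1 + `|b|))))).
  rewrite mulrA ler_pdivlMr ?mulr_gt0 ?ltr_wpDr// mulrC ler_wpM2r ?subr_ge0//.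
  by rewrite expr2 ler_pM// ?lerD2l// addr_ge0.
by rewrite ler_wpM2l// sqr_ge0.
Qed.

Lemma contract_addr x a : c x - `|a| <= c (x + a%:E)%E.
Proof.
case: x => [r| |] /=; last 2 first.
- by rewrite lerBlDr lerDl.
- by rewrite lerBlDr lerDl.
have := contract_lip1 r (r + a); rewrite opprD addNKr normrN ler_norml => /andP[_].
rewrite /contract; lra.
Qed.

Lemma contract_max x y : c (maxe x y) = Num.max (c x) (c y).
Proof.
have [xy|yx] := leP x y; first by rewrite max_r// le_contract.
by rewrite max_l// le_contract ltW.
Qed.

Lemma contract_bigmax (I : Type) (s : seq I) (F : I -> \bar R) :
  c (\big[maxe/-oo%E]_(i <- s) F i) = \big[Num.max/-1]_(i <- s) c (F i).
Proof. by elim: s => [|i s IH]; rewrite ?big_nil// !big_cons contract_max IH. Qed.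

Lemma bigmaxr_dist (I : eqType) (s : seq I) (F G : I -> R) (z e : R) : 0 <= e ->
  (forall i, i \in s -> `|F i - G i| <= e) ->
  `|\big[Num.max/z]_(i <- s) F i - \big[Num.max/z]_(i <- s) G i| <= e.
Proof.
move=> e0; elim: s => [|i s IH] H; first by rewrite !big_nil subrr normr0.
rewrite !big_cons; set A := \big[_/_]_(_ <- _) _; set B := \big[_/_]_(_ <- _) _.
have : `|A - B| <= e by apply: IH => j js; apply: H; rewrite inE js orbT.
have : `|F i - G i| <= e by apply: H; rewrite mem_head.
rewrite !ler_norml => /andP[h1 h2] /andP[h3 h4].
by case: (leP (F i) A) => ?; case: (leP (G i) B) => ?; apply/andP; split; lra.
Qed.

Lemma continuous_contract : continuous c.
Proof.
by move=> x; apply/cvgrPdist_lt => e e0; exact: (nbhsx_ballx x e e0).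
Qed.

Lemma clamp_lip lo hi a b : `|clamp lo hi a - clamp lo hi b| <= `|a - b|.
Proof.
have h1 := ler_norm (a - b); have h2 : - (a - b) <= `|a - b| by rewrite ler_normr lexx orbT.
rewrite ler_norml; case_clamp; apply/andP; split; lra.
Qed.

Lemma clamp_bounds lo hi a : lo <= hi -> lo <= clamp lo hi a <= hi.
Proof.
move=> lohi; case_clamp; apply/andP; split; lra.
Qed.

Lemma clamp_id lo hi a : lo <= a <= hi -> clamp lo hi a = a.
Proof. by move=> /andP[h1 h2]; rewrite /clamp min_r// max_r. Qed.

(** The sum of two extended reals is not a Lipschitz function of their contractions. After
    truncation at height [M] it is, because the inverse of [contract] is Lipschitz on [[-M, M]] with
    constant [(1 + M)^2]. *)
Definition truncate (M : R) x : R :=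
  match x with r%:E => clamp (- M) M r | +oo%E => M | -oo%E => - M end.

Lemma truncate_bound M x : 0 <= M -> `|truncate M x| <= M.
Proof.
move=> M0; rewrite ler_norml; case: x => [r| |] /=; [by apply: clamp_bounds; lra|lra|lra].
Qed.

Lemma truncate_id M a : `|a| <= M -> truncate M a%:E = a.
Proof. by move=> aM; rewrite /= clamp_id// -ler_norml. Qed.

(** [contract] is increasing and odd, hence commutes with clamping to a symmetric interval. *)
Lemma contract_truncate M x : 0 <= M ->
  c (truncate M x)%:E = clamp (- c M%:E) (c M%:E) (c x).
Proof.
move=> M0; have cN : c (- M)%:E = - c M%:E by rewrite -contractN.
have cM0 : 0 <= c M%:E by rewrite -(contract0 R) le_contract lee_fin.
have E' (r : R) : c (clamp (- M) M r)%:E = clamp (- c M%:E) (c M%:E) (c r%:E).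
  have E u v : (c u%:E <= c v%:E) = (u <= v) by rewrite le_contract lee_fin.
  rewrite /clamp -cN; have [h1|h1] := leP M r.
    by rewrite min_l ?E//; have [h2|h2] := leP (- M) M;
      [rewrite max_r ?E|rewrite max_l ?E// ltW].
  by rewrite min_r ?E ?(ltW h1)//; have [h2|h2] := leP (- M) r;
    [rewrite max_r ?E|rewrite max_l ?E// ltW].
case: x => [r| |]; first exact: E'.
  by rewrite [LHS]/=/clamp min_l ?contract_le_1// max_r//; lra.
rewrite [LHS]/= -[_ / _]/(c (- M)%:E) cN /clamp min_r; last first.
  by rewrite (le_trans (contract_ge_N1 0%E))// contract0.
by rewrite max_l// lerN2 contract_le_1.
Qed.

Lemma truncate_lip M x y : 0 <= M ->
  `|truncate M x - truncate M y| <= (1 + M) ^+ 2 * `|c x - c y|.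
Proof.
move=> M0; apply: le_trans (contract_expansive (truncate_bound x M0) (truncate_bound y M0)) _.
by rewrite ler_wpM2l ?sqr_ge0// !contract_truncate// clamp_lip.
Qed.

(** A substitute for the indicator of large values, affine in [contract x] between [a] and [b] so
    that it is Lipschitz up to infinity. Tail estimates in this form pass to the limit in law. *)
Definition ramp a b x : R := clamp 0 1 ((c x - c a%:E) / (c b%:E - c a%:E)).

Lemma ramp_bounds a b x : 0 <= ramp a b x <= 1.
Proof. exact: clamp_bounds. Qed.

Lemma ramp1 a b x : a < b -> (b%:E <= x)%E -> ramp a b x = 1.
Proof.
move=> ab bx; rewrite /ramp /clamp min_l ?max_r//.
have h : 0 < c b%:E - c a%:E by rewrite subr_gt0 lt_contract lte_fin.
by rewrite ler_pdivlMr// mul1r lerD2r le_contract.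
Qed.

Lemma ramp0 a b x : a < b -> (x <= a%:E)%E -> ramp a b x = 0.
Proof.
move=> ab bx; have h : 0 < c b%:E - c a%:E by rewrite subr_gt0 lt_contract lte_fin.
rewrite /ramp /clamp max_l// ge_min; apply/orP; right.
by rewrite ler_pdivrMr// mul0r subr_le0 le_contract.
Qed.

Lemma ramp_lip a b : a < b -> exists2 K : R, 0 <= K &
  forall x y, `|ramp a b x - ramp a b y| <= K * `|c x - c y|.
Proof.
move=> ab; have h : 0 < c b%:E - c a%:E by rewrite subr_gt0 lt_contract lte_fin.
exists (c b%:E - c a%:E)^-1 => [|x y]; first by rewrite invr_ge0 ltW.
apply: le_trans (clamp_lip _ _ _ _) _.
rewrite -mulrBl normrM mulrC (@ger0_norm _ _^-1) ?invr_ge0 ?(ltW h)//.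
by rewrite ler_wpM2l ?invr_ge0 ?(ltW h)// opprD addrACA subrr addr0.
Qed.

Lemma ramp_continuous a b : a < b -> continuous (ramp a b).
Proof.
move=> ab x; have [K K0 HK] := ramp_lip ab; apply/cvgrPdist_lt => e e0.
have : c y @[y --> x] --> c x by exact: continuous_contract.
move=> /cvgrPdist_lt /(_ (e / (K + 1))) h.
have K1 : 0 < K + 1 by lra.
have /h : 0 < e / (K + 1) by rewrite divr_gt0.
apply: filterS => y; rewrite ltr_pdivlMr// => hy.
apply: le_lt_trans (HK x y) _; apply: le_lt_trans hy.
by rewrite mulrC ler_wpM2l// lerDl.
Qed.

End contraction.

(** * Lipschitz functionals of finitely many contracted values *)

Section lipschitz_functionals.
Context {R : realType} {U : eqType}.
Implicit Types (H : (U -> \bar R) -> R) (f g : U -> \bar R) (D : seq U).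
Local Notation c := (@contract R).

(** The case [e = 0] says that [H] sees only the values at the points of [D] ([contract_lip_ext]).
    These are the finite-dimensional test functionals of the whole proof. *)
Definition contract_lip D H : Prop := exists2 C : R, 0 <= C &
  forall f g (e : R), 0 <= e -> (forall u, u \in D -> `|c (f u) - c (g u)| <= e) ->
    `|H f - H g| <= C * e.

Lemma contract_lip_bounded D H : contract_lip D H -> exists M, forall f, `|H f| <= M.
Proof.
move=> [C C0 HC]; exists (`|H (fun=> 0%E)| + C * 2) => f.
rewrite -[X in `|X|](subrK (H (fun=> 0%E))) addrC.
by rewrite (le_trans (ler_normD _ _))// lerD2l HC// => u _; exact: contract_dist2.
Qed.

Lemma contract_lip_at D u (F : \bar R -> R) : u \in D ->
  (exists2 K : R, 0 <= K & forall x y, `|F x - F y| <= K * `|c x - c y|) ->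
  contract_lip D (fun f => F (f u)).
Proof.
move=> uD [K K0 HK]; exists K => // f g e e0 h; apply: le_trans (HK _ _) _.
by rewrite ler_wpM2l// h.
Qed.

Lemma contract_lip_contract D u : u \in D -> contract_lip D (fun f => c (f u)).
Proof.
by move=> uD; apply: contract_lip_at => //; exists 1 => // x y; rewrite mul1r.
Qed.

Definition nice (phi : R -> R) : Prop := (forall x, 0 <= phi x <= 1) /\
  exists2 K : R, 0 <= K & forall x y, `|phi x - phi y| <= K * `|x - y|.

Definition product (s : seq (U * (R -> R))) f : R := \prod_(p <- s) p.2 (c (f p.1)).

(* The bump number [i] of a partition of unity of [0, N] by bumps of width 2. *)
Let rho (i : nat) (y : R) := clamp 0 1 (y + 1 - i%:R).
Let tau (i : nat) (y : R) := rho i y - rho i.+1 y.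

Let tau01 i y : 0 <= tau i y <= 1.
Proof.
rewrite /tau /rho -[i.+1%:R]natr1; case_clamp; apply/andP; split; lra.
Qed.

Let tau_lip i y y' : `|tau i y - tau i y'| <= 2 * `|y - y'|.
Proof.
have h j : `|rho j y - rho j y'| <= `|y - y'|.
  by apply: le_trans (clamp_lip _ _ _ _) _; rewrite opprD addrACA subrr addr0
    opprD addrACA subrr addr0.
rewrite (_ : _ - _ = (rho i y - rho i y') - (rho i.+1 y - rho i.+1 y')).
  rewrite (le_trans (ler_normB _ _))//; have := h i; have := h i.+1; lra.
by rewrite /tau; ring.
Qed.

Let tau_supp i y : tau i y != 0 -> `|y - i%:R| <= 1.
Proof.
apply: contraNle; rewrite ltr_normr => /orP H; apply/eqP.
rewrite /tau /rho -[i.+1%:R]natr1; case: H => H; case_clamp; lra.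
Qed.

Let tau_sum (N : nat) y : 0 <= y <= N%:R -> \sum_(i <- iota 0 N.+1) tau i y = 1.
Proof.
move=> /andP[y0 yN].
rewrite -[iota 0 _]/(index_iota 0 N.+1).
rewrite (@telescope_sumr_eq _ _ _ (fun i => - rho i y))//; last first.
  by move=> i _; rewrite /tau opprK addrC.
by rewrite /rho -[N.+1%:R]natr1; case_clamp; lra.
Qed.

Variables (D0 : seq U) (test : set ((U -> \bar R) -> R)).
Hypothesis test_product : forall s,
  (forall p, p \in unzip1 s -> p \in D0) -> (forall i, (i < size s)%N -> nice (nth id (unzip2 s) i)) ->
  test (product s).
Hypothesis testD : forall H H', test H -> test H' -> test (fun f => H f + H' f).
Hypothesis testZ : forall k H, test H -> test (fun f => k * H f).
Hypothesis test_unif : forall H,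
  (forall e : R, 0 < e -> exists2 H', test H' & forall f, `|H f - H' f| <= e) -> test H.

(** An approximation theorem in the style of Stone and Weierstrass. The points of [D] are removed
    one by one: a partition of unity in [contract (f u)] replaces the value at [u] by the nodes of a
    grid, at the price of one more factor in the product. The class [test] is abstract because it
    stands for convergence in one application and for measurability in another. *)
Lemma contract_lip_test H : contract_lip D0 H -> test H.
Proof.
have test0 : test (fun=> 0).
  have t1 : test (product [::]) by apply: test_product.
  by have := testZ 0 t1; under eq_fun do rewrite mul0r.
have test_sum (I : eqType) (s : seq I) (F : I -> (U -> \bar R) -> R) :
    (forall i, test (F i)) -> test (fun f => \sum_(i <- s) F i f).
  move=> tF; elim: s => [|i s IH]; first by under eq_fun do rewrite big_nil.
  by under eq_fun do rewrite big_cons; exact: testD.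
suff K D : forall s H, {subset D <= D0} ->
    (forall p, p \in unzip1 s -> p \in D0) ->
    (forall i, (i < size s)%N -> nice (nth id (unzip2 s) i)) ->
    contract_lip D H -> test (fun f => product s f * H f).
  move=> hH; rewrite (_ : H = fun f => product [::] f * H f); first exact: (K D0).
  by apply/funext => f; rewrite /product big_nil mul1r.
elim: D => [|u D IH] s {}H sub sD sn [C C0 HC].
  have E f : H f = H (fun=> 0%E).
    by apply/eqP; rewrite -subr_eq0 -normr_le0 -(mulr0 C); exact: HC.
  by under eq_fun do rewrite E mulrC; apply: testZ; exact: test_product.
apply: test_unif => e e0.
(* [y] maps the range [[-1, 1]] of [contract] onto [[0, N]], where bump [i] lives within distance 1
   of [i]. Back in [[-1, 1]] this distance is [2 / N], hence the error [C (2 / N)]. *)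
pose N := (Num.trunc (2 * C / e)).+1; have N0 : 0 < N%:R :> R by rewrite ltr0n.
have Ne : C * (2 / N%:R) <= e.
  rewrite (_ : _ * _ = 2 * C / N%:R); last by ring.
  by rewrite ler_pdivrMr// -ler_pdivrMl// mulrC ltW// truncnS_gt.
pose y (x : R) := N%:R * ((x + 1) / 2).
(* The extended real whose contraction is the node [i]; for [i = 0] and [i = N] it is infinite. *)
pose a i : \bar R := expand (2 * i%:R / N%:R - 1).
pose upd f i : U -> \bar R := fun v => if v == u then a i else f v.
pose H' f := \sum_(i <- iota 0 N.+1) tau i (y (c (f u))) * H (upd f i).
have yN x : y (c x) = N%:R * ((c x + 1) / 2) by [].
have y01 x : 0 <= y (c x) <= N%:R.
  have := contract_ge_N1 x; have := contract_le_1 x => h1 h2.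
  by rewrite yN; apply/andP; split; [rewrite mulr_ge0//; lra|rewrite ler_piMr//; lra].
have prod01 s' f : (forall i, (i < size s')%N -> nice (nth id (unzip2 s') i)) ->
    0 <= product s' f <= 1.
  rewrite /product => sn'; elim: s' sn' => [|p s' IH'] sn'.
    by rewrite big_nil ler01 lexx.
  rewrite big_cons; have /andP[h1 h2] := IH' (fun i => sn' i.+1).
  have [/(_ (c (f p.1)))/andP[h3 h4] _] := sn' 0 isT.
  by rewrite mulr_ge0//= mulr_ile1.
have HH' f : `|H f - H' f| <= C * (2 / N%:R).
  have E z : z = \sum_(i <- iota 0 N.+1) tau i (y (c (f u))) * z.
    by rewrite -mulr_suml tau_sum// mul1r.
  rewrite {1}(E (H f)) /H' -sumrB; apply: le_trans (ler_norm_sum _ _ _) _.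
  rewrite [leRHS]E [leLHS]big_seq [leRHS]big_seq.
  apply: ler_sum => i; rewrite mem_iota add0n => /andP[_ iN].
  rewrite -mulrBr normrM; have /andP[t0 t1] := tau01 i (y (c (f u))).
  rewrite ger0_norm//; have [->|t] := eqVneq (tau i (y (c (f u)))) 0; first by rewrite !mul0r.
  rewrite ler_wpM2l//; apply: (HC _ _ (2 / N%:R)); first by rewrite divr_ge0 ?ler0n.
  move=> v _; rewrite /upd; case: eqP => [->|_]; last first.
    by rewrite subrr normr0 divr_ge0 ?ler0n.
  have iN' : i%:R <= N%:R :> R by rewrite ler_nat -ltnS.
  have q0 : 0 <= 2 * i%:R / N%:R :> R by rewrite divr_ge0 ?mulr_ge0 ?ler0n.
  have q2 : 2 * i%:R / N%:R <= 2 :> R by rewrite ler_pdivrMr// ler_wpM2l.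
  rewrite /a expandK; last by rewrite inE ler_norml; apply/andP; split; lra.
  have := tau_supp t; rewrite yN => h.
  rewrite (_ : _ - _ = (2 / N%:R) * (N%:R * ((c (f u) + 1) / 2) - i%:R)); last first.
    by field; rewrite gt_eqF.
  by rewrite normrM ger0_norm ?divr_ge0// ?(ltW N0)// ler_piMr// divr_ge0.
exists (fun f => product s f * H' f); last first.
  move=> f; rewrite -mulrBr normrM; have /andP[p0 p1] := prod01 s f sn.
  by rewrite ger0_norm// (le_trans _ (le_trans (HH' f) Ne))// ler_piMl.
rewrite (_ : (fun _ => _) = fun f => \sum_(i <- iota 0 N.+1)
    product ((u, fun x => tau i (y x)) :: s) f * H (upd f i)); last first.
  apply/funext => f; rewrite mulr_sumr; apply: eq_bigr => i _.
  by rewrite /product big_cons /= mulrA; congr (_ * _); rewrite mulrC.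
apply: test_sum => i; apply: IH.
- by move=> v vD; apply: sub; rewrite inE vD orbT.
- by move=> p; rewrite inE => /predU1P[->|]; [apply: sub; rewrite mem_head|exact: sD].
- case=> [_|j]; last exact: sn.
  split=> [x|] /=; first exact: tau01.
  exists N%:R => [|x x']; first exact: ltW.
  apply: le_trans (tau_lip _ _ _) _; rewrite /y -mulrBr -mulrBl opprD addrACA subrr addr0.
  rewrite !normrM (@ger0_norm _ N%:R) ?(ltW N0)// (@ger0_norm _ 2^-1)//.
  by rewrite (_ : 2 * _ = N%:R * `|x - x'|)//; field.
- exists C => // f g e' e'0 h; apply: HC => // v; rewrite inE /upd.
  by case: eqP => //= _ vD; [rewrite subrr normr0|exact: h].
Qed.

End lipschitz_functionals.

(** * The Airy function *)

Section airy_function.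
Context {R : realType}.
Local Notation mu := (@lebesgue_measure R).
Implicit Types x u m M : R.

Let phi x u : R := u ^+ 3 / 3 + x * u.

Definition airy_trunc M x : R := \int[mu]_(u in `[0, M]) cos (phi x u).

Let phi_is_derive x u : is_derive u 1 (phi x) (u ^+ 2 + x).
Proof.
rewrite /phi; apply: is_derive_eq.
  by rewrite /GRing.scale/= !mulr1; field.
Qed.

Let phi_continuous x : continuous (phi x).
Proof.
move=> u; apply: differentiable_continuous; apply/derivable1_diffP.
by case: (phi_is_derive x u).
Qed.

Let cos_phi_continuous x : continuous (cos \o phi x).
Proof. move=> u; apply: continuous_comp; [exact: phi_continuous|exact: continuous_cos]. Qed.

Lemma airy_integrable x m M : mu.-integrable `[m, M] (EFin \o (fun u => cos (phi x u))).
Proof.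
apply: continuous_compact_integrable; first exact: segment_compact.
exact/continuous_subspaceT/cos_phi_continuous.
Qed.

(* (sin (phi u) - s) / (u^2 + x) has derivative cos (phi u) minus a term of the sign of - s. *)
Let primitive s x u : R := (sin (phi x u) - s) * (u ^+ 2 + x)^-1.
Let dprimitive s x u : R :=
  cos (phi x u) - (sin (phi x u) - s) * (2 * u / (u ^+ 2 + x) ^+ 2).

Let primitive_is_derive s x u : u ^+ 2 + x != 0 ->
  is_derive u 1 (primitive s x) (dprimitive s x u).
Proof.
move=> ux; rewrite /primitive.
have h1 : is_derive u 1 (fun u => sin (phi x u) - s) ((u ^+ 2 + x) * cos (phi x u)).
  have h2 : is_derive u 1 (sin \o phi x) ((u ^+ 2 + x) * cos (phi x u)).
    by have := is_derive1_comp (is_derive_sin (phi x u)) (phi_is_derive x u);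
      rewrite mulrC.
  by apply: is_derive_eq; rewrite subr0.
have h3 : is_derive u 1 (fun u : R => (u ^+ 2 + x)^-1) (- (2 * u) / (u ^+ 2 + x) ^+ 2).
  have h4 : is_derive u 1 (fun u : R => u ^+ 2 + x) (2 * u).
    by apply: is_derive_eq; rewrite /GRing.scale/= !mulr1 addr0; ring.
  apply: is_derive_eq; rewrite /GRing.scale/=.
  by rewrite !mulNr mulrC.
apply: is_derive_eq; rewrite /GRing.scale/= /dprimitive.
by field.
Qed.

Let oscillation_side s x m M : 0 < m -> m < M -> 0 < m ^+ 2 + x ->
  (\int[mu]_(u in `[m, M]) (dprimitive s x u)%:E = (primitive s x M)%:E - (primitive s x m)%:E)%E
  /\ mu.-integrable `[m, M] (EFin \o dprimitive s x).
Proof.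
move=> m0 mM mx.
have pos u : m <= u -> 0 < u ^+ 2 + x.
  move=> mu; apply: lt_le_trans mx _; rewrite lerD2r ler_sqr// nnegrE; lra.
have cd u : m <= u -> {for u, continuous (dprimitive s x)}.
  move=> mu; rewrite /dprimitive; apply: cvgB; first exact: cos_phi_continuous.
  apply: cvgM.
    apply: cvgB; last exact: cvg_cst.
    by apply: continuous_comp; [exact: phi_continuous|exact: continuous_sin].
  apply: cvgM; first by apply: cvgM; [exact: cvg_cst|exact: cvg_id].
  apply: cvgV; first by rewrite expf_neq0// gt_eqF// pos.
  have h : continuous (fun u : R => u ^+ 2 + x).
    by move=> v; apply: cvgD; [exact: exprn_continuous|exact: cvg_cst].
  exact: (cvg_comp _ _ (h u) (@exprn_continuous R 2 _)).
have cw : {within `[m, M], continuous (dprimitive s x)}.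
  apply: continuous_in_subspaceT => u /set_mem; rewrite /= in_itv/= => /andP[mu _].
  exact: cd.
have dp u : m <= u -> is_derive u 1 (primitive s x) (dprimitive s x u).
  by move=> mu; apply: primitive_is_derive; rewrite gt_eqF// pos.
have cp u : m <= u -> {for u, continuous (primitive s x)}.
  move=> mu; apply: differentiable_continuous; apply/derivable1_diffP.
  by case: (dp u mu).
split; last by apply: continuous_compact_integrable => //; exact: segment_compact.
apply: continuous_FTC2 => //.
  split.
  - move=> u; rewrite in_itv/= => /andP[/ltW mu _].
    by case: (dp u mu).
  - exact/cvg_at_right_filter/cp.
  - exact/cvg_at_left_filter/cp/ltW.
move=> u; rewrite in_itv/= => /andP[/ltW mu _].
by rewrite derive1E; have [_ ->] := dp u mu.
Qed.

(** The derivatives of the primitives with [s = -1] and [s = 1] are a minorant and a majorant of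
    [cos (phi x u)], because [sin - s] has a constant sign. Integration leaves boundary terms,
    bounded by [2 / (m^2 + x)]. *)
Lemma airy_trunc_dist x m M : 0 < m -> m <= M -> 0 < m ^+ 2 + x ->
  `|airy_trunc M x - airy_trunc m x| <= 2 / (m ^+ 2 + x).
Proof.
move=> m0; rewrite le_eqVlt => /predU1P[<- mx|mM mx].
  by rewrite subrr normr0 divr_ge0// ltW.
have pos u : m <= u -> 0 < u ^+ 2 + x.
  move=> mu; apply: lt_le_trans mx _; rewrite lerD2r ler_sqr// nnegrE; lra.
have -> : airy_trunc M x - airy_trunc m x = \int[mu]_(u in `[m, M]) cos (phi x u).
  rewrite /airy_trunc (@Rintegral_itvB _ (fun u => cos (phi x u)) (BLeft 0) (BRight M) m).
  - rewrite Rintegral_itv_obnd_cbnd//.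
    by apply: integrableS (airy_integrable x m M) => //; exact: subset_itv_oc_cc.
  - exact: airy_integrable.
  - by rewrite bnd_simp ltW.
  - by rewrite bnd_simp ltW.
have key s : (\int[mu]_(u in `[m, M]) dprimitive s x u) = primitive s x M - primitive s x m.
  by rewrite /Rintegral (oscillation_side s m0 mM mx).1.
have int s : mu.-integrable `[m, M] (EFin \o dprimitive s x).
  exact: (oscillation_side s m0 mM mx).2.
have sg u : m <= u -> 0 <= 2 * u / (u ^+ 2 + x) ^+ 2.
  by move=> mu; rewrite divr_ge0 ?sqr_ge0// mulr_ge0//; lra.
have hM : 0 <= (M ^+ 2 + x)^-1 by rewrite invr_ge0 ltW// pos// ltW.
have hm : 0 <= (m ^+ 2 + x)^-1 by rewrite invr_ge0 ltW// pos.
rewrite ler_norml; apply/andP; split.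
  apply: (@le_trans _ _ (\int[mu]_(u in `[m, M]) dprimitive (-1) x u)); last first.
    apply: le_Rintegral => //; first exact: airy_integrable.
    move=> u; rewrite /= in_itv/= => /andP[mu _]; rewrite /dprimitive lerBlDr lerDl.
    by rewrite mulr_ge0 ?sg// opprK -lerBlDr sub0r sin_geN1.
  rewrite key /primitive.
  have h1 : 0 <= (sin (phi x M) - -1) * (M ^+ 2 + x)^-1.
    by rewrite mulr_ge0// opprK -lerBlDr sub0r sin_geN1.
  have h2 : (sin (phi x m) - -1) * (m ^+ 2 + x)^-1 <= 2 * (m ^+ 2 + x)^-1.
    by rewrite ler_wpM2r//; have := sin_le1 (phi x m); lra.
  lra.
apply: (@le_trans _ _ (\int[mu]_(u in `[m, M]) dprimitive 1 x u)).
  apply: le_Rintegral => //; first exact: airy_integrable.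
  move=> u; rewrite /= in_itv/= => /andP[mu _]; rewrite /dprimitive lerBrDr gerDl.
  by rewrite mulr_le0_ge0 ?sg// subr_le0 sin_le1.
rewrite key /primitive.
have h1 : (sin (phi x M) - 1) * (M ^+ 2 + x)^-1 <= 0.
  by rewrite mulr_le0_ge0// subr_le0 sin_le1.
have h2 : - (2 * (m ^+ 2 + x)^-1) <= (sin (phi x m) - 1) * (m ^+ 2 + x)^-1.
  by rewrite -mulNr ler_wpM2r//; have := sin_geN1 (phi x m); lra.
lra.
Qed.

(** [airy] is defined through [lim], whose value is meaningful only once the truncated integrals are
    known to converge. *)
Lemma airy_trunc_cvg x : airy_trunc M x @[M --> +oo] --> pi * airy x.
Proof.
have -> : pi * airy x = lim (airy_trunc M x @[M --> +oo]).
  by rewrite /airy mulrA divff ?mul1r// gt_eqF// pi_gt0.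
apply: (@cauchy_cvg R); apply: cauchy_exP => e e0.
(* As [m >= 1], [m^2 + x >= m - |x|], which exceeds [2 / e]. *)
pose m := `|x| + 1 + 2 / e.
have e20 : 0 < 2 / e by rewrite divr_gt0.
have m1 : 1 <= m by rewrite /m; have := normr_ge0 x; lra.
have mx : 2 / e < m ^+ 2 + x.
  have : m <= m ^+ 2 by rewrite expr2 ler_peMl//; lra.
  by have := ler_norm (- x); rewrite normrN /m; lra.
exists (airy_trunc m x); exists m; split; first exact: num_real.
move=> M mM; rewrite /ball/= distrC; apply: le_lt_trans (airy_trunc_dist _ (ltW mM) _) _.
- lra.
- lra.
by rewrite ltr_pdivrMr; [rewrite mulrC -ltr_pdivrMr//; lra|lra].
Qed.

Lemma measurable_airy_trunc M : measurable_fun setT (airy_trunc M).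
Proof.
(* Tonelli's theorem wants a nonnegative integrand: 1 is added to the cosine, and the length [l] of
   the interval is subtracted in the end. *)
pose f (p : R * measurableTypeR R) : \bar R := ((cos (phi p.1 p.2) + 1) * \1_(`[0, M]) p.2)%:E.
have mf : measurable_fun setT f.
  apply/measurable_EFinP/measurable_funM; last first.
    by apply: measurableT_comp; [exact: measurable_indic|exact: measurable_snd].
  apply: measurable_funD; last exact: measurable_cst.
  apply: measurableT_comp; first exact: (continuous_measurable_fun (@continuous_cos R)).
  apply: measurable_funD.
    by apply: measurable_funM; [apply: measurable_funX; exact: measurable_snd|exact: measurable_cst].
  by apply: measurable_funM; [exact: measurable_fst|exact: measurable_snd].
have f0 p : (0 <= f p)%E.
  by rewrite lee_fin mulr_ge0// -lerBlDr sub0r cos_geN1.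
have mF : measurable_fun setT (fubini_F mu f) := measurable_fun_fubini_tonelli_F _ mf f0.
pose l := fine (mu `[0, M]).
rewrite (_ : airy_trunc M = fun x => fine (fubini_F mu f x) - l); last first.
  apply/funext => x; rewrite /fubini_F/= /airy_trunc /Rintegral.
  pose I : set R := `[0, M]%classic.
  have -> : (\int[mu]_y (f (x, y)) = \int[mu]_(u in I) (cos (phi x u) + 1)%R%:E)%E.
    rewrite [RHS]integral_mkcond; apply: eq_integral => y _.
    rewrite /f/= patchE indicE /I; case: ifPn => _; first by rewrite mulr1.
    by rewrite mulr0.
  have fin0 : (mu I < +oo)%E by rewrite /I lebesgue_measure_itv/=; case: ifP => _; rewrite ltry.
  have i1 : mu.-integrable `[0, M] (EFin \o cst (1:R)).
    apply: continuous_compact_integrable; first exact: segment_compact.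
    exact/continuous_subspaceT/cst_continuous.
  have H := @RintegralD _ _ _ mu `[0, M] (fun u => cos (phi x u)) (cst 1) _
    (airy_integrable x 0 M) _.
  rewrite /Rintegral in H; rewrite H//.
  have E1 : (\int[mu]_(y in I) (cst (1:R) y)%:E = mu I)%E.
    rewrite -[RHS]mul1e.
    exact: (@integral_cst _ _ R mu I (measurable_itv `[0, M]) 1%R%:E).
  by rewrite E1 addrK.
apply: measurable_funB; last exact: measurable_cst.
by apply: measurableT_comp => //; exact: fine_measurable.
Qed.

Lemma measurable_airy : measurable_fun setT (@airy R).
Proof.
rewrite (_ : @airy R = fun x => pi^-1 * (pi * airy x)); last first.
  by apply/funext => x; rewrite mulKf// gt_eqF// pi_gt0.
apply: measurable_funM; first exact: measurable_cst.
apply: (measurable_fun_cvg (h := fun n => airy_trunc n%:R)) => [n|x _].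
  exact: measurable_airy_trunc.
by have /cvg_pinftyP H := @airy_trunc_cvg x; exact: (H (fun n => n%:R) cvgr_idn).
Qed.

(** The kernel on its diagonal, that is the mean density of the points at one time. *)
Definition airy_density x : R := \int[mu]_(l in `[0, +oo[) (airy (x + l) * airy (x + l)).

Lemma extended_airy_kernel_diag (t x : R) : extended_airy_kernel (t, x) (t, x) = airy_density x.
Proof.
rewrite /extended_airy_kernel lexx; congr Rintegral; apply/funext => l.
by rewrite subrr mulr0 oppr0 expR0 mul1r.
Qed.

Lemma extended_airy_kernel_sym (t x y : R) :
  extended_airy_kernel (t, x) (t, y) = extended_airy_kernel (t, y) (t, x).
Proof.
rewrite /extended_airy_kernel lexx; congr Rintegral; apply/funext => l.
by rewrite mulrAC.
Qed.

Lemma airy_density_ge0 x : 0 <= airy_density x.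
Proof. by apply: Rintegral_ge0 => l _; rewrite -expr2 sqr_ge0. Qed.

Lemma measurable_airy_density : measurable_fun setT airy_density.
Proof.
pose f (p : R * measurableTypeR R) : \bar R := ((airy (p.1 + p.2)) ^+ 2 * \1_(`[0, +oo[) p.2)%:E.
have mf : measurable_fun setT f.
  apply/measurable_EFinP/measurable_funM; last first.
    by apply: measurableT_comp; [exact: measurable_indic|exact: measurable_snd].
  apply: measurable_funX; apply: measurableT_comp; first exact: measurable_airy.
  by apply: measurable_funD; [exact: measurable_fst|exact: measurable_snd].
have f0 p : (0 <= f p)%E by rewrite lee_fin mulr_ge0// sqr_ge0.
have mF : measurable_fun setT (fubini_F mu f) := measurable_fun_fubini_tonelli_F _ mf f0.
rewrite (_ : airy_density = fun x => fine (fubini_F mu f x)); last first.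
  apply/funext => x; rewrite /fubini_F/= /airy_density /Rintegral; congr fine.
  rewrite integral_mkcond; apply: eq_integral => y _.
  rewrite /f/= patchE indicE expr2; case: ifPn => _; first by rewrite mulr1.
  by rewrite mulr0.
by apply: measurableT_comp => //; exact: fine_measurable.
Qed.

End airy_function.

(** * The Airy point process *)

Section integral_domination.
Context d (T : measurableType d) {R : realType} (mu : {measure set T -> \bar R}).
Local Open Scope ereal_scope.

(* No measurability: the integral of a function is a supremum over simple functions. *)
Lemma integral_dominated (D : set T) (f g : T -> \bar R) :
  (forall x, D x -> 0 <= g x) -> (forall x, D x -> f x <= g x) ->
  \int[mu]_(x in D) f x <= \int[mu]_(x in D) g x.
Proof.
move=> g0 fg; rewrite integralE.
apply: (@le_trans _ _ (\int[mu]_(x in D) f^\+ x)).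
  have h : 0 <= \int[mu]_(x in D) f^\- x by apply: integral_ge0 => x _; exact: funeneg_ge0.
  by rewrite -[leRHS]sube0 leeB.
rewrite ge0_integralE; last by move=> x _; exact: funepos_ge0.
rewrite ge0_integralE//; apply: le_ereal_sup => _ [h hf <-]; exists h => //.
move=> x; apply: le_trans (hf x) _; rewrite !patchE; case: ifPn => // xD.
by rewrite funeposE ge_max fg ?g0//; exact: set_mem.
Qed.

End integral_domination.

Section counting.
Context {R : realType} {T : choiceType}.
Implicit Types (X : set T) (s : seq T).

Lemma counting_ge X s : uniq s -> (forall x, x \in s -> X x) ->
  ((size s)%:R%:E <= counting X :> \bar R)%E.
Proof.
move=> us sX; rewrite /counting; case: asboolP => [fX|_]; last exact: leey.
rewrite lee_fin ler_nat.
apply: (uniq_leq_size us) => x /sX Xx.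
by have := in_fset_set fX x; rewrite mem_set.
Qed.

Lemma counting_le X (y : \bar R) :
  (forall s, uniq s -> (forall x, x \in s -> X x) -> ((size s)%:R%:E <= y)%E) ->
  (counting X <= y)%E.
Proof.
move=> H; rewrite /counting; case: asboolP => [fX|iX].
  by apply: H; [exact: fset_uniq|move=> x; rewrite in_fset_set// => /set_mem].
rewrite leye_eq; apply/eqP; case: y H => [r| |] H //.
  have [B BX cB] := infinite_set_fset (Num.trunc r).+1 iX.
  have := H (enum_fset B) (fset_uniq B) (fun x xB => BX x xB).
  rewrite lee_fin => h; have := truncnS_gt r; rewrite ltNge (le_trans _ h)// ler_nat.
  exact: cB.
have /(_ (fun x xs => ltac:(by []))) := H [::] isT.
by rewrite leNgt ltNyr.
Qed.

End counting.

Section point_counts.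
Context {R : realType} (T : Type) (x : T -> nat -> R) (E : set R).

Definition hits (J : nat) (w : T) : seq nat := [seq i <- iota 0 J | x w i \in E].

(** The cut-off at index [J] keeps the number of points a bounded variable; [J] tends to infinity in
    [airy_nhits_cvg]. *)
Definition nhits J w : R := (size (hits J w))%:R.

Lemma nhitsE J w : nhits J w = \sum_(i <- iota 0 J) \1_E (x w i).
Proof.
rewrite /nhits size_filter -sum1_count natr_sum [LHS]big_mkcond/=.
by apply: eq_bigr => i _; rewrite indicE; case: (_ \in _).
Qed.

Lemma nhits_nondecreasing w : {homo (fun J => nhits J w) : J K / (J <= K)%N >-> J <= K}.
Proof.
move=> J K JK; rewrite ler_nat /hits -(subnK JK) addnC iotaD filter_cat size_cat.
exact: leq_addr.
Qed.

End point_counts.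

Section ensemble.
Context {R : realType} d (T : measurableType d) (P : probability T R) (A : T -> nat -> R -> R).
Hypothesis HA : parabolic_airy_line_ensemble P A.
Variable v : R.
Local Notation leb := (@lebesgue_measure R).

(** Point [i] belongs to line [i + 1], as lines are numbered from 1. Adding the parabola back makes
    the intensity the same at all times [v]. *)
Definition airy_point (w : T) (i : nat) : R := A w i.+1 v + v ^+ 2.

Lemma measurable_airy_point i : measurable_fun setT (airy_point ^~ i).
Proof.
have [Hc _ _] := HA; apply: measurable_funD; last exact: measurable_cst.
by have [+ _] := Hc i.+1 isT; apply.
Qed.

Lemma airy_point_decr w i j : (i < j)%N -> airy_point w j < airy_point w i.
Proof.
have [_ Hd _] := HA; rewrite /airy_point ltrD2r.
elim: j => // j IH; rewrite ltnS leq_eqVlt => /predU1P[->|/IH]; first exact: Hd.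
exact/lt_trans/Hd.
Qed.

Variable E : set R.
Hypotheses (mE : measurable E) (bE : bounded_set E).

Let tm : {measure set (R * measurableTypeR R) -> \bar R} := times_measure [:: v].
Let B : set (R * measurableTypeR R) := [set v] `*` (E : set (measurableTypeR R)).

Let mB : measurable B.
Proof. by apply: measurableX. Qed.

Let bB : bounded_set (B : set (R * R)%type).
Proof.
have [M [Mr HM]] := bE; exists (Num.max M `|v|); split; first exact: num_real.
move=> x; rewrite gt_max => /andP[Mx vx] [a b] [/= -> Eb].
by rewrite prod_normE/= ge_max (ltW vx)/=; exact: HM.
Qed.

Let pairv (x : measurableTypeR R) : R * measurableTypeR R := (v, x).

Let mpairv : measurable_fun setT pairv.
Proof. by apply: measurable_fun_pair; [exact: measurable_cst|exact: measurable_id]. Qed.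

Let tmE (C : set (R * measurableTypeR R)) : measurable C -> tm C = pushforward leb pairv C.
Proof.
move=> mC.
have -> : tm C = (\int[msum (fun j => dirac (nth 0%R [:: v] j) : {measure set R -> \bar R}) 1]_x
    (leb \o xsection C) x)%E by [].
rewrite ge0_integral_measure_sum//; last first.
  by apply: measurable_fun_xsection.
rewrite big_ord1 /= integral_dirac//; last exact: measurable_fun_xsection.
rewrite diracT mul1e /= /pushforward; congr (leb _).
by apply/seteqP; split => y /= => [/xsectionP|h]; last exact/xsectionP.
Qed.

Let int_tm (f : R * measurableTypeR R -> \bar R) : measurable_fun setT f ->
  (forall z, (0 <= f z)%E) ->
  (\int[tm]_(z in B) f z = \int[leb]_(x in E) f (v, x))%E.
Proof.
move=> mf f0.
rewrite (@eq_measure_integral _ _ _ _ (pushforward leb pairv)); last by move=> C mC _; exact: tmE.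
rewrite ge0_integral_pushforward//; last exact: measurable_funTS.
by congr integral; apply/seteqP; split => y //= [].
Qed.

Definition airy_intensity : \bar R := (\int[leb]_(x in E) (airy_density x)%:E)%E.

Let K := @extended_airy_kernel R.

Let count (k : nat) (w : T) : \bar R :=
  counting [set s : seq (nat * 'I_1) | [/\ uniq s, size s = k &
        forall l i, (l < k)%N -> B ((let t := nth 0 [:: v] (nth i s l).2 in
             (t, A w (nth i s l).1.+1 t + t ^+ 2)))]].

Let airy_pointE w (ij : nat * 'I_1) :
  (let t := nth 0 [:: v] ij.2 in (t, A w ij.1.+1 t + t ^+ 2)) = (v, airy_point w ij.1).
Proof. by rewrite /= (ord1 ij.2). Qed.

Let moment (k : nat) : (\int[P]_w count k w)%E =
  iterated_integral tm (nseq k B) (kernel_det K).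
Proof.
have [_ _ /(_ [:: v] isT) Hdet] := HA.
rewrite -Hdet => [|l]; last first.
  by rewrite size_nseq => lk; rewrite nth_nseq lk.
rewrite /count size_nseq; congr integral; apply/funext => w; congr counting.
apply/seteqP; split => s [us sk H]; split => // l i lk;
  by have := H l i lk; rewrite nth_nseq lk.
Qed.

Let kernel_det1 z : kernel_det K [:: z] = K z z.
Proof. by rewrite /kernel_det det_mx11 mxE. Qed.

Let kernel_det2 z z' : kernel_det K [:: z; z'] = K z z * K z' z' - K z z' * K z' z.
Proof.
rewrite /kernel_det (expand_det_row _ 0) !big_ord_recl big_ord0 addr0 /cofactor.
by rewrite !det_mx11 !mxE /= !expr0 !expr1; ring.
Qed.

Lemma airy_first_moment : (\int[P]_w count 1 w = airy_intensity)%E.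
Proof.
rewrite moment /= /airy_intensity -(int_tm (f := fun z => (airy_density z.2)%:E)) //=.
- by apply: eq_integral => -[t x] _; rewrite kernel_det1 /K extended_airy_kernel_diag.
- apply/measurable_EFinP; apply: measurableT_comp; first exact: measurable_airy_density.
  exact: measurable_snd.
- by move=> z; rewrite lee_fin airy_density_ge0.
Qed.

(** At a single time the kernel is symmetric, so the 2 by 2 determinant is
    [K(x,x) K(y,y) - K(x,y)^2], at most the product of the diagonal terms: the points repel each
    other. *)
Lemma airy_second_moment : (\int[P]_w count 2 w <= airy_intensity * airy_intensity)%E.
Proof.
pose k (z : R * measurableTypeR R) : \bar R := (airy_density z.2)%:E.
have mk : measurable_fun setT k.
  apply/measurable_EFinP; apply: measurableT_comp; first exact: measurable_airy_density.
  exact: measurable_snd.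
have k0 z : (0 <= k z)%E by rewrite lee_fin airy_density_ge0.
have kB : (\int[tm]_(z in B) k z = airy_intensity)%E by rewrite int_tm.
rewrite moment /=.
apply: (@le_trans _ _ (\int[tm]_(z in B) (k z * airy_intensity))%E); last first.
  by rewrite ge0_integralZr//; [rewrite kB|exact: measurable_funTS|rewrite -kB integral_ge0].
apply: integral_dominated => z Bz; first by rewrite mule_ge0// -kB integral_ge0.
apply: (@le_trans _ _ (\int[tm]_(z' in B) (k z * k z'))%E); last first.
  by rewrite ge0_integralZl//; [rewrite kB|exact: measurable_funTS].
apply: integral_dominated => z' Bz'; first by rewrite mule_ge0.
rewrite kernel_det2 /k lee_fin; case: z z' Bz Bz' => t x [t' x'] [tv _] [tv' _].
have {}tv : t = v := tv; have {}tv' : t' = v := tv'; subst t t'.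
change (K (v, x) (v, x) * K (v, x') (v, x') - K (v, x) (v, x') * K (v, x') (v, x) <=
  airy_density x * airy_density x').
rewrite /K !extended_airy_kernel_diag (extended_airy_kernel_sym v x' x) lerBlDr lerDl.
by rewrite -expr2 sqr_ge0.
Qed.

Let measurable_indic_point i : bdd_meas (fun w => \1_E (airy_point w i) : R).
Proof.
split; first by apply: measurableT_comp; [exact: measurable_indic|exact: measurable_airy_point].
by exists 1 => w; rewrite indicE ger0_norm// lern1 leq_b1.
Qed.

Let bdd_meas_nhits J : bdd_meas (nhits airy_point E J).
Proof.
rewrite (_ : nhits _ _ _ = fun w => \sum_(i <- iota 0 J) \1_E (airy_point w i)).
  by apply: bdd_meas_sum => i _; exact: measurable_indic_point.
by apply/funext => w; rewrite nhitsE.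
Qed.

Let nhits_le_count J w : ((nhits airy_point E J w)%:E <= count 1 w)%E.
Proof.
rewrite /nhits -(size_map (fun i => [:: (i, ord0 : 'I_1)])); apply: counting_ge.
  rewrite map_inj_uniq; last by move=> i j [].
  exact/filter_uniq/iota_uniq.
move=> s /mapP[i]; rewrite mem_filter => /andP[/set_mem Ei _] ->; split => //= l i' l1.
by move: l1; rewrite ltnS leqn0 => /eqP ->; split.
Qed.

Let nhits2_le_count J w :
  ((nhits airy_point E J w * nhits airy_point E J w - nhits airy_point E J w)%:E <= count 2 w)%E.
Proof.
pose h := hits airy_point E J w.
have uh : uniq h by exact/filter_uniq/iota_uniq.
(* The ordered pairs of distinct indices among [N] hits are [N^2 - N] in number. *)
pose s := [seq p <- [seq (i, j) | i <- h, j <- h] | p.1 != p.2].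
have us : uniq s by apply: filter_uniq; apply: allpairs_uniq => // -[? ?] [? ?].
have ss : (size s)%:R = nhits airy_point E J w * nhits airy_point E J w - nhits airy_point E J w.
  apply/eqP; rewrite eq_sym subr_eq eq_sym /nhits -natrM -natrD eqr_nat; apply/eqP.
  rewrite /s size_filter -(size_allpairs pair) -(count_predC (fun p : nat * nat => p.1 != p.2)).
  congr (_ + _)%N; rewrite count_flatten -map_comp/=.
  rewrite -[LHS]mul1n -sum1_size sumnE big_map big_distrr/= big_seq [RHS]big_seq.
  apply: eq_bigr => i ih; rewrite muln1 count_map.
  rewrite (eq_count (a2 := pred1 i)); first by rewrite count_uniq_mem// ih.
  by move=> j /=; rewrite negbK eq_sym.
rewrite -ss -(size_map (fun p : nat * nat => [:: (p.1, ord0 : 'I_1); (p.2, ord0)])).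
apply: counting_ge.
  by rewrite map_inj_uniq// => -[? ?] [? ?] [] -> ->.
move=> q /mapP[[i j]]; rewrite mem_filter /= => /andP[ij /allpairsP[[i' j'] [/= + + [ii jj]]]].
rewrite -{}ii -{}jj !mem_filter => /andP[/set_mem Ei _] /andP[/set_mem Ej _] ->; split => //=.
  by rewrite inE xpair_eqE negb_and ij.
by move=> [|[|l]] // i0 _; split.
Qed.

Let count1_le w : (count 1 w <= ereal_sup (range (fun J => (nhits airy_point E J w)%:E)))%E.
Proof.
apply: counting_le => s us Hs.
pose l := [seq (head (0%N, ord0) q).1 | q <- s].
have HE q : q \in s -> q = [:: ((head (0%N, ord0) q).1, ord0)] /\ airy_point w (head (0%N, ord0) q).1 \in E.
  move=> /Hs [_]; case: q => [|ij [|? ?]]//= _ /(_ 0 ij isT) /=.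
  rewrite [nth _ _ _]/= => -[_ /=]; case: ij => i j; rewrite (ord1 j) /= => Ei.
  by split => //; apply/mem_set.
have ul : uniq l.
  rewrite map_inj_in_uniq// => q q' /HE[-> _] /HE[-> _] /= -> //.
apply: ereal_sup_ge; exists ((nhits airy_point E (\max_(i <- l) i).+1 w)%:E); first by exists (\max_(i <- l) i).+1.
rewrite lee_fin ler_nat -(size_map (fun q => (head (0%N, ord0) q).1)).
apply: (uniq_leq_size ul) => i /mapP[q qs ->]; rewrite mem_filter (HE q qs).2 andTb.
rewrite mem_iota leq0n add0n ltnS; apply: leq_bigmax_seq => //; exact: map_f.
Qed.

Lemma airy_nhits_cvg :
  (ev P (nhits airy_point E J))%:E @[J --> \oo] --> airy_intensity.
Proof.
have h J : (\int[P]_w (nhits airy_point E J w)%:E)%E = (ev P (nhits airy_point E J))%:E.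
  by rewrite -ev_expectation// unlock.
under eq_fun do rewrite -h.
have nd w : nondecreasing_seq (fun J => (nhits airy_point E J w)%:E).
  by move=> J K' JK; rewrite lee_fin; exact: nhits_nondecreasing.
have -> : airy_intensity = (\int[P]_w limn (fun J => (nhits airy_point E J w)%:E))%E.
  rewrite -airy_first_moment; apply: eq_integral => w _.
  rewrite (cvg_lim _ (ereal_nondecreasing_cvgn (nd w)))//.
  apply/eqP; rewrite eq_le count1_le /=.
  by apply: ge_ereal_sup => _ [J _ <-]; exact: nhits_le_count.
apply: cvg_monotone_convergence => //.
- by move=> J; apply/measurable_EFinP; case: (bdd_meas_nhits J).
- by move=> J w _; rewrite lee_fin.
Qed.

Lemma airy_nhits_le J : ((ev P (nhits airy_point E J))%:E <= airy_intensity)%E.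
Proof.
rewrite -airy_first_moment -ev_expectation// unlock.
by apply: integral_dominated => w _; [exact: (counting_ge (s := [::]))|exact: nhits_le_count].
Qed.

Hypothesis finE : airy_intensity \is a fin_num.
Let kappa := fine airy_intensity.

Let ev_nhits_cvg : ev P (nhits airy_point E J) @[J --> \oo] --> kappa.
Proof.
have := airy_nhits_cvg; rewrite -(fineK finE) => /fine_cvgP[_].
by apply.
Qed.

Let ev_nhits2 J : ev P (fun w => nhits airy_point E J w * nhits airy_point E J w)
  <= kappa ^+ 2 + ev P (nhits airy_point E J).
Proof.
have b := bdd_meas_nhits J.
have bb := bdd_measM b b.
rewrite -lerBlDr -evB// -lee_fin.
have -> : (ev P (fun w => nhits airy_point E J w * nhits airy_point E J w -
    nhits airy_point E J w))%:E = (\int[P]_w (nhits airy_point E J w *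
    nhits airy_point E J w - nhits airy_point E J w)%:E)%E.
  by rewrite -ev_expectation ?unlock//; exact: bdd_measB.
apply: (@le_trans _ _ (\int[P]_w count 2 w)%E).
  by apply: integral_dominated => w _; [exact: (counting_ge (s := [::]))|exact: nhits2_le_count].
by apply: le_trans airy_second_moment _; rewrite -(fineK finE) -EFinM expr2.
Qed.

Lemma measurable_airy_event J : measurable [set w | forall i, (i < J)%N -> ~ E (airy_point w i)].
Proof.
rewrite (_ : [set _ | _] = \bigcap_(i in `I_J) ((airy_point ^~ i) @^-1` (~` E))).
  apply: fin_bigcap_measurable => // i _.
  rewrite -[_ @^-1` _]setTI; apply: measurable_airy_point => //.
  exact: measurableC.
by apply/seteqP; split.
Qed.

Lemma airy_point_prob : (P [set w | E (airy_point w 0%N)] <= airy_intensity)%E.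
Proof.
rewrite -airy_first_moment.
have mS : measurable [set w | E (airy_point w 0%N)].
  by rewrite -[[set _ | _]]setTI; exact: measurable_airy_point.
rewrite -[X in (P X <= _)%E]setIT -integral_indic//; apply: integral_dominated => w _.
  exact: (counting_ge (s := [::])).
apply: (@le_trans _ _ (nhits airy_point E 1 w)%:E); last exact: nhits_le_count.
rewrite lee_fin nhitsE big_seq1 !indicE .
by rewrite (_ : (w \in _) = (airy_point w 0 \in E))//; apply/idP/idP => /set_mem h; exact/mem_set.
Qed.

(* Chebyshev's inequality; the variance of the number of points is at most its mean. *)
Lemma airy_avoidance (Q : set T) : measurable Q -> 0 < kappa ->
  (forall w i, Q w -> ~ E (airy_point w i)) -> fine (P Q) * kappa <= 1.
Proof.
move=> mQ k0 HQ; rewrite -ev_indic//.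
suff H : ev P (\1_Q) <= kappa^-1 by rewrite -ler_pdivlMr// mul1r.
have bQ := bdd_meas_indic (R := R) mQ.
have HJ J : ev P (\1_Q) <= 2 - 2 * (ev P (nhits airy_point E J) * kappa^-1) +
    ev P (nhits airy_point E J) * (kappa^-1) ^+ 2.
  have b := bdd_meas_nhits J; have bb := bdd_measM b b.
  set e := ev P (nhits _ _ _).
  apply: (@le_trans _ _ (1 - 2 * (e * kappa^-1) + (kappa ^+ 2 + e) * (kappa^-1) ^+ 2)); last first.
    rewrite (_ : (kappa ^+ 2 + e) * _ = 1 + e * kappa^-1 ^+ 2); first lra.
    by field; rewrite gt_eqF.
  apply: (@le_trans _ _ (1 - 2 * (e * kappa^-1) +
     ev P (fun w => nhits airy_point E J w * nhits airy_point E J w) * (kappa^-1) ^+ 2)); last first.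
    by rewrite lerD2l ler_wpM2r// ?sqr_ge0// ev_nhits2.
  (* The expansion of [(1 - N / kappa)^2], with [N] the number of hits; it equals 1 on [Q] and is
     nonnegative elsewhere. *)
  pose f w := 1 + ((- 2 * kappa^-1) * nhits airy_point E J w +
     (kappa^-1) ^+ 2 * (nhits airy_point E J w * nhits airy_point E J w)).
  have b1 : bdd_meas (fun _ : T => 1 : R) by exact: bdd_meas_cst.
  have b2 := bdd_measZ (- 2 * kappa^-1) b; have b3 := bdd_measZ ((kappa^-1) ^+ 2) bb.
  rewrite (_ : _ + _ = ev P f); last first.
    by rewrite /f evD ?evD ?evZ ?ev_cst//; [rewrite -/e; ring|exact: bdd_measD].
  apply: ev_le => //; first by apply: bdd_measD => //; exact: bdd_measD.
  move=> w; rewrite indicE /f; have [wQ|wQ] := boolP (w \in Q).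
    have -> : nhits airy_point E J w = 0.
      rewrite nhitsE big1// => i _; rewrite indicE memNset//.
      by apply: HQ; exact: set_mem.
    by rewrite /=; lra.
  rewrite (_ : _ + _ = (1 - kappa^-1 * nhits airy_point E J w) ^+ 2) ?sqr_ge0//.
  by ring.
have L : (2 - 2 * (ev P (nhits airy_point E J) * kappa^-1) +
    ev P (nhits airy_point E J) * (kappa^-1) ^+ 2) @[J --> \oo] -->
    2 - 2 * (kappa * kappa^-1) + kappa * (kappa^-1) ^+ 2.
  apply: cvgD; first apply: cvgB; first exact: cvg_cst.
    by apply: cvgMl_tmp; apply: cvgMr_tmp.
  exact: cvgMr_tmp.
have -> : kappa^-1 = 2 - 2 * (kappa * kappa^-1) + kappa * (kappa^-1) ^+ 2.
  by field; rewrite gt_eqF.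
apply: (@ler_cvg_to _ _ _ _ (fun=> ev P (\1_Q)) _ _ _ (cvg_cst _) L).
by apply: nearW => J; exact: HJ.
Qed.

End ensemble.

(** * Uniform tails of the directed landscape *)

Section airy_tails.
Context {R : realType}.
Local Notation leb := (@lebesgue_measure R).

(** The bound on the density makes the intensity of every window finite; as the interval and [j]
    grow, the windows exhaust the line. *)
Definition airy_window (lo hi : R) (j : nat) : set R :=
  `]lo, hi]%classic `&` [set x | airy_density x <= j%:R].

Lemma measurable_airy_window lo hi j : measurable (airy_window lo hi j).
Proof.
apply: measurableI; first exact: measurable_itv.
rewrite (_ : [set _ | _] = airy_density @^-1` `]-oo, j%:R]).
  by rewrite -[_ @^-1` _]setTI; exact: measurable_airy_density.
by apply/seteqP; split => x /=; rewrite in_itv.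
Qed.

Lemma airy_window_bounded lo hi j : bounded_set (airy_window lo hi j).
Proof.
exists (Num.max `|lo| `|hi|); split; first exact: num_real.
move=> M; rewrite gt_max => /andP[lM hM] x [/=]; rewrite in_itv/= => /andP[lx xh] _.
rewrite ler_norml; apply/andP; split.
  by have := ler_norm (- lo); rewrite normrN; lra.
by have := ler_norm hi; lra.
Qed.

Lemma airy_intensity_fin (E : set R) lo hi j : measurable E -> E `<=` airy_window lo hi j ->
  airy_intensity E \is a fin_num.
Proof.
move=> mE EW; rewrite ge0_fin_numE; last first.
  by apply: integral_ge0 => x _; rewrite lee_fin airy_density_ge0.
apply: (@le_lt_trans _ _ (\int[leb]_(x in E) (cst j%:R%:E) x)%E).
  by apply: integral_dominated => x /EW[_ /=]; rewrite lee_fin.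
rewrite integral_cst//; apply: lte_mul_pinfty => //.
apply: (@le_lt_trans _ _ (leb `]lo, hi]%classic)).
  apply: le_measure; [exact: mem_set|by apply: mem_set; exact: (measurable_itv `]lo, hi])|].
  by move=> x /EW[].
by rewrite lebesgue_measure_itv/=; case: ifP => _; rewrite ltry.
Qed.

Lemma airy_intensityD (E F : set R) : measurable E -> measurable F -> F `<=` E ->
  airy_intensity E = (airy_intensity F + airy_intensity (E `\` F))%E.
Proof.
move=> mE mF FE; rewrite -[E in LHS](setDUK FE) /airy_intensity ge0_integral_setU//.
- exact: measurableD.
- by apply/measurable_EFinP; apply: measurable_funTS; exact: measurable_airy_density.
- by move=> x _; rewrite lee_fin airy_density_ge0.
- by apply/disj_setPS => x [? []].
Qed.

Lemma airy_intensity_ge0 (E : set R) : 0 <= fine (airy_intensity E).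
Proof.
by apply: fine_ge0; apply: integral_ge0 => x _; rewrite lee_fin airy_density_ge0.
Qed.

Lemma airy_point_le d (T : measurableType d) (P : probability T R) (A : T -> nat -> R -> R)
    v w i : parabolic_airy_line_ensemble P A -> airy_point A v w i <= airy_point A v w 0.
Proof.
move=> HA; case: i => [//|i]; apply: ltW; exact: (airy_point_decr HA).
Qed.

Lemma indic_cvg_ev d (T : measurableType d) (P : probability T R) (S : nat -> set T) (S' : set T) :
  (forall j, measurable (S j)) -> measurable S' ->
  (forall w, \forall j \near \oo, S j w <-> S' w) ->
  ev P (\1_(S j)) @[j --> \oo] --> ev P (\1_S' : T -> R).
Proof.
move=> mS mS' H; apply: (ev_dominated_cvg (M := 1)).
- by move=> j; exact: measurable_indic.
- by move=> j w; rewrite indicE ger0_norm// lern1 leq_b1.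
- apply: aeW => w; apply: cvg_near_cst; near=> j; rewrite !indicE.
  have e : S j w <-> S' w by near: j; exact: H.
  by congr (nat_of_bool _)%:R; apply/idP/idP => /set_mem h; apply/mem_set/e.
- exact: measurable_indic.
Unshelve. all: by end_near. Qed.

Section existing.
Context d0 (T0 : measurableType d0) (P0 : probability T0 R) (A0 : T0 -> nat -> R -> R).
Hypothesis HA0 : parabolic_airy_line_ensemble P0 A0.
Let pt0 := airy_point A0 0.

Let mpt0 i : measurable_fun setT (pt0 ^~ i).
Proof. exact: measurable_airy_point HA0 0 i. Qed.

Let mset d (T : measurableType d) (f : T -> R) (B : set R) :
  measurable_fun setT f -> measurable B -> measurable [set w | B (f w)].
Proof. by move=> mf mB; rewrite -[[set _ | _]]setTI; exact: mf. Qed.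

Let mgt (a : R) : measurable [set x : R | a < x].
Proof.
rewrite (_ : [set _ | _] = `]a, +oo[%classic); first exact: measurable_itv.
by apply/seteqP; split => x /=; rewrite in_itv/= andbT.
Qed.

(** In the reference ensemble there is no point above some [a] with probability at least 1/2, so by
    [airy_avoidance] every window above [a] has intensity at most 2. These intensities increase with
    the window, so beyond some [j0] they gain at most [e]. The intensity is common to all ensembles,
    and it bounds the probability of finding the top point there. *)
Lemma airy_upper_tail (e : R) : 0 < e -> exists b : R,
  forall d (T : measurableType d) (P : probability T R) (A : T -> nat -> R -> R) v,
  parabolic_airy_line_ensemble P A -> fine (P [set w | b < airy_point A v w 0]) <= e.
Proof.
move=> e0.
have [a Ha] : exists a : nat, ev P0 (\1_[set w | a%:R < pt0 w 0]) < 2^-1.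
  have : ev P0 (\1_[set w | j%:R < pt0 w 0]) @[j --> \oo] --> ev P0 (\1_set0 : T0 -> R).
    apply: indic_cvg_ev => //; first by move=> j; exact: (mset (mpt0 0) (mgt j%:R)).
    move=> w; exists (Num.trunc `|pt0 w 0|).+1 => // j /= jw; split => //=.
    apply/negP; rewrite -leNgt (le_trans (ler_norm _))// ltW//.
    by rewrite (lt_le_trans (truncnS_gt _))// ler_nat.
  rewrite [X in _ --> X](_ : _ = 0); last by rewrite indic0 ev_cst.
  move=> /cvgr_lt /(_ 2^-1) []; first by rewrite invr_gt0.
  by move=> a _ /(_ a (leqnn a)); exists a.
pose W j := airy_window a%:R (a%:R + j%:R) j.
have mW j : measurable (W j) by exact: measurable_airy_window.
have WW j k : (j <= k)%N -> W j `<=` W k.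
  move=> jk x [/=]; rewrite in_itv/= => /andP[ax xj] dj; split => /=.
    by rewrite in_itv/= ax (le_trans xj)// lerD2l ler_nat.
  by rewrite (le_trans dj)// ler_nat.
have finW j : airy_intensity (W j) \is a fin_num.
  exact: (airy_intensity_fin (mW j) (fun x h => h)).
pose k j := fine (airy_intensity (W j)).
have k2 j : k j <= 2.
  have [k0|] := ltP 0 (k j); last lra.
  pose Q := [set w | ~ (a%:R < pt0 w 0)].
  have mQ : measurable Q by apply: measurableC; exact: (mset (mpt0 0) (mgt a%:R)).
  have HQ w i : Q w -> ~ W j (airy_point A0 0 w i).
    move=> Qw [/=]; rewrite in_itv/= => /andP[aw _] _; apply: Qw => /=.
    exact: lt_le_trans aw (airy_point_le 0 w i HA0).
  have := airy_avoidance HA0 (mW j) (@airy_window_bounded _ _ j) (finW j) mQ k0 HQ.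
  rewrite -ev_indic// => h; have hq : 2^-1 <= ev P0 (\1_Q).
    have := evB P0 (bdd_meas_cst T0 1) (bdd_meas_indic (R := R) (mset (mpt0 0) (mgt a%:R))).
    rewrite ev_cst; have -> : (fun w => 1 - \1_[set w | [set x | a%:R < x] (pt0 w 0)] w) =
        (\1_Q : T0 -> R).
      apply/funext => w; rewrite !indicE.
      have [h1|h1] := boolP (w \in Q).
        by rewrite memNset ?subr0//; exact: set_mem h1.
      rewrite mem_set ?subrr//=; apply: contrapT => h2.
      by move/negP: h1; apply; exact/mem_set.
    by move=> ->; lra.
  by have := ler_wpM2r (ltW k0) hq; rewrite -/(k j) in h; lra.
(* Otherwise the intensity would grow by [e] infinitely often and exceed the bound 2. *)
have [j0 Hj0] : exists j0, forall j, k j - k j0 <= e.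
  apply: contrapT => /forallNP H.
  have {}H j : exists j', k j + e < k j'.
    have /existsNP[j' h] := H j; exists j'.
    by move/negP: h; rewrite -ltNge; lra.
  have H' n : exists j, n%:R * e <= k j.
    elim: n => [|n [j IH]]; first by exists 0%N; rewrite mul0r airy_intensity_ge0.
    by have [j' h] := H j; exists j'; rewrite -natr1 mulrDl mul1r; lra.
  have [j h] := H' (Num.trunc (2 / e)).+1; have := k2 j.
  suff : 2 < (Num.trunc (2 / e)).+1%:R * e by lra.
  by rewrite -ltr_pdivrMr// truncnS_gt.
exists (a%:R + j0%:R) => d T P A v HA.
have mp := measurable_airy_point HA v 0.
(* The first moment bounds the probability of [S j], and [S j] tends to [S'], which contains the
   event to be bounded. *)
pose S j := [set w | (W j `\` W j0) (airy_point A v w 0)].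
pose S' := [set w | (a%:R < airy_point A v w 0) /\ ~ W j0 (airy_point A v w 0)].
have mS j : measurable (S j) by apply: (mset mp); exact: measurableD.
have mS' : measurable S'.
  by apply: (mset (B := [set x | a%:R < x] `\` W j0) mp); apply: measurableD.
have hS j : ev P (\1_(S j)) <= e.
  have [jj|jj] := leqP j0 j; last first.
    rewrite (_ : S j = set0).
      by rewrite indic0 ev_cst ltW.
    apply/seteqP; split => w //= -[h1 h2].
    exact: (h2 (WW _ _ (ltnW jj) _ h1)).
  apply: le_trans (Hj0 j); rewrite ev_indic// -lee_fin fineK ?fin_num_measure//.
  have mD : measurable (W j `\` W j0) by exact: measurableD.
  have fD : airy_intensity (W j `\` W j0) \is a fin_num.
    exact: (airy_intensity_fin mD (fun x h => proj1 h)).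
  rewrite /k (airy_intensityD (mW j) (mW j0) (WW _ _ jj)) fineD// addrC addKr fineK//.
  apply: (airy_point_prob HA) => //.
  have [M [Mr HM]] := @airy_window_bounded a%:R (a%:R + j%:R) j.
  by exists M; split => // M' /HM h x [] /h.
rewrite -ev_indic; last exact: (mset mp (mgt _)).
apply: (@le_trans _ _ (ev P (\1_S'))).
  apply: ev_le; [exact/bdd_meas_indic/(mset mp (mgt _))|exact: bdd_meas_indic|].
  move=> w; rewrite !indicE ler_nat; case: (boolP (w \in [set _ | _])) => // /set_mem /= h.
  rewrite mem_set//; split.
    by apply: le_lt_trans h; rewrite lerDl.
  by move=> [/=]; rewrite in_itv/= => /andP[_]; rewrite leNgt h.
have L : ev P (\1_(S j)) @[j --> \oo] --> ev P (\1_S' : T -> R).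
  apply: indic_cvg_ev => // w.
  pose y := airy_point A v w 0.
  exists (maxn (Num.trunc (`|y| + `|a%:R|)).+1 (Num.trunc (airy_density y)).+1) => // j /=.
  rewrite geq_max => /andP[h1 h2]; rewrite /S /S' /=; split.
    by move=> [[/=]]; rewrite in_itv/= => /andP[].
  move=> [h3 h4]; split => //; split => /=.
    rewrite in_itv/= h3 -lerBlDl (le_trans (ler_norm _))// (le_trans (ler_normB _ _))// ltW//.
    by rewrite (lt_le_trans (truncnS_gt _))// ler_nat.
  by rewrite ltW// (lt_le_trans (truncnS_gt _))// ler_nat.
by apply: (ler_cvg_to L (cvg_cst _)); apply: nearW => j; exact: hS.
Qed.

(** An ensemble has infinitely many points, so some window [V j] contains the first [J > 2 / e] of
    them with probability above 1/2 and thus has intensity above [1 / e]. A top point below [-j]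
    leaves this window empty, which by [airy_avoidance] has probability at most [e] in every
    ensemble. *)
Lemma airy_lower_tail (e : R) : 0 < e -> exists b : R,
  forall d (T : measurableType d) (P : probability T R) (A : T -> nat -> R -> R) v,
  parabolic_airy_line_ensemble P A -> fine (P [set w | airy_point A v w 0 < b]) <= e.
Proof.
move=> e0.
pose V j := airy_window (- j%:R) j%:R j.
have mV j : measurable (V j) by exact: measurable_airy_window.
have finV j : airy_intensity (V j) \is a fin_num.
  exact: (airy_intensity_fin (mV j) (fun x h => h)).
pose J := (Num.trunc (2 * e^-1)).+1.
have [j Hj] : exists j, e^-1 < fine (airy_intensity (V j)).
  pose S j := [set w | forall i, (i < J)%N -> V j (pt0 w i)].
  have mS j : measurable (S j).
    rewrite (_ : S j = \bigcap_(i in `I_J) ((pt0 ^~ i) @^-1` (V j))); last by apply/seteqP; split.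
    apply: fin_bigcap_measurable => // i _.
    by rewrite -[_ @^-1` _]setTI; exact: mpt0.
  have : ev P0 (\1_(S j)) @[j --> \oo] --> ev P0 (\1_setT : T0 -> R).
    apply: indic_cvg_ev => // w.
    pose n0 i := maxn (Num.trunc `|pt0 w i|).+1 (Num.trunc (airy_density (pt0 w i))).+1.
    exists (\max_(i < J) n0 i)%N => // j /= Hj; split => // _ i iJ.
    have : (n0 i <= j)%N.
      by apply: leq_trans Hj; exact: (@leq_bigmax _ (fun i : 'I_J => n0 i) (Ordinal iJ)).
    rewrite geq_max => /andP[h1 h2].
    have h3 : `|pt0 w i| < j%:R by rewrite (lt_le_trans (truncnS_gt _))// ler_nat.
    split => /=; last by rewrite ltW// (lt_le_trans (truncnS_gt _))// ler_nat.
    by rewrite in_itv/=; move: h3; rewrite ltr_norml => /andP[-> /ltW ->].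
  rewrite [X in _ --> X](_ : _ = 1); last by rewrite indicT ev_cst.
  move=> /cvgr_gt /(_ 2^-1) []; first by rewrite invf_lt1// ltr1n.
  move=> j _ /(_ j (leqnn j)) hj; exists j.
  have /= := airy_nhits_le HA0 0 (mV j) (@airy_window_bounded _ _ j) J.
  rewrite -(fineK (finV j)) lee_fin; apply: lt_le_trans.
  have bn : bdd_meas (nhits pt0 (V j) J).
    rewrite (_ : nhits _ _ _ = fun w => \sum_(i <- iota 0 J) \1_(V j) (pt0 w i)).
      apply: bdd_meas_sum => i _; split; last first.
        by exists 1 => w; rewrite indicE ger0_norm// lern1 leq_b1.
      by apply: measurableT_comp; [exact: measurable_indic|exact: mpt0].
    by apply/funext => w; rewrite nhitsE.
  apply: (@lt_le_trans _ _ (J%:R * ev P0 (\1_(S j)))).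
    have : 2 * e^-1 < J%:R by exact: truncnS_gt.
    have : 0 < J%:R :> R by rewrite ltr0n.
    have := invr_gt0 e; rewrite e0; nra.
  rewrite -evZ; last exact: bdd_meas_indic.
  apply: ev_le => //; first exact/bdd_measZ/bdd_meas_indic.
  move=> w; rewrite indicE; have [/set_mem wS|_] := boolP (w \in S j); last by rewrite mulr0.
  rewrite mulr1 nhitsE (eq_big_seq (fun=> 1)).
    by rewrite big_const_seq count_predT size_iota iter_addr_0.
  by move=> i; rewrite mem_iota add0n => /andP[_ iJ]; rewrite indicE mem_set//; exact: wS.
exists (- j%:R) => d T P A v HA.
have mp := measurable_airy_point HA v 0.
have k0 : 0 < fine (airy_intensity (V j)) by apply: lt_trans Hj; rewrite invr_gt0.
pose Q := [set w | airy_point A v w 0 < - j%:R].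
have mQ : measurable Q.
  rewrite (_ : Q = [set w | [set x | j%:R < x] (- airy_point A v w 0)]).
    by apply: (mset (f := fun w => - airy_point A v w 0)) => //; exact: measurableT_comp.
  by apply/seteqP; split => w /=; rewrite /Q /= ltrNr.
have HQ w i : Q w -> ~ V j (airy_point A v w i).
  move=> Qw [/=]; rewrite in_itv/= => /andP[aw _] _.
  have := airy_point_le v w i HA; have : airy_point A v w 0 < - j%:R by exact: Qw.
  lra.
have := airy_avoidance HA (mV j) (@airy_window_bounded _ _ j) (finV j) mQ k0 HQ.
rewrite -ler_pdivlMr// => h; apply: (le_trans h).
by rewrite div1r invf_ple ?posrE// ltW.
Qed.

Lemma airy_tails (e : R) : 0 < e -> exists2 M : R, 0 < M &
  forall d (T : measurableType d) (P : probability T R) (A : T -> nat -> R -> R) v,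
  parabolic_airy_line_ensemble P A -> fine (P [set w | M < `|A w 1 v + v ^+ 2|]) <= e.
Proof.
move=> e0; have e20 : 0 < e / 2 by rewrite divr_gt0.
have [b1 H1] := airy_upper_tail e20; have [b2 H2] := airy_lower_tail e20.
exists (1 + `|b1| + `|b2|) => [|d T P A v HA].
  by have := normr_ge0 b1; have := normr_ge0 b2; lra.
have mp := measurable_airy_point HA v 0.
have m1 : measurable [set w | b1 < airy_point A v w 0] by exact: (mset mp (mgt b1)).
have m2 : measurable [set w | airy_point A v w 0 < b2].
  rewrite (_ : [set _ | _] = [set w | [set x | - b2 < x] (- airy_point A v w 0)]).
    by apply: (mset (f := fun w => - airy_point A v w 0)) => //; exact: measurableT_comp.
  by apply/seteqP; split => w /=; rewrite ltrN2.
have m3 : measurable [set w | 1 + `|b1| + `|b2| < `|A w 1 v + v ^+ 2|].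
  apply: (@mset _ _ (fun w => `|airy_point A v w 0|) [set x | 1 + `|b1| + `|b2| < x]).
    exact: measurableT_comp.
  exact: mgt.
apply: le_trans (_ : _ <= fine (P [set w | b1 < airy_point A v w 0]) +
   fine (P [set w | airy_point A v w 0 < b2])) _; last first.
  by have := H1 _ _ _ _ v HA; have := H2 _ _ _ _ v HA; lra.
rewrite -!ev_indic// -evD; [|exact: bdd_meas_indic..].
apply: ev_le; [exact: bdd_meas_indic|by apply: bdd_measD; exact: bdd_meas_indic|].
move=> w; rewrite [leLHS]indicE; case: (boolP (w \in _)) => [/set_mem/= h|_]; last first.
  by rewrite addr_ge0// indicE.
have hb1 := ler_norm b1; have hb2 := ler_norm (- b2); rewrite normrN in hb2.
have n1 := normr_ge0 b1; have n2 := normr_ge0 b2.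
have [h1|h1] := ltP b1 (airy_point A v w 0).
  by rewrite (indicE _ [set w | b1 < airy_point A v w 0]) mem_set//= lerDl indicE.
rewrite (indicE _ [set w | airy_point A v w 0 < b2]) mem_set /=; first by rewrite lerDr indicE.
move: h; rewrite ltr_normr => /orP[|]; rewrite -/(airy_point A v w 0); lra.
Qed.

End existing.
End airy_tails.

Section landscape_tails.
Context {R : realType} d (T : measurableType d) (P : probability T R)
  (L : T -> (R * R) * (R * R) -> \bar R).
Hypothesis HL : directed_landscape P L.

Lemma landscape_slice (s t : R) : s < t ->
  airy_sheet_of_scale P ((t - s) `^ 3^-1) (fun w => time_slice s t (L w)).
Proof.
move=> st; have [_ _ _ H _] := HL.
have [] := H 1%N (fun=> s) (fun=> t) (fun=> st).
  by apply/trivIsetP => i j _ _; rewrite (ord1 i) (ord1 j) eqxx.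
by move=> _ /(_ ord0).
Qed.

(** Stationarity moves the start point to 0, where the sheet is the top line of the coupled
    ensemble. That ensemble lives on another probability space, so the comparison is one of
    probabilities. *)
Lemma airy_sheet_line_tail (S : T -> R * R -> R) (x y M : R) : airy_sheet P S ->
  exists d' (T' : measurableType d') (P' : probability T' R) (A : T' -> nat -> R -> R),
    parabolic_airy_line_ensemble P' A /\
    fine (P [set w | M < `|S w (x, y) + (y - x) ^+ 2|]) =
      fine (P' [set w | M < `|A w 1 (y - x) + (y - x) ^+ 2|]).
Proof.
move=> [[mS _] shift [d' [T' [P' [A [S' [HA [mS' _] law S'A _]]]]]]].
exists d', T', P', A; split => //; set v := y - x.
pose B := [set r : R | M < `|r + v ^+ 2|].
have mB : measurable B.
  rewrite (_ : B = (fun r => `|r + v ^+ 2|) @^-1` `]M, +oo[); last first.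
    by apply/seteqP; split => r /=; rewrite in_itv/= andbT.
  have mf : measurable_fun setT (fun r : R => `|r + v ^+ 2|).
    by apply: measurableT_comp => //; exact: measurable_funD.
  by rewrite -[_ @^-1` _]setTI; apply: mf => //; exact: measurable_itv.
have cyl p : cylindrical [set f : R * R -> R | B (f p)].
  by apply: sub_gen_smallest; exists p, B.
have h1 : P [set w | B (S w (x, y))] = P [set w | B (S w (0, v))].
  have := shift x _ (cyl (0, v)); rewrite /preimage/= add0r /v subrK => <-.
  by congr (P _); apply/seteqP; split => w /=; rewrite add0r subrK.
rewrite [X in fine X]h1; have := law _ (cyl (0, v)); rewrite /preimage/= => <-.
have m1 : measurable [set w | B (S' w (0, v))].
  by rewrite -[[set _ | _]]setTI; exact: mS'.
have m2 : measurable [set w | B (A w 1 v)].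
  have [HcA _ _] := HA; have [mA _] := HcA 1%N isT.
  by rewrite -[[set _ | _]]setTI; exact: mA.
rewrite -[RHS](ev_indic P' m2) -[LHS](ev_indic P' m1); apply: ae_eq_ev.
- exact: measurable_indic.
- exact: measurable_indic.
by apply: filterS S'A => w /(_ v) E; rewrite !indicE; congr (nat_of_bool _)%:R;
  apply/idP/idP => /set_mem/= h; apply/mem_set; rewrite /= ?E// -?E.
Qed.

(** A slice of scale [r] is [r S(x / r^2, y / r^2)]; division by [r] reduces it to a top line at one
    time. The bound [airy_tails] is uniform over all ensembles, hence here over all slices. *)
Lemma landscape_tails (e : R) : 0 < e -> exists2 M : R, 0 < M &
  forall x s y t r : R, s < t -> r = (t - s) `^ 3^-1 ->
  fine (P [set w | M < `|fine (L w ((x, s), (y, t))) / r + ((y - x) / r ^+ 2) ^+ 2|]) <= e.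
Proof.
move=> e0.
(* The slice of duration 1 supplies the reference ensemble for [airy_tails]. *)
have [S0 HS0 _] := landscape_slice (@ltr01 R).
have [_ _ [d0 [T0 [P0 [A0 [S0' [HA0 _ _ _ _]]]]]]] := HS0.
have [M M0 HM] := airy_tails HA0 e0.
exists M => // x s y t r st rE.
have r0 : 0 < r by rewrite rE powR_gt0// subr_gt0.
have [S HS SE] := landscape_slice st.
have [d' [T' [P' [A [HA E]]]]] := airy_sheet_line_tail (x / r ^+ 2) (y / r ^+ 2) M HS.
rewrite (_ : [set _ | _] = [set w | M < `|S w (x / r ^+ 2, y / r ^+ 2) +
    (y / r ^+ 2 - x / r ^+ 2) ^+ 2|]); first by rewrite E; exact: HM.
apply/seteqP; split => w /=; have := SE w (x, y); rewrite /time_slice/= => ->.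
  by rewrite /= -rE [r * _]mulrC mulfK ?gt_eqF// mulrBl.
by rewrite /= -rE [r * _]mulrC mulfK ?gt_eqF// mulrBl.
Qed.

End landscape_tails.

(** * Lattice last passage percolation *)

Section countable_sup.
Context {R : realType} d (T : measurableType d).

Lemma measurable_countable_sup (J : countType) (Q : set J) (f : J -> T -> \bar R) :
  (forall j, Q j -> measurable_fun setT (f j)) ->
  measurable_fun setT (fun w => ereal_sup [set f j w | j in Q]).
Proof.
move=> mf; pose g (n : nat) (w : T) : \bar R :=
  if choice.unpickle n is Some j then (if `[< Q j >] then f j w else -oo%E) else -oo%E.
have mg n : measurable_fun setT (g n).
  rewrite /g; case: (choice.unpickle n) => [j|]; last exact: measurable_cst.
  by case: asboolP => [Qj|_]; [exact: mf|exact: measurable_cst].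
rewrite (_ : (fun _ => _) = (fun w => esups (g ^~ w) 0)); first exact: measurable_fun_esups.
apply/funext => w; rewrite /esups; apply/eqP; rewrite eq_le; apply/andP; split.
  apply: ge_ereal_sup => _ [j Qj <-]; apply: ereal_sup_ubound => /=.
  by exists (choice.pickle j) => //=; rewrite /g choice.pickleK asboolT.
apply: ge_ereal_sup => _ [n _ <-]; rewrite /g; case: (choice.unpickle n) => [j|]; last exact: leNye.
by case: asboolP => [Qj|_]; [apply: ereal_sup_ubound; exists j|exact: leNye].
Qed.

End countable_sup.

(** * Independence of events that use disjoint sets of sites *)

Section site_independence.
Context {R : realType} d (T : measurableType d) (P : probability T R).
Context (I : choiceType) (X : T -> I -> R).
Hypothesis mX : random_function X.
Hypothesis iX : independent P (@measurable _ R) (fun i w => X w i).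

Definition coordinates (S : set I) : set_system T :=
  [set A | exists i (B : set R), [/\ S i, measurable B & A = [set w | B (X w i)]]].

Let cylinders (S : set I) : set_system T :=
  [set A | exists (s : seq I) (B : I -> set R), [/\ forall i, i \in s -> S i,
     forall i, measurable (B i) & A = [set w | forall i, i \in s -> B i (X w i)]]].

Let cylindersI S : setI_closed (cylinders S).
Proof.
move=> _ _ [s [B [sS mB ->]]] [s' [B' [sS' mB' ->]]].
exists (s ++ s'), (fun i => (if i \in s then B i else setT) `&` (if i \in s' then B' i else setT)).
split.
- by move=> i; rewrite mem_cat => /orP[/sS|/sS'].
- by move=> i; apply: measurableI; case: ifP.
apply/seteqP; split => w /=.
  move=> [h1 h2] i; rewrite mem_cat => /orP[] hi; split => /=.
  - by rewrite hi; exact: h1.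
  - by case: ifP => // /h2.
  - by case: ifP => // /h1.
  - by rewrite hi; exact: h2.
move=> h; split => i hi.
  by have [] := h i _; [rewrite mem_cat hi|rewrite hi].
by have [] := h i _; [rewrite mem_cat hi orbT|rewrite hi].
Qed.

Let cylinder_bigcap (s : seq I) (B : I -> set R) :
  [set w | forall i, i \in s -> B i (X w i)] =
  \bigcap_(i in [set` undup s]) ((fun w => X w i) @^-1` B i).
Proof. by apply/seteqP; split => w h i /=; [rewrite mem_undup|rewrite -mem_undup]; exact: h. Qed.

Let measurable_cylinder S A : cylinders S A -> measurable A.
Proof.
move=> [s [B [sS mB ->]]]; rewrite cylinder_bigcap; apply: fin_bigcap_measurable => // i _.
by rewrite -[_ @^-1` _]setTI; exact: mX.
Qed.

Let cylinders_gen S A : <<s coordinates S >> A -> <<s cylinders S >> A.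
Proof.
apply: sub_sigma_algebra2 => _ [i [B [Si mB ->]]].
exists [:: i], (fun=> B); split => //; first by move=> j; rewrite inE => /eqP ->.
by apply/seteqP; split => w /= h; [move=> j; rewrite inE => /eqP ->|apply: h; rewrite mem_head].
Qed.

Let measurable_gen S A : <<s cylinders S >> A -> measurable A.
Proof.
exact: (smallest_sub (@sigma_algebra_measurable _ T) (@measurable_cylinder S)).
Qed.

Lemma measurable_coordinates S A : <<s coordinates S >> A -> measurable A.
Proof. by move=> /cylinders_gen /measurable_gen. Qed.

(* The two sides of the product rule are finite measures in A. *)
Let extend (G : set_system T) (B : set T) : measurable B -> setI_closed G ->
  G setT -> (G `<=` measurable) ->
  (forall A, G A -> P (A `&` B) = (P A * P B)%E) ->
  forall A, <<s G >> A -> P (A `&` B) = (P A * P B)%E.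
Proof.
move=> mB GI GT Gm H A GA.
have PB : P B \is a fin_num by exact: fin_num_measure.
have PB0 : 0 <= fine (P B) by exact: fine_ge0.
pose r : {nonneg R} := NngNum PB0.
have E C : mscale r P C = (P C * P B)%E by rewrite /mscale/= fineK// muleC.
rewrite -E; pose m1 : {measure set T -> \bar R} := mrestr P mB.
pose m2 : {measure set T -> \bar R} := mscale r P.
apply: (@g_sigma_algebra_measure_unique _ R T G Gm (fun=> setT) _ _ m1 m2) => //.
- by apply/seteqP; split => // x _; exists 0%N.
- by move=> C GC; rewrite /m2/= E; exact: H.
- move=> _; rewrite /m1/= /mrestr setTI.
  by rewrite ltey_eq PB.
Qed.

(** Cylinder events are stable under intersection and generate the sigma-algebras, so the product
    rule extends first in [A], with [B] a cylinder, and then in [B]. *)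
Lemma sites_independent (S S' : set I) A B : S `&` S' = set0 ->
  <<s coordinates S >> A -> <<s coordinates S' >> B -> P (A `&` B) = (P A * P B)%E.
Proof.
move=> SS' /cylinders_gen cA /cylinders_gen cB.
have mB := measurable_gen cB.
have cT S0 : cylinders S0 setT.
  by exists [::], (fun=> setT); split => //; apply/seteqP; split.
have base A0 B0 : cylinders S A0 -> cylinders S' B0 -> P (A0 `&` B0) = (P A0 * P B0)%E.
  move=> [s [C [sS mC ->]]] [s' [C' [sS' mC' ->]]].
  pose D i := if i \in s then C i else C' i.
  have ds i : i \in s -> i \in s' -> False.
    by move=> /sS h /sS' h'; have : (S `&` S') i by []; rewrite SS'.
  have mD i : measurable (D i) by rewrite /D; case: ifP.
  have u : uniq (undup s ++ undup s').
    rewrite cat_uniq !undup_uniq /= andbT; apply/hasPn => i; rewrite !mem_undup => h.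
    by apply/negP => /ds; apply.
  have -> : [set w | forall i, i \in s -> C i (X w i)] `&` [set w | forall i, i \in s' -> C' i (X w i)]
      = \bigcap_(i in [set` undup s ++ undup s']) ((fun w => X w i) @^-1` D i).
    apply/seteqP; split => w.
      move=> [h h'] i /=; rewrite mem_cat !mem_undup /D => /orP[] hi; first by rewrite hi; exact: h.
      by case: ifP => [/ds/(_ hi)//|_]; exact: h'.
    move=> h; split => i hi.
      by have := h i; rewrite /= mem_cat mem_undup hi /D hi; apply.
    have := h i; rewrite /= mem_cat !mem_undup hi orbT /D; case: ifP => [/ds/(_ hi)//|_].
    by apply.
  rewrite (iX u mD) big_cat/= !cylinder_bigcap.
  rewrite (iX (undup_uniq s) mC) (iX (undup_uniq s') mC') [X in (X * _)%E]big_seq.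
  rewrite [X in (_ * X)%E]big_seq [X in _ = (X * _)%E]big_seq [X in _ = (_ * X)%E]big_seq.
  congr (_ * _)%E; apply: eq_bigr => i; rewrite mem_undup /D => hi; first by rewrite hi.
  by case: ifP => // /ds/(_ hi).
have half B0 : cylinders S' B0 -> P (A `&` B0) = (P A * P B0)%E.
  move=> cB0; apply: (extend (G := cylinders S)) => //.
  - exact: measurable_cylinder cB0.
  - exact: measurable_cylinder.
  - by move=> A0 cA0; exact: base.
rewrite setIC muleC; apply: (extend (G := cylinders S')) => //.
- exact: measurable_gen cA.
- exact: measurable_cylinder.
- by move=> B0 cB0; rewrite setIC half// muleC.
Qed.

End site_independence.

Section lattice.
Context {R : realType}.
Local Notation site := (int * int)%type.
Implicit Types (a b z : site) (X : site -> R).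

(* The order in which down-right paths visit sites: by row from top to bottom,
   from left to right within a row. *)
Definition before : rel site := fun a z => (z.2 < a.2) || ((z.2 == a.2) && (a.1 < z.1)).

Lemma before_trans : transitive before.
Proof.
move=> b a z; rewrite /before => /orP[h1|/andP[/eqP h1 h2]] /orP[h3|/andP[/eqP h3 h4]].
- by rewrite (lt_trans h3 h1).
- by rewrite h3 h1.
- by rewrite -h1 h3.
- by rewrite h3 h1 eqxx (lt_trans h2 h4) orbT.
Qed.

Lemma before_irr a : before a a = false.
Proof. by rewrite /before !ltxx andbF. Qed.

Lemma before_total a z : a != z -> before a z || before z a.
Proof.
case: a z => [a1 a2] [z1 z2]; rewrite /before xpair_eqE /=.
by case: (ltgtP a2 z2) => //= _; rewrite andbT; case: (ltgtP a1 z1).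
Qed.

Lemma step_before a z : lattice_step a z -> before a z.
Proof.
move=> /= /orP[] /eqP ->; rewrite /before /=.
  by rewrite eqxx ltrDl ltr01 orbT.
by rewrite gtrDl oppr_lt0 ltr01.
Qed.

(** The counted sites lie strictly after the start and not after the end. Hence passage times into a
    site and passage times out of it use disjoint sets of weights. *)
Lemma path_sites a p : path lattice_step a p -> forall z, z \in p ->
  before a z && ((z == last a p) || before z (last a p)).
Proof.
move=> /(sub_path step_before); elim: p a => [//|b p IH] a /= /andP[ab pb] z.
have hb : (b == last b p) || before b (last b p).
  case: p pb {IH} => [|y p]; first by rewrite eqxx.
  move=> /(order_path_min before_trans)/allP H; rewrite (H (last y p)) ?orbT//.
  by rewrite /= mem_last.
rewrite inE => /predU1P[->|zp]; first by rewrite ab.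
have /andP[h1 h2] := IH b pb z zp.
by rewrite (before_trans ab h1).
Qed.

Lemma path_coord a p : path lattice_step a p -> a.1 <= (last a p).1 /\ (last a p).2 <= a.2.
Proof.
elim: p a => [//|b p IH] a /= /andP[/orP[] /eqP E /IH]; rewrite E /=.
  by move=> [h1 h2]; split => //; rewrite (le_trans _ h1)// lerDl ler01.
by move=> [h1 h2]; split => //; rewrite (le_trans h2)// gerDl oppr_le0 ler01.
Qed.

Lemma lattice_lpp_eqNy X a b : ~~ ((a.1 <= b.1) && (b.2 <= a.2)) -> lattice_lpp X a b = -oo%E.
Proof.
move=> h; rewrite /lattice_lpp (_ : [set _ | _ in _] = set0) ?ereal_sup0//.
apply/seteqP; split => [_ [p [pp pl] <-]|//]; move/negP: h; apply.
by have [h1 h2] := path_coord pp; rewrite -pl h1 h2.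
Qed.

Lemma lattice_lpp_triangle X a b z : (lattice_lpp X a b + lattice_lpp X b z <= lattice_lpp X a z)%E.
Proof.
set S := [set p | path lattice_step a p /\ last a p = b].
set S' := [set p | path lattice_step b p /\ last b p = z].
have H p q : S p -> S' q ->
    ((\sum_(z <- p) X z)%:E + (\sum_(z <- q) X z)%:E <= lattice_lpp X a z)%E.
  move=> [pp pl] [qq ql]; rewrite -EFinD -big_cat/=; apply: ereal_sup_ubound.
  by exists (p ++ q) => //; split; rewrite ?cat_path ?last_cat ?pl ?pp.
have [->|] := eqVneq (lattice_lpp X a z) +oo%E; first exact: leey.
move=> fin.
have H2 q : S' q -> (lattice_lpp X a b <= lattice_lpp X a z - (\sum_(z <- q) X z)%:E)%E.
  move=> Sq; apply: ge_ereal_sup => _ [p Sp <-].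
  by rewrite leeBrDr// H.
have [->|Nb] := eqVneq (lattice_lpp X a b) -oo%E; first by rewrite addNye leNye.
have [E|/set0P[q Sq]] := eqVneq S' set0.
  by rewrite [X in (_ + X)%E]/lattice_lpp -/S' E image_set0 ereal_sup0 addeNy leNye.
have fab : lattice_lpp X a b \is a fin_num.
  rewrite fin_numE Nb /=; apply/eqP => E; have := H2 q Sq; rewrite E leye_eq.
  by case: (lattice_lpp X a z) fin.
rewrite addeC -leeBrDr//; apply: ge_ereal_sup => _ [q' Sq' <-].
have := H2 q' Sq'; rewrite leeBrDr// => h; rewrite leeBrDr// addeC.
exact: h.
Qed.

Let siteP a b : a.1 = b.1 -> a.2 = b.2 -> a = b.
Proof. by case: a b => ? ? [? ?] /= -> ->. Qed.

Lemma path_row a p : path lattice_step a p -> (last a p).2 = a.2 -> forall b, b.2 = a.2 ->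
  a.1 <= b.1 <= (last a p).1 -> exists p1 p2, [/\ p = p1 ++ p2,
   path lattice_step a p1, last a p1 = b, path lattice_step b p2 & last b p2 = last a p].
Proof.
elim: p a => [|y p IH] a /=.
  move=> _ _ b b2 /andP[h1 h2]; exists [::], [::]; split => //=.
    by apply: siteP => //; apply/eqP; rewrite eq_le h1.
  by apply: siteP => //; apply/eqP; rewrite eq_le h2.
move=> /andP[ay py] l2 b b2 /andP[h1 h2].
have [E|ab] := eqVneq a b.
  by exists [::], (y :: p); split => //=; rewrite -?E ?ay.
have [_ ly] := path_coord py.
have yE : y = (a.1 + 1, a.2).
  move: ay => /orP[] /eqP// E; move: ly; rewrite l2 E /= => h.
  by move: h; rewrite lerDl oppr_ge0 ler10.
have ab1 : a.1 < b.1.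
  rewrite lt_neqAle h1 andbT; apply: contraNneq ab => E.
  by apply/eqP/siteP.
have [|||p1 [p2 [pE pp1 lp1 pp2 lp2]]] := IH y py _ b.
- by rewrite l2 yE.
- by rewrite b2 yE.
- by rewrite {1}yE /= lezD1 ab1 h2.
by exists (y :: p1), p2; split => //=; rewrite ?ay ?{1}pE.
Qed.

(** Within one row there is a single path, and it runs through [b]: the triangle inequality can be
    reversed. *)
Lemma lattice_lpp_row X a b z : b.2 = a.2 -> z.2 = a.2 -> a.1 <= b.1 <= z.1 ->
  (lattice_lpp X a z <= lattice_lpp X a b + lattice_lpp X b z)%E.
Proof.
move=> b2 z2 h; apply: ge_ereal_sup => _ [p [pp pl] <-].
have [||p1 [p2 [pE pp1 lp1 pp2 lp2]]] := path_row pp _ b2; rewrite ?pl//.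
rewrite pE big_cat EFinD; apply: leeD; apply: ereal_sup_ubound.
  by exists p1.
by exists p2 => //; split => //; rewrite lp2 pl.
Qed.

Lemma measurable_lattice_lpp d (T : measurableType d) (X : T -> site -> R) a b :
  (forall z, before a z -> (z == b) || before z b -> measurable_fun setT (fun w => X w z)) ->
  measurable_fun setT (fun w => lattice_lpp (X w) a b).
Proof.
move=> mX; apply: (measurable_countable_sup (f := fun p w => (\sum_(z <- p) X w z)%:E)).
move=> p [pp pl]; apply/measurable_EFinP.
have {pp pl}: forall z, z \in p -> measurable_fun setT (fun w => X w z).
  by move=> z /(path_sites pp)/andP[h1]; rewrite pl; exact: mX.
elim: p => [|y p IH] H; first by under eq_fun do rewrite big_nil; exact: measurable_cst.
under eq_fun do rewrite big_cons; apply: measurable_funD; first by apply: H; rewrite mem_head.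
by apply: IH => z zp; apply: H; rewrite inE zp orbT.
Qed.

(* Restriction of the sigma-algebra of T to the one generated by the weights at the sites of S. *)
Lemma lattice_lpp_sites d (T : measurableType d) (X : T -> site -> R) a b (S : set site) :
  (forall z, before a z -> (z == b) || before z b -> S z) ->
  forall B : set (\bar R), measurable B ->
    <<s coordinates X S >> [set w | B (lattice_lpp (X w) a b)].
Proof.
move=> HS B mB.
pose T' := g_sigma_algebraType (coordinates X S).
have := @measurable_lattice_lpp _ T' X a b _ measurableT B mB.
rewrite setTI; apply => z az zb _ C mC; rewrite setTI.
by apply: sub_sigma_algebra; exists z, C; split => //; exact: HS.
Qed.

End lattice.

(** * The hypograph distance *)

Section euclidean.
Context {R : realType}.
Implicit Types (a b : R) (p q : R * R) (r : (R * R) * (R * R)).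

Definition hypot a b : R := Num.sqrt (a ^+ 2 + b ^+ 2).

Lemma hypot_ge0 a b : 0 <= hypot a b. Proof. exact: sqrtr_ge0. Qed.

Lemma hypot_sqr a b : hypot a b ^+ 2 = a ^+ 2 + b ^+ 2.
Proof. by rewrite sqr_sqrtr// addr_ge0// sqr_ge0. Qed.

Lemma hypot_le a b c : 0 <= c -> a ^+ 2 + b ^+ 2 <= c ^+ 2 -> hypot a b <= c.
Proof. by move=> c0 h; rewrite -(ler_sqr (hypot_ge0 _ _) c0) hypot_sqr. Qed.

Lemma hypot_mono a b a' b' : `|a| <= `|a'| -> `|b| <= `|b'| -> hypot a b <= hypot a' b'.
Proof.
move=> h1 h2; apply: hypot_le; first exact: hypot_ge0.
rewrite hypot_sqr lerD// -(real_normK (num_real _)) -[leRHS](real_normK (num_real _)).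
  by rewrite ler_sqr ?nnegrE.
by rewrite ler_sqr ?nnegrE.
Qed.

Lemma hypot_triangle a b a' b' : hypot (a + a') (b + b') <= hypot a b + hypot a' b'.
Proof.
apply: hypot_le; first by rewrite addr_ge0// hypot_ge0.
have h : a * a' + b * b' <= hypot a b * hypot a' b'.
  apply: le_trans (ler_norm _) _.
  rewrite -(ler_sqr (normr_ge0 _)) ?nnegrE ?mulr_ge0 ?hypot_ge0//.
  rewrite real_normK ?num_real// exprMn !hypot_sqr -subr_ge0.
  by rewrite (_ : _ - _ = (a * b' - b * a') ^+ 2) ?sqr_ge0//; ring.
have := hypot_sqr a b; have := hypot_sqr a' b'; rewrite !expr2; lra.
Qed.

Lemma hypot_le_norm a b : hypot a b <= `|a| + `|b|.
Proof.
apply: hypot_le; first by rewrite addr_ge0.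
rewrite -(real_normK (num_real a)) -(real_normK (num_real b)) sqrrD lerD2r lerDl.
by rewrite mulrn_wge0// mulr_ge0.
Qed.

Lemma le_hypot a b : `|a| <= hypot a b.
Proof.
rewrite -(ler_sqr (normr_ge0 _)) ?nnegrE ?hypot_ge0// hypot_sqr real_normK ?num_real//.
by rewrite lerDl sqr_ge0.
Qed.

Lemma hypotC a b : hypot a b = hypot b a. Proof. by rewrite /hypot addrC. Qed.

Lemma le_hypotr a b : `|b| <= hypot a b. Proof. by rewrite hypotC le_hypot. Qed.

Lemma hypotN a b : hypot (- a) (- b) = hypot a b. Proof. by rewrite /hypot !sqrrN. Qed.

Lemma norm2E p : norm2 p = hypot p.1 p.2. Proof. by []. Qed.
Lemma norm4E r : norm4 r = hypot (norm2 r.1) (norm2 r.2). Proof. by []. Qed.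

Lemma norm2_ge0 p : 0 <= norm2 p. Proof. exact: hypot_ge0. Qed.
Lemma norm4_ge0 r : 0 <= norm4 r. Proof. exact: hypot_ge0. Qed.

Lemma norm2D p q : norm2 (p + q) <= norm2 p + norm2 q. Proof. exact: hypot_triangle. Qed.

Lemma norm2N p : norm2 (- p) = norm2 p. Proof. exact: hypotN. Qed.

Lemma norm4D r r' : norm4 (r + r') <= norm4 r + norm4 r'.
Proof.
apply: le_trans (hypot_triangle _ _ _ _); apply: hypot_mono;
  by rewrite !ger0_norm ?norm2_ge0 ?addr_ge0 ?norm2_ge0//; exact: norm2D.
Qed.

Lemma norm4N r : norm4 (- r) = norm4 r.
Proof. by rewrite !norm4E /= !norm2N. Qed.

Lemma norm2_distC p q : norm2 (p - q) = norm2 (q - p).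
Proof. by rewrite -norm2N opprB. Qed.

Lemma norm4_distC r r' : norm4 (r - r') = norm4 (r' - r).
Proof. by rewrite -norm4N opprB. Qed.

Lemma norm2_dist p q : `|norm2 p - norm2 q| <= norm2 (p - q).
Proof.
have h1 := norm2D q (p - q); have h2 := norm2D p (q - p).
rewrite addrC subrK in h1; rewrite addrC subrK norm2_distC in h2.
by rewrite ler_norml; apply/andP; split; lra.
Qed.

Lemma norm4_dist r r' : `|norm4 r - norm4 r'| <= norm4 (r - r').
Proof.
have h1 := norm4D r' (r - r'); have h2 := norm4D r (r' - r).
rewrite addrC subrK in h1; rewrite addrC subrK norm4_distC in h2.
by rewrite ler_norml; apply/andP; split; lra.
Qed.

Lemma norm2_eq0 p : (norm2 p == 0) = (p == 0).
Proof.
case: p => a b; rewrite /norm2 sqrtr_eq0 /= [RHS]xpair_eqE.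
rewrite le_eqVlt ltNge addr_ge0 ?sqr_ge0//= orbF paddr_eq0 ?sqr_ge0//.
by rewrite !sqrf_eq0.
Qed.

Lemma norm2_le_max p : norm2 p <= 2 * `|p|.
Proof.
apply: le_trans (hypot_le_norm _ _) _; rewrite prod_normE.
have h1 : `|p.1| <= Num.max `|p.1| `|p.2| by rewrite le_max lexx.
have h2 : `|p.2| <= Num.max `|p.1| `|p.2| by rewrite le_max lexx orbT.
lra.
Qed.

Lemma norm4_le_max r : norm4 r <= 2 * `|r|.
Proof.
have hn p : norm2 p ^+ 2 <= 2 * `|p| ^+ 2.
  rewrite norm2E hypot_sqr mulr_natl mulr2n prod_normE lerD//;
    rewrite -(real_normK (num_real _)) ler_sqr ?nnegrE// ?le_max ?lexx ?orbT//.
have hr : `|r.1| <= `|r| /\ `|r.2| <= `|r| by split; rewrite [leRHS]prod_normE le_max lexx ?orbT.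
apply: hypot_le; first by rewrite mulr_ge0.
have h1 := hn r.1; have h2 := hn r.2.
have : `|r.1| ^+ 2 <= `|r| ^+ 2 by rewrite ler_sqr ?nnegrE// hr.1.
have : `|r.2| ^+ 2 <= `|r| ^+ 2 by rewrite ler_sqr ?nnegrE// hr.2.
rewrite exprMn; lra.
Qed.

Lemma norm_le_norm4 r : `|r| <= norm4 r.
Proof.
rewrite prod_normE ge_max; apply/andP; split.
  apply: le_trans (_ : norm2 r.1 <= _).
    by rewrite prod_normE ge_max le_hypot le_hypotr.
  by rewrite -[leLHS]ger0_norm ?norm2_ge0// le_hypot.
apply: le_trans (_ : norm2 r.2 <= _).
  by rewrite prod_normE ge_max le_hypot le_hypotr.
by rewrite -[leLHS]ger0_norm ?norm2_ge0// le_hypotr.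
Qed.

Lemma expRN_dist a b : 0 <= a -> a <= b -> 0 <= expR (- a) - expR (- b) <= expR (- a) * (b - a).
Proof.
move=> a0 ab; have -> : expR (- b) = expR (- a) * expR (- (b - a)).
  by rewrite -expRD; congr expR; ring.
have h := expR_ge1Dx (- (b - a)); have h1 : expR (- (b - a)) <= 1.
  by rewrite -expR0 ler_expR; lra.
have h2 := expR_ge0 (- a).
apply/andP; split; first by rewrite -{1}[expR (- a)]mulr1 -mulrBr mulr_ge0//; lra.
by rewrite -{1}[expR (- a)]mulr1 -mulrBr ler_wpM2l//; lra.
Qed.

Lemma expRN_le1 a : 0 <= a -> expR (- a) <= 1.
Proof. by move=> a0; rewrite -expR0 ler_expR; lra. Qed.

Lemma mul_expRN_le1 a : 0 <= a -> a * expR (- a) <= 1.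
Proof.
move=> a0; rewrite expRN ler_pdivrMr ?expR_gt0// mul1r.
by have := expR_ge1Dx a; lra.
Qed.

Lemma expRN_lip a b : 0 <= a -> 0 <= b -> `|expR (- a) - expR (- b)| <= `|a - b|.
Proof.
wlog ab : a b / a <= b.
  move=> H a0 b0; have [/H|/ltW/H] := leP a b; first exact.
  by rewrite distrC (distrC a); apply.
move=> a0 _; have /andP[h1 h2] := expRN_dist a0 ab.
rewrite ger0_norm// distrC ger0_norm ?subr_ge0//; apply: le_trans h2 _.
by rewrite ler_piMl ?subr_ge0// expRN_le1.
Qed.

End euclidean.

(** * Finite approximations of hypographs and Lipschitz minorants *)

Section hypograph_distance.
Context {R : realType}.
Local Notation R4 := ((R * R) * (R * R))%type.
Local Notation c := (@contract R).
Implicit Types (f g h : R4 -> \bar R) (r : R4) (x y : R4 * \bar R).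

Definition hypo_weight r : R := norm2 (r.1 - r.2) * expR (- norm4 r).

Let edist (u v : R4 * R) : R := Num.sqrt (norm4 (u.1 - v.1) ^+ 2 + (u.2 - v.2) ^+ 2).

Let edist_triangle u v w : edist u w <= edist u v + edist v w.
Proof.
apply: le_trans (_ : hypot (norm4 (u.1 - v.1) + norm4 (v.1 - w.1)) ((u.2 - v.2) + (v.2 - w.2)) <= _);
  last exact: hypot_triangle.
apply: hypot_mono; last by rewrite addrA subrK.
rewrite !ger0_norm ?addr_ge0 ?norm4_ge0//.
by rewrite -[u.1 - w.1](_ : (u.1 - v.1) + (v.1 - w.1) = _) ?norm4D// addrA subrK.
Qed.

Let edistC u v : edist u v = edist v u.
Proof. by rewrite /edist norm4_distC -(opprB v.2) sqrrN. Qed.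

Lemma norm2_diff_le r : norm2 (r.1 - r.2) <= 2 * norm4 r.
Proof.
apply: le_trans (norm2D _ _) _; rewrite norm2N.
have := le_hypot (norm2 r.1) (norm2 r.2); have := le_hypotr (norm2 r.1) (norm2 r.2).
by rewrite !ger0_norm ?norm2_ge0// norm4E; lra.
Qed.

Lemma hypo_weight_ge0 r : 0 <= hypo_weight r.
Proof. by rewrite mulr_ge0 ?norm2_ge0 ?expR_ge0. Qed.

Lemma hypo_weight_le2 r : hypo_weight r <= 2.
Proof.
apply: le_trans (_ : 2 * (norm4 r * expR (- norm4 r)) <= _).
  by rewrite mulrA ler_wpM2r ?expR_ge0 ?norm2_diff_le.
by have := mul_expRN_le1 (norm4_ge0 r); lra.
Qed.

(** With [r] the point of smaller norm, the change of the exponential is controlled by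
    [|p - q| <= 2 |r|] and [|r| exp(-|r|) <= 1], the change of [|p - q|] by [exp(-|r'|) <= 1]. Each
    contributes 2. *)
Lemma hypo_weight_lip r r' : `|hypo_weight r - hypo_weight r'| <= 4 * norm4 (r - r').
Proof.
wlog rr : r r' / norm4 r <= norm4 r'.
  move=> H; have [/H//|/ltW/H] := leP (norm4 r) (norm4 r').
  by rewrite distrC norm4_distC.
rewrite (_ : _ - _ = norm2 (r.1 - r.2) * (expR (- norm4 r) - expR (- norm4 r')) +
   expR (- norm4 r') * (norm2 (r.1 - r.2) - norm2 (r'.1 - r'.2))); last first.
  by rewrite /hypo_weight; ring.
apply: le_trans (ler_normD _ _) _.
have h1 : `|norm2 (r.1 - r.2) * (expR (- norm4 r) - expR (- norm4 r'))| <= 2 * norm4 (r - r').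
  have /andP[e0 e1] := expRN_dist (norm4_ge0 r) rr.
  rewrite ger0_norm; last by rewrite mulr_ge0// norm2_ge0.
  apply: le_trans (_ : (2 * norm4 r) * (expR (- norm4 r) * (norm4 r' - norm4 r)) <= _).
    by apply: ler_pM => //; [exact: norm2_ge0|exact: norm2_diff_le].
  rewrite -mulrA ler_wpM2l// mulrA; apply: le_trans (_ : 1 * (norm4 r' - norm4 r) <= _).
    by rewrite ler_wpM2r ?subr_ge0// mul_expRN_le1// norm4_ge0.
  by rewrite mul1r (le_trans (ler_norm _))// norm4_distC norm4_dist.
have h2 : `|expR (- norm4 r') * (norm2 (r.1 - r.2) - norm2 (r'.1 - r'.2))| <= 2 * norm4 (r - r').
  rewrite normrM ger0_norm ?expR_ge0//.
  apply: le_trans (_ : 1 * norm2 ((r - r').1 - (r - r').2) <= _); last first.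
    by rewrite mul1r norm2_diff_le.
  apply: ler_pM; rewrite ?expR_ge0 ?expRN_le1 ?norm4_ge0//.
  apply: le_trans (norm2_dist _ _) _; rewrite le_eqVlt; apply/orP; left; apply/eqP.
  by congr norm2; rewrite /= !opprB addrACA [RHS]addrACA; congr (_ + _); rewrite addrC.
lra.
Qed.

Lemma hypo_embed_lip x y : edist (hypo_embed x) (hypo_embed y) <=
  5 * norm4 (x.1 - y.1) + hypo_weight y.1 * `|c x.2 - c y.2|.
Proof.
apply: le_trans (hypot_le_norm _ _) _; rewrite /= ger0_norm ?norm4_ge0//.
rewrite -/(hypo_weight x.1) -/(hypo_weight y.1).
rewrite (_ : _ - _ = (hypo_weight x.1 - hypo_weight y.1) * c x.2 +
  hypo_weight y.1 * (c x.2 - c y.2)); last by ring.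
have := ler_normD ((hypo_weight x.1 - hypo_weight y.1) * c x.2) (hypo_weight y.1 * (c x.2 - c y.2)).
rewrite [X in _ <= _ + X]normrM (ger0_norm (hypo_weight_ge0 _)) normrM.
have : `|hypo_weight x.1 - hypo_weight y.1| * `|c x.2| <= 4 * norm4 (x.1 - y.1).
  apply: le_trans (hypo_weight_lip _ _); rewrite ler_piMr// contract_le1 //.
lra.
Qed.

Definition subgraph f : set (R4 * \bar R) := [set ra | R4o ra.1 /\ (ra.2 <= f ra.1)%E].

(** A Hausdorff comparison of the hypographs before closure. Passing to the closures costs an
    arbitrarily small amount, hence the strict inequality in [hypo_near_dist]. *)
Definition hypo_near (e : R) f g : Prop :=
  (forall x, subgraph f x -> exists2 y, subgraph g y & edist (hypo_embed x) (hypo_embed y) <= e) /\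
  (forall y, subgraph g y -> exists2 x, subgraph f x & edist (hypo_embed x) (hypo_embed y) <= e).

Lemma hypo_near_refl f : hypo_near 0 f f.
Proof.
have e0 u : edist u u <= 0.
  apply: le_trans (hypot_le_norm _ _) _; rewrite !subrr normr0 addr0 ger0_norm ?norm4_ge0//.
  by rewrite (le_trans (norm4_le_max _))// normr0 mulr0.
by split => x Hx; exists x.
Qed.

Lemma hypo_near_sym e f g : hypo_near e f g -> hypo_near e g f.
Proof. by move=> [h1 h2]; split => x Hx; [have [y] := h2 x Hx|have [y] := h1 x Hx]; exists y => //; rewrite edistC. Qed.

Lemma hypo_near_trans e e' f g h : hypo_near e f g -> hypo_near e' g h -> hypo_near (e + e') f h.
Proof.
move=> [h1 h2] [h3 h4]; split => x Hx.
  have [y Hy ?] := h1 x Hx; have [z Hz ?] := h3 y Hy; exists z => //.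
  by apply: le_trans (edist_triangle _ (hypo_embed y) _) _; apply: lerD.
have [y Hy ?] := h4 x Hx; have [z Hz ?] := h2 y Hy; exists z => //.
by apply: le_trans (edist_triangle _ (hypo_embed y) _) _; apply: lerD.
Qed.

Let closure_approx f x (e : R) : 0 < e -> hypograph f x ->
  exists2 y, subgraph f y & edist (hypo_embed x) (hypo_embed y) < e.
Proof.
move=> e0 [cx _].
have e1 : 0 < e / 16 by rewrite divr_gt0.
have nb : nbhs x [set y : R4 * \bar R | `|x.1 - y.1| < e / 16 /\ `|c x.2 - c y.2| < e / 16].
  exists ([set r : R4 | `|x.1 - r| < e / 16], [set a : \bar R | `|c x.2 - c a| < e / 16]) => //=.
  split; last exact: (nbhsx_ballx x.2 _ e1).
  by have := nbhsx_ballx x.1 _ e1; rewrite -ball_normE.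
have [y [Hy [h1 h2]]] := cx _ nb; exists y => //.
apply: le_lt_trans (hypo_embed_lip _ _) _.
have h3 := norm4_le_max (x.1 - y.1).
have h4 : hypo_weight y.1 * `|c x.2 - c y.2| <= 2 * `|c x.2 - c y.2|.
  by rewrite ler_wpM2r// hypo_weight_le2.
lra.
Qed.

Let half_dist f g (e e' : R) : e < e' ->
  (forall x, subgraph f x -> exists2 y, subgraph g y & edist (hypo_embed x) (hypo_embed y) <= e) ->
  (ereal_sup [set ereal_inf [set (edist a b)%:E | b in @hypo_embed R @` hypograph g] |
     a in @hypo_embed R @` hypograph f] <= e'%:E)%E.
Proof.
move=> ee H; apply: ge_ereal_sup => _ [_ [x Hx <-] <-].
have ee0 : 0 < e' - e by rewrite subr_gt0.
have [y Hy h1] := closure_approx ee0 Hx.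
have [z Hz h2] := H y Hy.
apply: (@le_trans _ _ (edist (hypo_embed x) (hypo_embed z))%:E).
  apply: ereal_inf_lbound; exists (hypo_embed z) => //; exists z => //; split; last by case: Hz.
  exact: subset_closure.
rewrite lee_fin; apply: le_trans (edist_triangle _ (hypo_embed y) _) _; lra.
Qed.

Lemma hypo_near_dist e (e' : R) f g : hypo_near e f g -> e < e' -> (hypo_dist f g < e'%:E)%E.
Proof.
move=> [h1 h2] ee; pose m := (e + e') / 2.
have em : e < m by rewrite /m; lra.
apply: (@le_lt_trans _ _ m%:E); last by rewrite lte_fin /m; lra.
rewrite /hypo_dist /hausdorff_dist ge_max; apply/andP; split; first exact: half_dist em h1.
have h2' y : subgraph g y -> exists2 x, subgraph f x & edist (hypo_embed y) (hypo_embed x) <= e.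
  by move=> /h2[x ? ?]; exists x => //; rewrite edistC.
apply: le_trans (half_dist em h2'); apply: ereal_sup_le => _ [b Hb <-] /=.
exists b => //; congr ereal_inf; apply: eq_imagel => a _.
by rewrite -/(edist b a) edistC.
Qed.

(** The hypograph topology sees little more of [f] than its suprema over small balls, since a
    hypograph contains everything below its points. Here these suprema sit as spikes at the centres
    [cs]. *)
Definition smash (cs : seq R4) (s : R4 -> R) f : R4 -> \bar R :=
  fun r => if r \in cs then ereal_sup (f @` ball r (s r)) else -oo%E.

(** Origin of 22: a move within a ball of radius at most [2 e] in the maximum norm has Euclidean
    length at most [4 e] and costs [5 * 4 e] by [hypo_embed_lip]; a change of height by [e] in
    contracted values costs at most [2 e], the weight being at most 2. *)
Lemma hypo_near_smash (e k : R) (cs : seq R4) (s : R4 -> R) f : 0 < k -> k <= e ->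
  (forall r, r \in cs -> [/\ R4o r, k <= s r <= 2 * e & ball r (s r) `<=` @R4o R]) ->
  (forall r, R4o r -> hypo_weight r <= e \/ exists2 r', r' \in cs & ball r' k r) ->
  hypo_near (22 * e) f (smash cs s f).
Proof.
move=> k0 ke Hcs cov; have e0 : 0 < e := lt_le_trans k0 ke.
have ball4 (l : R) (r r' : R4) : ball r l r' -> norm4 (r - r') <= 2 * l.
  rewrite -ball_normE /ball_ /= => h; apply: le_trans (norm4_le_max _) _.
  by rewrite ler_wpM2l// ltW.
split=> [[r a] [/= or ar]|[r a] [/= or]].
  (* Where the weight is small all heights are embedded close together, so height -oo at the same
     point serves. *)
  have [Wr|[r' r'cs br]] := cov r or.
    exists (r, -oo%E); first by split => //=; rewrite leNye.
    apply: le_trans (hypo_embed_lip _ _) _ => /=.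
    rewrite subrr; have -> : norm4 (0 : R4) = 0.
      by apply/le_anti; rewrite norm4_ge0 (le_trans (norm4_le_max _))// normr0 mulr0.
    have h := contract_dist2 a -oo%E; have h0 := hypo_weight_ge0 r.
    have : hypo_weight r * `|c a - c -oo%E| <= e * 2 by rewrite ler_pM.
    by rewrite /= mulr0 add0r; lra.
  have [or' /andP[es se] _] := Hcs r' r'cs.
  exists (r', a).
    split => //=; rewrite /smash r'cs (le_trans ar)//; apply: ereal_sup_ubound.
    by exists r => //; exact: le_ball es _ br.
  apply: le_trans (hypo_embed_lip _ _) _ => /=; rewrite subrr normr0 mulr0 addr0.
  by have := ball4 _ _ _ br; rewrite norm4_distC; lra.
rewrite /smash; case: ifP => rcs ar; last first.
  exists (r, a); first by split => //=; rewrite (le_trans ar)// leNye.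
  by apply: le_trans (hypo_embed_lip _ _) _; rewrite /= !subrr normr0 mulr0 addr0;
     rewrite (le_trans (ler_wpM2l _ (norm4_le_max _)))// normr0 !mulr0 mulr_ge0// ltW.
have [_ /andP[es se] bo] := Hcs r rcs.
pose S := f @` ball r (s r).
have S0 : S !=set0 by exists (f r); exists r => //; apply: ballxx; apply: lt_le_trans es.
have sS : has_sup (c @` S).
  split; first by have [x Sx] := S0; exists (c x), x.
  by exists 1 => _ [x _ <-]; exact: contract_le_1.
(* A point of the ball where [f] almost reaches its supremum; the height [a] is lowered to [f x] if
   necessary. *)
have [_ [_ [x bx <-] <-] hx] := sup_adherent e0 sS.
rewrite -contract_sup// in hx.
have ca : c a <= c (ereal_sup S) by rewrite le_contract.
exists (x, Order.min a (f x)); first by split => /=; [exact: bo|rewrite ge_min lexx orbT].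
apply: le_trans (hypo_embed_lip _ _) _ => /=.
have h1 := ball4 _ _ _ bx; rewrite norm4_distC in h1.
have h2 : `|c (Order.min a (f x)) - c a| <= e.
  have [afx|fxa] := leP a (f x); first by rewrite subrr normr0 ltW.
  have h3 : c (f x) <= c a by rewrite le_contract ltW.
  by rewrite ler0_norm ?subr_le0//; lra.
have h4 : hypo_weight r * `|c (Order.min a (f x)) - c a| <= 2 * e.
  by rewrite ler_pM ?hypo_weight_ge0// hypo_weight_le2.
lra.
Qed.

Lemma hypo_near_spikes (e : R) (cs : seq R4) f g : 0 <= e ->
  (forall r, r \in cs -> `|c (f r) - c (g r)| <= e) ->
  (forall r, r \notin cs -> f r = -oo%E /\ g r = -oo%E) -> hypo_near (2 * e) f g.
Proof.
have half f' g' : 0 <= e -> (forall r, r \in cs -> `|c (f' r) - c (g' r)| <= e) ->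
    (forall r, r \notin cs -> f' r = -oo%E /\ g' r = -oo%E) ->
    forall x, subgraph f' x -> exists2 y, subgraph g' y & edist (hypo_embed x) (hypo_embed y) <= 2 * e.
  move=> e0 H1 H2 [r a] [/= or ar]; exists (r, Order.min a (g' r)).
    by split => //=; rewrite ge_min lexx orbT.
  apply: le_trans (hypo_embed_lip _ _) _ => /=.
  rewrite subrr; have -> : norm4 (0 : R4) = 0.
    by apply/le_anti; rewrite norm4_ge0 (le_trans (norm4_le_max _))// normr0 mulr0.
  rewrite mulr0 add0r; apply: ler_pM; rewrite ?hypo_weight_ge0 ?hypo_weight_le2//.
  have [ag|ga] := leP a (g' r); first by rewrite subrr normr0.
  have [rcs|rcs] := boolP (r \in cs).
    have := H1 r rcs; have h3 : c (g' r) <= c a by rewrite le_contract ltW.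
    have h4 : c a <= c (f' r) by rewrite le_contract.
    by rewrite !ger0_norm ?subr_ge0//; lra.
  have [fE gE] := H2 r rcs; move: ar; rewrite fE leeNy_eq => /eqP aE.
  by move: ga; rewrite aE gE ltxx.
move=> e0 H1 H2; split; first exact: half.
have H1' r : r \in cs -> `|c (g r) - c (f r)| <= e by move=> /H1; rewrite distrC.
have H2' r : r \notin cs -> g r = -oo%E /\ f r = -oo%E by move=> /H2[].
by move=> y /(half g f e0 H1' H2')[x ? ?]; exists x => //; rewrite edistC.
Qed.

(* The set {hypo_weight >= e} is compact and bounded away from the diagonal. *)
Lemma hypo_net (e : R) : 0 < e -> exists2 cs : seq R4,
  (forall r, r \in cs -> R4o r /\ ball r (2 * (e / 16)) `<=` @R4o R) &
  (forall r, R4o r -> hypo_weight r <= e \/ exists2 r', r' \in cs & ball r' (e / 16) r).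
Proof.
move=> e0; pose k := e / 16; have k0 : 0 < k by rewrite divr_gt0.
pose K : set R4 := [set r | e <= hypo_weight r].
have cW : continuous (hypo_weight : R4 -> R).
  move=> r; apply/cvgrPdist_le => d d0.
  have : nbhs r (ball r (d / 8)) by apply: nbhsx_ballx; rewrite divr_gt0.
  apply: filterS => r'; rewrite -ball_normE /ball_/= => h.
  apply: le_trans (hypo_weight_lip _ _) _.
  by have := norm4_le_max (r - r'); lra.
have clK : closed K.
  by apply: (@closed_comp _ _ hypo_weight [set x | e <= x]) => // r _; exact: cW.
have bK r : K r -> `|r| <= 16 / e.
  rewrite /K /= => h; apply: le_trans (norm_le_norm4 _) _.
  have n0 := norm4_ge0 r.
  have h1 : e <= 2 * norm4 r * expR (- norm4 r).
    by apply: (le_trans h); rewrite ler_wpM2r ?expR_ge0// norm2_diff_le.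
  (* This is [t exp(-t) <= 1] at [t = norm4 r / 2], squared. *)
  have h2 : expR (- norm4 r) * (norm4 r / 2) ^+ 2 <= 1.
    have -> : expR (- norm4 r) = expR (- (norm4 r / 2)) ^+ 2.
      by rewrite expr2 -expRD; congr expR; lra.
    rewrite -exprMn mulrC exprn_ile1 ?mulr_ge0 ?expR_ge0//.
    by rewrite mul_expRN_le1// divr_ge0.
  rewrite ler_pdivlMr//.
  apply: le_trans (_ : norm4 r * (2 * norm4 r * expR (- norm4 r)) <= _); first by rewrite ler_wpM2l.
  by move: h2; rewrite !expr2; lra.
have cK : compact K.
  pose I : set R := `[- (16 / e), 16 / e]%classic.
  have cI : compact I by exact: segment_compact.
  apply: (@subclosed_compact _ _ ((I `*` I) `*` (I `*` I))) => //.
    by do 3 apply: compact_setX => //.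
  move=> [[x s] [y t]] /bK; rewrite prod_normE ge_max /= => /andP[].
  by rewrite !prod_normE !ge_max /= => /andP[h1 h2] /andP[h3 h4];
    split; split; rewrite /I /= in_itv /= -ler_norml.
move: cK; rewrite compact_near_coveringP.
(* Finite sequences directed by inclusion: along this filter the near-covering form of compactness
   produces a finite net. *)
pose G : set_system (seq R4) := 
    filter_from setT (fun s0 : seq R4 => [set s : seq R4 | {subset s0 <= s}]).
have FG : Filter G.
  apply: filter_from_filter; first by exists [::].
  move=> s1 s2 _ _; exists (s1 ++ s2) => // s h; split=> r rs; apply: h.
    by rewrite mem_cat rs.
  by rewrite mem_cat rs orbT.
move=> /(_ _ G (fun s r => exists2 r', r' \in s & K r' /\ ball r' k r) FG) [].
  move=> r Kr; exists (ball r k, [set s : seq R4 | (r : R4) \in s]).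
    split; first exact: nbhsx_ballx.
    by exists [:: r] => // s h; apply: h; rewrite mem_head.
  by move=> [r' s] [/= br rs]; exists r.
move=> s0 _ cov; exists [seq r <- s0 | `[< K r >]].
  move=> r; rewrite mem_filter => /andP[/asboolP Kr _].
  have h0 : e <= norm2 (r.1 - r.2).
    apply: le_trans Kr _; rewrite /hypo_weight ler_piMr ?norm2_ge0//.
    exact: expRN_le1 (norm4_ge0 r).
  have H r' : ball r (2 * k) r' -> R4o r'.
    rewrite -ball_normE /ball_/= => h.
    rewrite /R4o /= => E; have : norm2 (r.1 - r.2) <= 2 * norm4 (r - r').
      apply: le_trans (norm2_diff_le (r - r')).
      by rewrite /= E opprB addrA subrK.
    by have := norm4_le_max (r - r'); rewrite /k in h; lra.
  by split => //; apply: H; apply: ballxx; rewrite mulr_gt0.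
move=> r or; have [Kr|] := leP e (hypo_weight r); last by move=> /ltW; left.
have [r' r's [Kr' br]] := cov s0 (fun=> id) r Kr.
by right; exists r' => //; rewrite mem_filter r's asboolT.
Qed.

Section lipschitz_minorant.
Variables (F : (R4 -> \bar R) -> R) (B : R).
Hypotheses (FB : forall f, `|F f| <= B) (cF : hypo_continuous F).

(** The Pasch-Hausdorff envelope: the largest [j]-Lipschitz minorant of [F], with [hypo_near e] in
    the role of a distance at most [e]. *)
Definition hypo_minorant (j : R) f : R :=
  inf [set y | exists g, exists2 e, 0 <= e /\ hypo_near e f g & y = F g + j * e].

Let has_inf_minorant j f : 0 <= j ->
  has_inf [set y | exists g, exists2 e, 0 <= e /\ hypo_near e f g & y = F g + j * e].
Proof.
move=> j0; split.
  by exists (F f + j * 0); exists f, 0 => //; split => //; exact: hypo_near_refl.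
exists (- B) => _ [g [e [e0 _] ->]].
by have := FB g; rewrite ler_norml => /andP[h _]; have := mulr_ge0 j0 e0; lra.
Qed.

Lemma hypo_minorant_le j f : 0 <= j -> hypo_minorant j f <= F f.
Proof.
move=> j0; apply: ge_inf; first by case: (has_inf_minorant f j0).
by exists f, 0; [split => //; exact: hypo_near_refl|rewrite mulr0 addr0].
Qed.

Lemma hypo_minorant_ge j f : 0 <= j -> - B <= hypo_minorant j f.
Proof.
move=> j0; apply: lb_le_inf; first by case: (has_inf_minorant f j0).
move=> _ [g [e [e0 _] ->]].
by have := FB g; rewrite ler_norml => /andP[h _]; have := mulr_ge0 j0 e0; lra.
Qed.

Lemma hypo_minorant_bound j f : 0 <= j -> `|hypo_minorant j f| <= B.
Proof.
move=> j0; rewrite ler_norml hypo_minorant_ge//=.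
by apply: le_trans (hypo_minorant_le f j0) _; exact: le_trans (ler_norm _) (FB f).
Qed.

Lemma hypo_minorant_lip j e f f' : 0 <= j -> 0 <= e -> hypo_near e f f' ->
  `|hypo_minorant j f - hypo_minorant j f'| <= j * e.
Proof.
move=> j0; have half f1 f2 e' : 0 <= e' -> hypo_near e' f1 f2 ->
    hypo_minorant j f1 <= hypo_minorant j f2 + j * e'.
  move=> e'0 n12; rewrite -lerBlDr; apply: lb_le_inf; first by case: (has_inf_minorant f2 j0).
  move=> _ [g [e2 [e20 n2] ->]]; rewrite lerBlDr -addrA -mulrDr.
  apply: ge_inf; first by case: (has_inf_minorant f1 j0).
  exists g, (e2 + e') => //; split; first by rewrite addr_ge0.
  by rewrite addrC; exact: hypo_near_trans n12 n2.
move=> e0 n; have h1 := half _ _ _ e0 n; have h2 := half _ _ _ e0 (hypo_near_sym n).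
by rewrite ler_norml; apply/andP; split; lra.
Qed.

Lemma hypo_minorant_cvg f : hypo_minorant j%:R f @[j --> \oo] --> F f.
Proof.
apply/cvgrPdist_le => e e0; have [d d0 Hd] := cF f e0.
(* For such [j] a competitor at distance at least [d] pays at least [2 B], the largest possible
   oscillation of [F]; nearby ones are handled by continuity. *)
exists (Num.trunc (2 * B / (d / 2))).+1 => // j /= jd.
have jR : 2 * B <= j%:R * (d / 2).
  rewrite -ler_pdivrMr ?divr_gt0// ltW// (lt_le_trans (truncnS_gt _))// ler_nat//.
rewrite ger0_norm ?subr_ge0 ?hypo_minorant_le//.
rewrite lerBlDr -lerBlDl; apply: lb_le_inf; first by case: (has_inf_minorant f (ler0n R j)).
move=> _ [g [e' [e'0 n] ->]].
have [ed|de] := ltP e' d.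
  have := Hd g (hypo_near_dist n ed); rewrite ltr_norml => /andP[_ h].
  by have := mulr_ge0 (ler0n R j) e'0; lra.
have := FB f; have := FB g; rewrite !ler_norml => /andP[h1 _] /andP[_ h2].
have : j%:R * (d / 2) <= j%:R * e' by rewrite ler_wpM2l//; lra.
lra.
Qed.

End lipschitz_minorant.

End hypograph_distance.

(** * Convergence of finite-dimensional functionals *)

Section graph_functionals.
Context {R : realType}.
Local Notation R2 := (R * R)%type.
Local Notation c := (@contract R).
Implicit Types (f g : R2 -> \bar R) (z : R2).

Let gdist (u v : R2 * R) : R := Num.sqrt (norm2 (u.1 - v.1) ^+ 2 + (u.2 - v.2) ^+ 2).

Let gdistC u v : gdist u v = gdist v u.
Proof. by rewrite /gdist norm2_distC -(opprB v.2) sqrrN. Qed.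

Let gdist_components u v : norm2 (u.1 - v.1) <= gdist u v /\ `|u.2 - v.2| <= gdist u v.
Proof.
split; last exact: le_hypotr.
by rewrite -[leLHS]ger0_norm ?norm2_ge0//; exact: le_hypot.
Qed.

(** Point evaluation is not continuous in the graph topology. This penalised supremum over the
    closed graph is, with Lipschitz constant [1 + k]. For [s = 1] it bounds the weighted value at
    [z] from above, for [s = -1] the opposite of that value, and both bounds become sharp as [k]
    grows if [f] is continuous at [z]. *)
Definition graph_peak (s k : R) z f : R :=
  sup [set s * v.2 - k * norm2 (v.1 - z) | v in @graph_embed R @` graph_closure f].

Let graph_point f r : (@graph_embed R @` graph_closure f) (r, expR (- norm2 r) * c (f r)).
Proof. by exists (r, f r) => //; exact: subset_closure. Qed.

Let weight_le1 r x : `|expR (- norm2 r) * c x| <= 1.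
Proof.
rewrite normrM ger0_norm ?expR_ge0// -[leRHS]mul1r ler_pM ?expR_ge0 ?contract_le1//.
exact: expRN_le1 (norm2_ge0 r).
Qed.

Lemma norm2_0 : norm2 (0 : R2) = 0.
Proof. by apply/eqP; rewrite norm2_eq0. Qed.

Section sign.
Variables (s : R) (s1 : `|s| = 1).

Let has_sup_peak k z f : 0 <= k ->
  has_sup [set s * v.2 - k * norm2 (v.1 - z) | v in @graph_embed R @` graph_closure f].
Proof.
move=> k0; split; first by exists (s * (expR (- norm2 z) * c (f z)) - k * norm2 (z - z));
  exists (z, expR (- norm2 z) * c (f z)) => //; exact: graph_point.
exists 1 => _ [_ [[r a] _ <-] <-] /=.
have := ler_norm (s * (expR (- norm2 r) * c a)); rewrite normrM s1 mul1r.
have := weight_le1 r a; have := mulr_ge0 k0 (norm2_ge0 (r - z)); lra.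
Qed.

Lemma graph_peak_ge k z f : 0 <= k -> s * (expR (- norm2 z) * c (f z)) <= graph_peak s k z f.
Proof.
move=> k0; apply: sup_upper_bound; first exact: has_sup_peak.
exists (z, expR (- norm2 z) * c (f z)); first exact: graph_point.
by rewrite /= subrr norm2_0 mulr0 subr0.
Qed.

Let near_le k z f g (e : R) : 0 <= k -> 0 <= e ->
  (forall u, (@graph_embed R @` graph_closure f) u ->
     exists2 v, (@graph_embed R @` graph_closure g) v & gdist u v < e) ->
  graph_peak s k z f <= graph_peak s k z g + (1 + k) * e.
Proof.
move=> k0 e0 H; apply: sup_le_ub; first by case: (has_sup_peak z f k0).
move=> _ [u Hu <-]; have [v Hv uv] := H u Hu.
have [h1 h2] := gdist_components u v.
have h3 : s * v.2 - k * norm2 (v.1 - z) <= graph_peak s k z g.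
  by apply: sup_upper_bound; [exact: has_sup_peak|exists v].
have h4 : s * u.2 - s * v.2 <= gdist u v.
  rewrite -mulrBr; apply: le_trans (ler_norm _) _; rewrite normrM s1 mul1r.
  exact: h2.
have h5 : norm2 (v.1 - z) <= norm2 (u.1 - z) + norm2 (u.1 - v.1).
  by have := norm2D (v.1 - u.1) (u.1 - z); rewrite addrA subrK (norm2_distC v.1 u.1) [leRHS]addrC.
have h6 : k * norm2 (v.1 - z) <= k * (norm2 (u.1 - z) + norm2 (u.1 - v.1)) by rewrite ler_wpM2l.
have h7 : k * norm2 (u.1 - v.1) <= k * e by rewrite ler_wpM2l// (le_trans h1)// ltW.
move: h6; rewrite mulrDr mulrDl mul1r; lra.
Qed.

Lemma graph_peak_lip k z f g (e : R) : 0 <= k -> 0 < e -> (graph_dist f g < e%:E)%E ->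
  `|graph_peak s k z f - graph_peak s k z g| <= (1 + k) * e.
Proof.
move=> k0 e0; rewrite /graph_dist /hausdorff_dist gt_max => /andP[h1 h2].
have H1 u : (@graph_embed R @` graph_closure f) u ->
     exists2 v, (@graph_embed R @` graph_closure g) v & gdist u v < e.
  move=> Hu; have : (ereal_inf [set (gdist u b)%:E | b in @graph_embed R @` graph_closure g] < e%:E)%E.
    by apply: le_lt_trans h1; apply: ereal_sup_ubound; exists u.
  by move=> /ereal_inf_lt[_ [v Hv <-]]; rewrite lte_fin; exists v.
have H2 u : (@graph_embed R @` graph_closure g) u ->
     exists2 v, (@graph_embed R @` graph_closure f) v & gdist u v < e.
  move=> Hu; have : (ereal_inf [set (gdist b u)%:E | b in @graph_embed R @` graph_closure f] < e%:E)%E.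
    by apply: le_lt_trans h2; apply: ereal_sup_ubound; exists u.
  by move=> /ereal_inf_lt[_ [v Hv <-]]; rewrite lte_fin gdistC; exists v.
have := near_le z k0 (ltW e0) H1; have := near_le z k0 (ltW e0) H2.
by rewrite ler_norml => *; apply/andP; split; lra.
Qed.

Lemma graph_peak_bound k z f : 0 <= k -> `|graph_peak s k z f| <= 1.
Proof.
move=> k0; rewrite ler_norml; apply/andP; split.
  apply: le_trans (graph_peak_ge z f k0).
  have := weight_le1 z (f z); have := ler_norm (- (s * (expR (- norm2 z) * c (f z)))).
  by rewrite normrN normrM s1 mul1r; lra.
apply: sup_le_ub; first by case: (has_sup_peak z f k0).
move=> _ [_ [[r a] _ <-] <-] /=.
have := ler_norm (s * (expR (- norm2 r) * c a)); rewrite normrM s1 mul1r.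
have := weight_le1 r a; have := mulr_ge0 k0 (norm2_ge0 (r - z)); lra.
Qed.

Let embed_near r (x : R2 * \bar R) (e : R) : 0 < e -> graph_closure r x ->
  exists r', gdist (graph_embed x) (graph_embed (r', r r')) < e.
Proof.
move: r => f e0 cx; have e1 : 0 < e / 8 by rewrite divr_gt0.
have nb : nbhs x [set y : R2 * \bar R | `|x.1 - y.1| < e / 8 /\ `|c x.2 - c y.2| < e / 8].
  exists ([set r : R2 | `|x.1 - r| < e / 8], [set a : \bar R | `|c x.2 - c a| < e / 8]) => //=.
  split; last exact: (nbhsx_ballx x.2 _ e1).
  by have := nbhsx_ballx x.1 _ e1; rewrite -ball_normE.
have [[r' a] [/= -> [/= h1 h2]]] := cx _ nb; exists r'.
apply: le_lt_trans (hypot_le_norm _ _) _; rewrite /= ger0_norm ?norm2_ge0//.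
have h3 := norm2_le_max (x.1 - r').
have h4 : `|expR (- norm2 x.1) * c x.2 - expR (- norm2 r') * c (f r')| <=
    norm2 (x.1 - r') + `|c x.2 - c (f r')|.
  rewrite (_ : _ - _ = (expR (- norm2 x.1) - expR (- norm2 r')) * c x.2 +
     expR (- norm2 r') * (c x.2 - c (f r'))); last by ring.
  apply: le_trans (ler_normD _ _) _; rewrite !normrM; apply: lerD.
    apply: le_trans (ler_wpM2l (normr_ge0 _) (contract_le1 x.2)) _; rewrite mulr1.
    by apply: le_trans (expRN_lip (norm2_ge0 _) (norm2_ge0 _)) _; exact: norm2_dist.
  by rewrite ger0_norm ?expR_ge0// ler_piMl// expRN_le1// norm2_ge0.
lra.
Qed.

Lemma graph_peak_le k z f y : 0 <= k ->
  (forall r, s * (expR (- norm2 r) * c (f r)) - k * norm2 (r - z) <= y) ->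
  graph_peak s k z f <= y.
Proof.
move=> k0 H; apply: sup_le_ub; first by case: (has_sup_peak z f k0).
move=> _ [_ [x Hx <-] <-]; apply/ler_addgt0Pr => e e0.
have e1 : 0 < e / (1 + k) by rewrite divr_gt0//; lra.
have [r uv] := embed_near e1 Hx; have := H r.
set u := graph_embed x in uv *; set v := graph_embed (r, f r) in uv *.
have [h1 h2] := gdist_components u v.
rewrite -[s * _]/(s * v.2) -[r - z]/(v.1 - z) => h3.
have h4 : s * u.2 - s * v.2 <= gdist u v.
  by rewrite -mulrBr; apply: le_trans (ler_norm _) _; rewrite normrM s1 mul1r.
have h5 : norm2 (v.1 - z) <= norm2 (u.1 - z) + norm2 (u.1 - v.1).
  by have := norm2D (v.1 - u.1) (u.1 - z); rewrite addrA subrK (norm2_distC v.1 u.1) [leRHS]addrC.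
have h6 : k * norm2 (v.1 - z) <= k * (norm2 (u.1 - z) + norm2 (u.1 - v.1)) by rewrite ler_wpM2l.
have h7 : k * norm2 (u.1 - v.1) <= k * gdist u v by rewrite ler_wpM2l.
have h8 : (1 + k) * gdist u v <= e.
  by rewrite mulrC -ler_pdivlMr ?ltW//; lra.
move: h6 h8; rewrite mulrDr mulrDl mul1r; lra.
Qed.

Lemma graph_peak_cvg z f : {for z, continuous f} ->
  graph_peak s k%:R z f @[k --> \oo] --> s * (expR (- norm2 z) * c (f z)).
Proof.
move=> cf; apply/cvgrPdist_le => e e0.
have : (expR (- norm2 r) * c (f r)) @[r --> z] --> expR (- norm2 z) * c (f z).
  apply: cvgM; last by apply: cvg_comp cf _; exact: continuous_contract.
  apply/cvgrPdist_le => e' e'0.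
  have : nbhs z (ball z (e' / 2)) by apply: nbhsx_ballx; rewrite divr_gt0.
  apply: filterS => r; rewrite -ball_normE /ball_/= => h.
  apply: le_trans (expRN_lip (norm2_ge0 _) (norm2_ge0 _)) _.
  by apply: le_trans (norm2_dist _ _) _; have := norm2_le_max (z - r); lra.
move=> /cvgrPdist_le /(_ e e0) /nbhs_ballP[d d0 Hd].
exists (Num.trunc (2 / d)).+1 => // k /= dk.
(* Beyond distance [d] the penalty is at least 2, the largest difference of two weighted values. *)
have kd : 2 <= k%:R * d.
  by rewrite -ler_pdivrMr// ltW// (lt_le_trans (truncnS_gt _))// ler_nat.
rewrite distrC ger0_norm ?subr_ge0 ?graph_peak_ge// lerBlDr; apply: graph_peak_le => // r.
have [h|h] := ltP (norm2 (r - z)) d.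
  have /Hd : ball z d r.
    rewrite -ball_normE /ball_/=; apply: le_lt_trans h.
    by rewrite distrC prod_normE ge_max le_hypot le_hypotr.
  move=> h1; have h2 : s * (expR (- norm2 r) * c (f r)) - s * (expR (- norm2 z) * c (f z)) <= e.
    by rewrite -mulrBr; apply: le_trans (ler_norm _) _; rewrite normrM s1 mul1r distrC.
  by have := mulr_ge0 (ler0n R k) (norm2_ge0 (r - z)); lra.
have h1 : k%:R * d <= k%:R * norm2 (r - z) by rewrite ler_wpM2l.
have := ler_norm (s * (expR (- norm2 r) * c (f r))); rewrite normrM s1 mul1r.
have := ler_norm (- (s * (expR (- norm2 z) * c (f z)))); rewrite normrN normrM s1 mul1r.
have := weight_le1 r (f r); have := weight_le1 z (f z); lra.
Qed.

End sign.
End graph_functionals.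

Lemma measurable_unif {R : realType} d (T : measurableType d) V (x : T -> V) (H : V -> R) :
  (forall e : R, 0 < e -> exists2 H' : V -> R, measurable_fun setT (H' \o x) &
     forall f, `|H f - H' f| <= e) -> measurable_fun setT (H \o x).
Proof.
move=> A; have B (n : nat) : {H' : V -> R | measurable_fun setT (H' \o x) & forall f, `|H f - H' f| <= n.+1%:R^-1}.
  by apply: cid2; apply: A; rewrite invr_gt0.
apply: (measurable_fun_cvg (h := fun n => s2val (B n) \o x)) => [n|w _]; first by rewrite /=; case: (B n).
apply/cvgrPdist_le => e e0; exists (Num.trunc e^-1).+1 => // n /= ne.
rewrite (le_trans (s2valP' (B n) (x w)))// -[leRHS]invrK lef_pV2 ?posrE ?invr_gt0//.
by rewrite ltW// (lt_le_trans (truncnS_gt _))// ler_nat ltnW.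
Qed.

(** * Test functionals and convergence of their means *)

Section convergence.
Context {R : realType} (dO : nat -> measure_display) (Omega : forall n, measurableType (dO n))
  (P : forall n, probability (Omega n) R)
  (dL : measure_display) (OmegaL : measurableType dL) (PL : probability OmegaL R)
  (U : eqType).
Local Notation c := (@contract R).

Section tests.
Variables (V : Type) (xi : forall n, Omega n -> V) (xiL : OmegaL -> V).

Definition conv_test (H : V -> R) : Prop :=
  [/\ exists M, forall f, `|H f| <= M, forall n, measurable_fun setT (H \o @xi n),
      measurable_fun setT (H \o xiL) &
      ev (P n) (H \o @xi n) @[n --> \oo] --> ev PL (H \o xiL)].

Lemma conv_test_bdd H : conv_test H ->
  (forall n, bdd_meas (H \o @xi n)) /\ bdd_meas (H \o xiL).
Proof.
by move=> [[M HM] m1 m2 _]; split => [n|]; split => //; exists M => w; exact: HM.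
Qed.

Lemma conv_testD H H' : conv_test H -> conv_test H' -> conv_test (fun f => H f + H' f).
Proof.
move=> tH tH'; have [b1 b2] := conv_test_bdd tH; have [b3 b4] := conv_test_bdd tH'.
move: tH tH' => [[M HM] _ _ cv] [[M' HM'] _ _ cv']; split.
- by exists (M + M') => f; rewrite (le_trans (ler_normD _ _))// lerD.
- by move=> n; have [] := bdd_measD (b1 n) (b3 n).
- by have [] := bdd_measD b2 b4.
- rewrite [X in _ --> X](evD PL b2 b4).
  under eq_fun do rewrite [ev _ _](evD (P _) (b1 _) (b3 _)).
  exact: cvgD.
Qed.

Lemma conv_testZ k H : conv_test H -> conv_test (fun f => k * H f).
Proof.
move=> tH; have [b1 b2] := conv_test_bdd tH; move: tH => [[M HM] _ _ cv]; split.
- by exists (`|k| * M) => f; rewrite normrM ler_wpM2l.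
- by move=> n; have [] := bdd_measZ k (b1 n).
- by have [] := bdd_measZ k b2.
- rewrite [X in _ --> X](evZ PL k b2).
  under eq_fun do rewrite [ev _ _](evZ (P _) k (b1 _)).
  exact: cvgMl_tmp.
Qed.

Lemma conv_test_eq H H' : (forall f, H f = H' f) -> conv_test H -> conv_test H'.
Proof. by move=> /funext ->. Qed.

Lemma conv_testB H H' : conv_test H -> conv_test H' -> conv_test (fun f => H f - H' f).
Proof.
move=> tH /(conv_testZ (-1)) tH'; apply: conv_test_eq (conv_testD tH tH') => f.
by rewrite mulN1r.
Qed.

Lemma conv_test_cst k : conv_test (fun=> k).
Proof.
split; [by exists (`|k|)|by move=> n; exact: measurable_cst|exact: measurable_cst|].
by rewrite [X in _ --> X]ev_cst; under eq_fun do rewrite [ev _ _]ev_cst; exact: cvg_cst.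
Qed.

Lemma conv_test_sum (I : eqType) (s : seq I) (F : I -> V -> R) :
  (forall i, i \in s -> conv_test (F i)) -> conv_test (fun f => \sum_(i <- s) F i f).
Proof.
elim: s => [|i s IH] H.
  by apply: conv_test_eq (conv_test_cst 0) => f; rewrite big_nil.
apply: conv_test_eq (conv_testD (H i (mem_head _ _)) (IH _)) => [f|j js].
  by rewrite big_cons.
by apply: H; rewrite inE js orbT.
Qed.

(** The error bound [K] is itself a test functional: that its mean is small under the limit law
    carries over to all large [n]. *)
Lemma conv_test_approx (H : V -> R) : (exists M, forall f, `|H f| <= M) ->
  (forall n, measurable_fun setT (H \o @xi n)) -> measurable_fun setT (H \o xiL) ->
  (forall e : R, 0 < e -> exists H' K, [/\ conv_test H', conv_test K,
     ev PL (K \o xiL) < e, `|ev PL (H \o xiL) - ev PL (H' \o xiL)| < e &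
     forall n (w : Omega n), `|H (xi w) - H' (xi w)| <= K (xi w)]) -> conv_test H.
Proof.
move=> bH m1 m2 A; split => //.
have b1 n : bdd_meas (H \o @xi n) by split => //; have [M HM] := bH; exists M => w; exact: HM.
have b2 : bdd_meas (H \o xiL) by split => //; have [M HM] := bH; exists M => w; exact: HM.
apply/cvgrPdist_lt => e e0; have e4 : 0 < e / 4 by rewrite divr_gt0.
have [H' [K [tH' tK Ke h4 Hn]]] := A _ e4.
have [b3 b4] := conv_test_bdd tH'; have [b5 b6] := conv_test_bdd tK.
have [_ _ _ /cvgrPdist_lt /(_ _ e4) cH'] := tH'.
have [_ _ _ /cvgr_lt /(_ _ Ke) cK] := tK.
near=> n.
have h1 : `|ev PL (H' \o xiL) - ev (P n) (H' \o @xi n)| < e / 4 by near: n.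
have h2 : ev (P n) (K \o @xi n) < e / 4 by near: n.
have h3 := ev_dist_le (P n) (b1 n) (b3 n) (b5 n) (Hn n).
move: h1 h3 h4; rewrite !ltr_norml !ler_norml => /andP[? ?] /andP[? ?] /andP[? ?].
by apply/andP; split; lra.
Unshelve. all: by end_near. Qed.

Lemma conv_test_unif (H : V -> R) :
  (forall e : R, 0 < e -> exists2 H', conv_test H' & forall f, `|H f - H' f| <= e) -> conv_test H.
Proof.
move=> A; have mu d (T : measurableType d) (x : T -> V) :
    (forall H', conv_test H' -> measurable_fun setT (H' \o x)) -> measurable_fun setT (H \o x).
  move=> mx; apply: measurable_unif => e e0; have [H' tH' h] := A e e0.
  by exists H' => //; exact: mx.
have bH : exists M, forall f, `|H f| <= M.
  have [H' [[M HM] _ _ _] h] := A 1 ltr01; exists (1 + M) => f.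
  by rewrite -(subrK (H' f) (H f)) (le_trans (ler_normD _ _))// lerD.
have [M HM] := bH.
have mL : measurable_fun setT (H \o xiL) by apply: mu => H' [].
have mn n : measurable_fun setT (H \o @xi n) by apply: mu => H' [].
apply: conv_test_approx => // e e0; have e2 : 0 < e / 2 by rewrite divr_gt0.
have [H' tH' h] := A _ e2; have [_ bL] := conv_test_bdd tH'.
exists H', (fun=> e / 2); split => //.
- exact: conv_test_cst.
- by rewrite [ltLHS]ev_cst; lra.
- apply: (@le_lt_trans _ _ (e / 2)); last by lra.
  by apply: ev_dist => // [|w]; [split => //; exists M => w; exact: HM|exact: h].
Qed.

End tests.

Variables (d : forall n, Omega n -> U -> \bar R) (L : OmegaL -> U -> \bar R).
Arguments conv_test {V}.

Definition conv_on (D : seq U) : Prop := forall H, contract_lip D H -> conv_test d L H.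

Lemma conv_on_product (D : seq U) :
  (forall s, (forall p, p \in unzip1 s -> p \in D) ->
     (forall i, (i < size s)%N -> nice (nth id (unzip2 s) i)) -> conv_test d L (product s)) ->
  conv_on D.
Proof.
move=> H; apply: contract_lip_test => //.
- by move=> *; exact: conv_testD.
- by move=> *; exact: conv_testZ.
- by move=> *; exact: conv_test_unif.
Qed.

End convergence.

Lemma prod_dist (R : realType) (I : eqType) (l : seq I) (x y : I -> R) :
  (forall i, i \in l -> 0 <= x i <= 1) -> (forall i, i \in l -> 0 <= y i <= 1) ->
  `|\prod_(i <- l) x i - \prod_(i <- l) y i| <= \sum_(i <- l) `|x i - y i|.
Proof.
elim: l => [|i l IH] Hx Hy; first by rewrite !big_nil subrr normr0.
have /IH h : forall j, j \in l -> 0 <= x j <= 1 by move=> j jl; rewrite Hx// inE jl orbT.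
have /h k : forall j, j \in l -> 0 <= y j <= 1 by move=> j jl; rewrite Hy// inE jl orbT.
have /andP[x0 x1] := Hx i (mem_head _ _).
have y01 : 0 <= \prod_(j <- l) y j <= 1.
  rewrite big_seq prodr_ge0 ?prodr_ile1//= => j jl.
    by rewrite Hy// inE jl orbT.
  by have /andP[] : 0 <= y j <= 1 by rewrite Hy// inE jl orbT.
rewrite !big_cons; move: k y01; set a := \prod_(_ <- _) _; set b := \prod_(_ <- _) _.
move=> k /andP[b0 b1].
rewrite (_ : x i * a - y i * b = b * (x i - y i) + x i * (a - b)); last by ring.
apply: le_trans (ler_normD _ _) _; rewrite !normrM (ger0_norm x0) (ger0_norm b0).
by apply: lerD; [exact: ler_piMl|apply: le_trans k; exact: ler_piMl].
Qed.

(** * What the two convergence hypotheses give at single points and in single strips *)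

Section limits_in_law.
Context {R : realType} (dO : nat -> measure_display) (Omega : forall n, measurableType (dO n))
  (P : forall n, probability (Omega n) R)
  (dL : measure_display) (OmegaL : measurableType dL) (PL : probability OmegaL R).
Local Notation c := (@contract R).
Local Notation R4 := ((R * R) * (R * R))%type.

Lemma cvg_in_distribution_conv_test V (C : set (V -> R)) (xi : forall n, Omega n -> V)
    (xiL : OmegaL -> V) (H : V -> R) :
  cvg_in_distribution C P xi PL xiL -> C H -> (exists M, forall f, `|H f| <= M) ->
  conv_test P PL xi xiL H.
Proof.
move=> cv CH [M HM]; have [|m1 m2 cE] := cv H CH; first by exists M.
split => //; first by exists M.
have bn n : bdd_meas (H \o xi n) by split => //; exists M => w; exact: HM.
have bL : bdd_meas (H \o xiL) by split => //; exists M => w; exact: HM.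
move: cE; rewrite (ev_expectation PL bL); under eq_fun do rewrite (ev_expectation _ (bn _)).
exact: fine_cvg.
Qed.

Lemma conv_test_cvg_in_distribution V (C : set (V -> R)) (xi : forall n, Omega n -> V)
    (xiL : OmegaL -> V) :
  (forall H, C H -> (exists M, forall f, `|H f| <= M) -> conv_test P PL xi xiL H) ->
  cvg_in_distribution C P xi PL xiL.
Proof.
move=> T H CH bH; have tH := T H CH bH; have [bn bL] := conv_test_bdd tH.
move: tH => [_ m1 m2 cv]; split => //.
rewrite (ev_expectation PL bL); under eq_fun do rewrite (ev_expectation _ (bn _)).
by apply: cvg_EFin; [exact: nearW|].
Qed.

Variables (d : forall n, Omega n -> R4 -> \bar R) (L : OmegaL -> R4 -> \bar R).
Hypothesis L_landscape : directed_landscape PL L.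

Section mobile.
Hypothesis mobile : forall (u_ : nat -> R4) (u : R4),
  R4up u -> u_ n @[n --> \oo] --> u ->
  cvg_in_distribution [set F : \bar R -> R | continuous F]
    P (fun n w => d w (u_ n)) PL (fun w => L w u).

Lemma mobile_point u (F : \bar R -> R) : R4up u -> continuous F ->
  (exists M, forall x, `|F x| <= M) -> conv_test P PL d L (fun f => F (f u)).
Proof.
move=> uu cF [M HM].
have [|bM m1 m2 cv] := cvg_in_distribution_conv_test (mobile uu (cvg_cst u)) cF.
  by exists M.
by split => //; exists M => f; exact: HM.
Qed.

Section continuous_functional.
Variables (F : \bar R -> R) (cF : continuous F) (bF : exists M, forall x, `|F x| <= M).

(** Convergence along every sequence [u_n] amounts to uniformity near [u]: if that failed, bad
    points [U k] with indices [N k >= k] could be merged into one sequence that converges to [u]. *)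
Lemma mobile_local u (e : R) : R4up u -> 0 < e ->
  \forall u' \near u & n \near \oo,
    `|ev (P n) (fun w => F (d w u')) - ev PL (fun w => F (L w u))| < e.
Proof.
move=> uu e0; apply: contrapT => H.
pose bad n u' := ~ `|ev (P n) (fun w => F (d w u')) - ev PL (fun w => F (L w u))| < e.
have B (k : nat) : {nu : nat * R4 | [/\ (k <= nu.1)%N, ball u k.+1%:R^-1 nu.2 & bad nu.1 nu.2]}.
  apply: cid; apply: contrapT => nB; apply: H.
  exists (ball u k.+1%:R^-1, [set n | (k <= n)%N]); first split => /=.
  - by apply: nbhsx_ballx; rewrite invr_gt0.
  - exact: nbhs_infty_ge.
  - move=> [u' n] /= [bu kn]; apply: contrapT => bd; apply: nB.
    by exists (n, u').
pose N k := (sval (B k)).1; pose U k := (sval (B k)).2.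
have NU k : [/\ (k <= N k)%N, ball u k.+1%:R^-1 (U k) & bad (N k) (U k)] by exact: svalP (B k).
(* At index [n] a bad point if there is one, and [u] otherwise. Several [k] may share the same
   [N k]; any choice among them is bad for that index. *)
pose u_ n := if pselect (exists k, N k = n) is left h then U (sval (cid h)) else u.
have uN n : u_ n = u \/ exists k, N k = n /\ u_ n = U k.
  rewrite /u_; case: pselect => [h|_]; last by left.
  by right; exists (sval (cid h)); split => //; exact: svalP (cid h).
have cu : u_ n @[n --> \oo] --> u.
  apply/cvg_ballP => r r0.
  (* [M] exceeds every [N k] with [k < K], so an index past [M] comes from some [k >= K], whose ball
     has radius below [r]. *)
  pose K := (Num.trunc r^-1).+1; pose M := (\sum_(0 <= k < K) N k).+1.
  exists M => // n /= Mn; have [->|[k [kn ->]]] := uN n; first exact: ballxx.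
  have [_ + _] := NU k; apply: le_ball.
  have Kk : (K <= k)%N.
    rewrite leqNgt; apply/negP => kK; move: Mn; rewrite ltnNge => /negP; apply.
    by rewrite -kn (big_rem k) ?mem_index_iota//= leq_addr.
  rewrite -[leRHS]invrK lef_pV2 ?posrE ?invr_gt0//.
  by rewrite ltW// (lt_le_trans (truncnS_gt _))// ler_nat ltnW.
have [_ _ _ /cvgrPdist_lt /(_ e e0) [N0 _ HN0]] :=
  cvg_in_distribution_conv_test (mobile uu cu) cF bF.
have [k1 _ bd] := NU N0.
have un : exists k, N k = N N0 /\ u_ (N N0) = U k.
  rewrite /u_; case: pselect => [h|nh].
    by exists (sval (cid h)); split => //; exact: svalP (cid h).
  by exfalso; apply: nh; exists N0.
have [k [kN uk]] := un; have [_ _ bk] := NU k.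
apply: bk; rewrite distrC -uk kN; exact: (HN0 (N N0) k1).
Qed.

Lemma mobile_compact (K : set R4) (r : R) : compact K -> K `<=` @R4up R ->
  (forall u, K u -> ev PL (fun w => F (L w u)) < r) ->
  \forall n \near \oo, forall u, K u -> ev (P n) (fun w => F (d w u)) < r.
Proof.
move=> /compact_near_coveringP cK sub H.
apply: (cK nat \oo (fun n u => ev (P n) (fun w => F (d w u)) < r) _) => u Ku.
have e0 : 0 < r - ev PL (fun w => F (L w u)) by rewrite subr_gt0 H.
have := mobile_local (sub _ Ku) e0; apply: filterS => -[u' n] /=.
by rewrite ltr_norml => /andP[_]; lra.
Qed.

End continuous_functional.

Section slices.
Hypothesis sheet : forall s t : R, s < t ->
  cvg_in_distribution (@graph_continuous R)
    P (fun n w => time_slice s t (d w)) PL (fun w => time_slice s t (L w)).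
Variables (s t : R).
Hypothesis st : s < t.

Let graph_lip (H : (R * R -> \bar R) -> R) := exists2 C : R, 0 <= C & forall f g (e : R),
  0 < e -> (graph_dist f g < e%:E)%E -> `|H f - H g| <= C * e.

Let graph_lip_continuous H : graph_lip H -> graph_continuous H.
Proof.
move=> [C C0 HC] f e e0; exists (e / (C + 1)) => [|g fg]; first by rewrite divr_gt0//; lra.
have C1 : 0 < C + 1 by lra.
apply: le_lt_trans (HC _ _ _ _ fg) _; first by rewrite divr_gt0.
by rewrite mulrCA gtr_pMr// ltr_pdivrMr//; lra.
Qed.

Let slice_peak_conv sg k z : `|sg| = 1 -> 0 <= k ->
  conv_test P PL d L (fun f => graph_peak sg k z (time_slice s t f)).
Proof.
move=> s1 k0.
have [||bM m1 m2 cv] := cvg_in_distribution_conv_test (H := graph_peak sg k z) (sheet st).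
- apply: graph_lip_continuous; exists (1 + k) => [|f g e]; first by lra.
  exact: graph_peak_lip.
- by exists 1 => f; exact: graph_peak_bound.
by split => //; exists 1 => f; exact: graph_peak_bound.
Qed.

(** Each value is replaced by its upper peak functional; the sum of the upper and the lower peak at
    the same point bounds the error for every [f]. Continuity enters through the landscape, for
    which this sum tends to 0. *)
Lemma slice_conv (D : seq R4) : (forall u, u \in D -> u.1.2 = s /\ u.2.2 = t) ->
  conv_on P PL d L D.
Proof.
move=> HD; apply: conv_on_product => l lD Hnice.
pose u0 : R4 := ((0, 0), (0, 0)); pose u i := nth u0 (unzip1 l) i.
pose phi i := nth id (unzip2 l) i; pose r := iota 0 (size l).
pose Z i : R * R := ((u i).1.1, (u i).2.1).
have ri i : i \in r -> (i < size l)%N by rewrite mem_iota.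
have Ei f : product l f = \prod_(i <- r) phi i (c (f (u i))).
  rewrite /product (big_nth (u0, id)) /r /index_iota subn0 big_seq [RHS]big_seq.
  apply: eq_bigr => i; rewrite mem_iota => /andP[_ il].
  by rewrite /phi /u (nth_map (u0, id))// (nth_map (u0, id)).
have HK i : exists K : R, 0 <= K /\ ((i < size l)%N ->
    (forall x, 0 <= phi i x <= 1) /\ forall x y, `|phi i x - phi i y| <= K * `|x - y|).
  have [il|il] := boolP (i < size l)%N; last by exists 0; split => //; rewrite (negbTE il).
  by have [h [K K0 hK]] := Hnice i il; exists K.
have {HK} [K HK] := choice HK.
(* The factor [expR (norm2 _)] undoes the weight of the graph embedding. *)
have uZ i f : i \in r -> c (f (u i)) = expR (norm2 (Z i)) *
    (expR (- norm2 (Z i)) * c (time_slice s t f (Z i))).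
  move=> /ri il; rewrite mulrA -expRD subrr expR0 mul1r /time_slice /Z /=.
  have [<- <-] : (u i).1.2 = s /\ (u i).2.2 = t.
    by apply: HD; apply: lD; rewrite mem_nth// size_map.
  by case: (u i) => [[? ?] [? ?]].
pose peak sg (k : nat) i (f : R4 -> \bar R) := graph_peak sg k%:R (Z i) (time_slice s t f).
pose H k (f : R4 -> \bar R) := \prod_(i <- r) phi i (expR (norm2 (Z i)) * peak 1 k i f).
pose E k (f : R4 -> \bar R) :=
  \sum_(i <- r) K i * expR (norm2 (Z i)) * (peak 1 k i f + peak (-1) k i f).
have n1 : `|1 : R| = 1 by rewrite normr1.
have nN1 : `|-1 : R| = 1 by rewrite normrN1.
have phi01 i x : i \in r -> 0 <= phi i x <= 1 by move=> /ri /(HK i).2[].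
have phiK i x y : i \in r -> `|phi i x - phi i y| <= K i * `|x - y| by move=> /ri /(HK i).2[].
have tE k : conv_test P PL d L (E k).
  apply: conv_test_sum => i _; apply: conv_testZ.
  by apply: conv_testD; exact: slice_peak_conv.
have tH k : conv_test P PL d L (H k).
  have bH f : `|H k f| <= 1.
    rewrite ger0_norm /H big_seq ?prodr_ge0 ?prodr_ile1// => i ir; last by have /andP[] := phi01 i (expR (norm2 (Z i)) * peak 1 k i f) ir.
    exact: phi01.
  pose G (g : R * R -> \bar R) := \prod_(i <- r) phi i (expR (norm2 (Z i)) * graph_peak 1 k%:R (Z i) g).
  have [||bM m1 m2 cv] := cvg_in_distribution_conv_test (H := G) (sheet st).
  - apply: graph_lip_continuous; exists (\sum_(i <- r) K i * expR (norm2 (Z i)) * (1 + k%:R)).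
      by apply: sumr_ge0 => i _; rewrite !mulr_ge0 ?expR_ge0 ?addr_ge0//; case: (HK i).
    move=> f g e e0 fg; apply: le_trans (prod_dist _ _) _ => [i ir|i ir|]; [exact: phi01..|].
    rewrite mulr_suml big_seq [leRHS]big_seq; apply: ler_sum => i ir.
    apply: le_trans (phiK _ _ _ ir) _; rewrite -!mulrA ler_wpM2l//; first by case: (HK i).
    rewrite -mulrBr normrM ger0_norm ?expR_ge0// ler_wpM2l ?expR_ge0//.
    exact: graph_peak_lip.
  - exists 1 => g; rewrite ger0_norm /G big_seq ?prodr_ge0 ?prodr_ile1// => i ir; last by have /andP[] := phi01 i (expR (norm2 (Z i)) * graph_peak 1 k%:R (Z i) g) ir.
    exact: phi01.
  by split => //; exists 1.
have close k f : `|product l f - H k f| <= E k f.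
  rewrite Ei; apply: le_trans (prod_dist _ _) _ => [i ir|i ir|]; [exact: phi01..|].
  rewrite /E big_seq [leRHS]big_seq; apply: ler_sum => i ir.
  apply: le_trans (phiK _ _ _ ir) _; rewrite -!mulrA ler_wpM2l//; first by case: (HK i).
  rewrite uZ// -mulrBr normrM ger0_norm ?expR_ge0// ler_wpM2l ?expR_ge0//.
  have := graph_peak_ge n1 (Z i) (time_slice s t f) (ler0n R k).
  have := graph_peak_ge nN1 (Z i) (time_slice s t f) (ler0n R k).
  rewrite mul1r mulN1r -/(peak _ _ _ _) -/(peak _ _ _ _) => h1 h2.
  by rewrite distrC ger0_norm ?subr_ge0//; lra.
have E0 : ev PL (E k \o L) @[k --> \oo] --> 0.
  rewrite -[X in _ --> X](ev_cst PL (0 : R)).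
  apply: (ev_dominated_cvg (M := \sum_(i <- r) K i * expR (norm2 (Z i)) * 2)).
  - by move=> k; have [] := tE k.
  - move=> k w; apply: le_trans (ler_norm_sum _ _ _) _; apply: ler_sum => i _.
    rewrite normrM [X in X * _]ger0_norm; last by rewrite mulr_ge0 ?expR_ge0//; case: (HK i).
    rewrite ler_wpM2l ?mulr_ge0 ?expR_ge0//; first by case: (HK i).
    apply: le_trans (ler_normD _ _) _.
    have := graph_peak_bound n1 (Z i) (time_slice s t (L w)) (ler0n R k).
    have := graph_peak_bound nN1 (Z i) (time_slice s t (L w)) (ler0n R k).
    rewrite /peak; lra.
  - apply: aeW => w; suff : (\sum_(i <- r) K i * expR (norm2 (Z i)) *
        (peak 1 k i (L w) + peak (-1) k i (L w))) @[k --> \oo] --> (0 : R) by [].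
    elim: r {ri Ei uZ H E phi01 phiK tE tH close} => [|i r' IH].
      by under eq_fun do rewrite big_nil; exact: cvg_cst.
    have cL : {for Z i, continuous (time_slice s t (L w))}.
      have [_ /(_ w (((Z i).1, s), ((Z i).2, t))) h _ _ _] := L_landscape.
      have [cw _] := h st; apply: (@continuous_comp _ _ _ (fun z : R * R => ((z.1, s), (z.2, t))) (L w)) cw.
      apply/cvg_ballP => e e0; apply: filterS (nbhsx_ballx (Z i) e e0) => y [h1 h2].
      by split; split => //; exact: ballxx.
    have := cvgD (cvgMl_tmp (a := K i * expR (norm2 (Z i)))
      (cvgD (graph_peak_cvg n1 cL) (graph_peak_cvg nN1 cL))) IH.
    rewrite mul1r mulN1r subrr mulr0 addr0 => h.
    suff -> : (fun k => \sum_(j <- i :: r') K j * expR (norm2 (Z j)) *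
        (peak 1 k j (L w) + peak (-1) k j (L w))) =
      (fun k => K i * expR (norm2 (Z i)) * (peak 1 k i (L w) + peak (-1) k i (L w)) +
        \sum_(j <- r') K j * expR (norm2 (Z j)) * (peak 1 k j (L w) + peak (-1) k j (L w))).
      exact: h.
    by apply/funext => k; rewrite big_cons.
  - exact: measurable_cst.
(* The one-point convergence includes the measurability of every contracted value, and the product
   inherits it. *)
have [mp mpL] : (forall n, bdd_meas (product l \o @d n)) /\ bdd_meas (product l \o L).
  have B i d' (T : measurableType d') (x : T -> R4 -> \bar R) : i \in r ->
      bdd_meas (fun w => c (x w (u i))) -> bdd_meas (fun w => phi i (c (x w (u i)))).
    move=> ir [mc _]; split; last first.
      by exists 1 => w; have /andP[h1 h2] := phi01 i (c (x w (u i))) ir; rewrite ger0_norm.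
    apply: measurableT_comp mc; apply: continuous_measurable_fun => y.
    apply/cvgrPdist_lt => e e0; have [K0 _] := HK i.
    have : nbhs y (ball y (e / (K i + 1))) by apply: nbhsx_ballx; rewrite divr_gt0//; lra.
    apply: filterS => y'; rewrite -ball_normE /ball_/= ltr_pdivlMr; last by lra.
    move=> h; apply: le_lt_trans h; apply: le_trans (phiK _ _ _ ir) _.
    by have := normr_ge0 (y - y'); rewrite mulrC ler_wpM2l//; lra.
  have T i : i \in r -> conv_test P PL d L (fun f => c (f (u i))).
    move=> /ri il; apply: mobile_point; last by exists 1 => x; exact: contract_le1.
      have [h1 h2] : (u i).1.2 = s /\ (u i).2.2 = t by apply: HD; apply: lD; rewrite mem_nth// size_map.
      by rewrite /R4up/= h1 h2.
    exact: continuous_contract.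
  have Eo d' (T' : measurableType d') (x : T' -> R4 -> \bar R) :
      product l \o x = fun w => \prod_(i <- r) phi i (c (x w (u i))).
    by apply/funext => w /=; exact: Ei.
  by split => [n|]; rewrite Eo; apply: bdd_meas_prod => i ir; apply: B => //;
    have [] := conv_test_bdd (T i ir).
apply: conv_test_approx.
- exists 1 => f; rewrite Ei ger0_norm big_seq ?prodr_ge0 ?prodr_ile1// => i ir; last by have /andP[] := phi01 i (c (f (u i))) ir.
  exact: phi01.
- by move=> n; case: (mp n).
- by case: mpL.
- move=> e e0; have /cvgr_lt /(_ e e0) [k _ /(_ k (leqnn k)) /= Ek] := E0.
  exists (H k), (E k); split => //.
  have [_ bE] := conv_test_bdd (tE k); have [_ bH] := conv_test_bdd (tH k).
  by apply: le_lt_trans (ev_dist_le PL mpL bH bE _) Ek => w; exact: close.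
Qed.

End slices.
End mobile.
End limits_in_law.

Section landscape_bounds.
Context {R : realType} (dL : measure_display) (OmegaL : measurableType dL)
  (PL : probability OmegaL R) (L : OmegaL -> (R * R) * (R * R) -> \bar R).
Hypothesis HL : directed_landscape PL L.

Lemma measurable_contract d (T : measurableType d) (x : T -> \bar R) :
  measurable_fun setT x -> measurable_fun setT (fun w => contract (x w)).
Proof.
move=> mx; apply: (measurability (@RGenCInfty.G R)) => [|_ [_ [r ->] <-]].
  exact: RGenCInfty.measurableE.
have [r1|r1] := leP r (-1).
  rewrite (_ : _ @^-1` _ = setT) ?setIT//; apply/seteqP; split => w _ //=.
  by rewrite in_itv/= andbT (le_trans r1)// contract_ge_N1.
have [r2|r2] := leP r 1; last first.
  rewrite (_ : _ @^-1` _ = set0) ?setI0//; apply/seteqP; split => w //=.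
  by rewrite in_itv/= andbT leNgt (le_lt_trans (contract_le_1 _) r2).
have rE : contract (expand r) = r by rewrite expandK// inE/= ler_norml ltW.
rewrite (_ : _ @^-1` _ = [set w | (expand r <= x w)%E]).
  exact: emeasurable_fun_c_infty.
by apply/seteqP; split => w /=; rewrite in_itv/= andbT -[in r <= _]rE le_contract.
Qed.

Lemma bdd_meas_ramp d (T : measurableType d) (x : T -> \bar R) (a b : R) : a < b ->
  measurable_fun setT x -> bdd_meas (fun w => ramp a b (x w)).
Proof.
move=> ab mx; split; last first.
  by exists 1 => w; have /andP[h1 h2] := ramp_bounds a b (x w); rewrite ger0_norm.
have mc : measurable_fun setT (clamp 0 1 : R -> R).
  apply: continuous_measurable_fun => y; apply/cvgrPdist_lt => e e0.
  apply: filterS (nbhsx_ballx y e e0) => y'; rewrite -ball_normE /ball_/=.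
  exact/le_lt_trans/clamp_lip.
apply: (measurableT_comp (f := clamp 0 1)
  (g := fun w => (contract (x w) - contract a%:E) / (contract b%:E - contract a%:E))) => //.
apply: measurable_funM; last exact: measurable_cst.
by apply: measurable_funB; [exact: measurable_contract|exact: measurable_cst].
Qed.

(** With [v] the displacement in units of the scale, [L] is within [r M] of [- r v^2] outside an
    event of probability at most [e]. Ramps put this into a form that mobile convergence carries
    over to [d_n]. *)
Lemma landscape_ramp (e : R) : 0 < e -> exists2 M : R, 0 < M &
  forall x s y t r v a b : R, s < t -> r = (t - s) `^ 3^-1 -> v = (y - x) / r ^+ 2 -> a < b ->
  (b <= - (r * (M + v ^+ 2)) -> 1 - e <= ev PL (fun w => ramp a b (L w ((x, s), (y, t))))) /\
  (r * (M - v ^+ 2) <= a -> ev PL (fun w => ramp a b (L w ((x, s), (y, t)))) <= e).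
Proof.
move=> e0; have [M M0 HM] := landscape_tails HL e0; exists M => // x s y t r v a b st Er Ev ab.
have r0 : 0 < r by rewrite Er powR_gt0// subr_gt0.
set u := ((x, s), (y, t)).
have [mL fL _ _ _] := HL.
set B := [set w | M < `|fine (L w u) / r + ((y - x) / r ^+ 2) ^+ 2|].
have mf : measurable_fun setT (fun w => `|fine (L w u) / r + ((y - x) / r ^+ 2) ^+ 2|).
  apply: measurableT_comp => //; apply: measurable_funD => //.
  by apply: measurable_funM => //; apply: measurableT_comp => //; exact: mL.
have mB : measurable B.
  rewrite (_ : B = (fun w => `|fine (L w u) / r + ((y - x) / r ^+ 2) ^+ 2|) @^-1` `]M, +oo[).
    by rewrite -[_ @^-1` _]setTI; exact: mf.
  by apply/seteqP; split => w; rewrite /= in_itv/= ?andbT.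
have bB : bdd_meas (\1_B : OmegaL -> R) by exact: bdd_meas_indic.
have bR : bdd_meas (fun w => ramp a b (L w u)) by apply: bdd_meas_ramp => //; exact: mL.
have PB : ev PL (\1_B) <= e by rewrite ev_indic//; exact: HM.
have good w : ~ B w -> `|fine (L w u) + r * v ^+ 2| <= r * M.
  rewrite /B /= -Ev => /negP; rewrite -leNgt => h.
  rewrite (_ : fine _ + _ = r * (fine (L w u) / r + v ^+ 2)); last by field; rewrite gt_eqF.
  by rewrite normrM gtr0_norm// ler_wpM2l// ltW.
have Lfin w : L w u = (fine (L w u))%:E by rewrite fineK//; have [] := fL w u st.
split => h.
- suff : 1 - ev PL (\1_B) <= ev PL (fun w => ramp a b (L w u)) by lra.
  rewrite -[X in X - _](ev_cst PL) -evB//; last exact: bdd_meas_cst.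
  apply: ev_le => // [|w]; first by apply: bdd_measB => //; exact: bdd_meas_cst.
  have /andP[r1 r2] := ramp_bounds a b (L w u); rewrite indicE.
  have [_|/negP/negP nB] := boolP (w \in B); first by rewrite subrr.
  rewrite subr0 ramp1// Lfin lee_fin; apply: le_trans h _.
  have := good w (contra_not (@mem_set _ B w) (elimN idP nB)).
  by rewrite ler_norml => /andP[]; lra.
- apply: le_trans PB; apply: ev_le => // w.
  have /andP[r1 r2] := ramp_bounds a b (L w u); rewrite indicE.
  have [_//|/negP/negP nB] := boolP (w \in B).
  rewrite ramp0// Lfin lee_fin; apply: le_trans h.
  have := good w (contra_not (@mem_set _ B w) (elimN idP nB)).
  by rewrite ler_norml => /andP[]; lra.
Qed.

End landscape_bounds.

(** * The rescaled metric and its vertical speed *)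

Section rescaled.
Context {R : realType}.
Local Notation R2 := (R * R)%type.
Variables (m a b c : R) (h : int * int -> R).
Hypothesis m0 : 0 < m.
Local Notation pt := (lattice_point a b c).
Local Notation site := (int * int)%type.
Implicit Types (X : site -> R) (p q r : R2).

Let affine_add (A B : \bar R) (x y : R) :
  (m%:E * (A + B) + (x + y)%:E = (m%:E * A + x%:E) + (m%:E * B + y%:E))%E.
Proof.
have y1 : (m%:E * +oo = +oo)%E by rewrite gt0_muley ?lte_fin.
have yN : (m%:E * -oo = -oo)%E by rewrite gt0_muleNy ?lte_fin.
case: A B => [A| |] [B| |].
- by rewrite -EFinD -!EFinM -!EFinD; congr _%:E; ring.
all: by rewrite ?(addeNy, addNye) ?addey ?addye ?y1 ?yN ?(addeNy, addNye) ?addey ?addye.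
Qed.

Let affine_le (A B : \bar R) (x : R) : (A <= B)%E -> (m%:E * A + x%:E <= m%:E * B + x%:E)%E.
Proof. by move=> AB; rewrite leeD2r// lee_pmul2l. Qed.

Lemma rescaled_triangle X p q r :
  (rescaled_lpp X m a b c h (p, q) + rescaled_lpp X m a b c h (q, r) <=
   rescaled_lpp X m a b c h (p, r))%E.
Proof.
rewrite /rescaled_lpp -affine_add/= addrA subrK.
exact/affine_le/lattice_lpp_triangle.
Qed.

Lemma rescaled_row X p q r : (pt q).2 = (pt p).2 -> (pt r).2 = (pt p).2 ->
  (pt p).1 <= (pt q).1 <= (pt r).1 ->
  (rescaled_lpp X m a b c h (p, r) <=
   rescaled_lpp X m a b c h (p, q) + rescaled_lpp X m a b c h (q, r))%E.
Proof.
move=> h1 h2 h3; rewrite /rescaled_lpp -affine_add/= addrA subrK.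
exact/affine_le/lattice_lpp_row.
Qed.

Lemma rescaled_eqNy X p q : ~~ (((pt p).1 <= (pt q).1) && ((pt q).2 <= (pt p).2)) ->
  rescaled_lpp X m a b c h (p, q) = -oo%E.
Proof.
by move=> /(lattice_lpp_eqNy X) E; rewrite /rescaled_lpp E mulr_infty gtr0_sg// mul1e.
Qed.

Lemma rescaled_sites d (T : measurableType d) (X : T -> site -> R) p q (S : set site) :
  (forall z, before (pt p) z -> (z == pt q) || before z (pt q) -> S z) ->
  forall B : set (\bar R), measurable B ->
    <<s coordinates X S >> [set w | B (rescaled_lpp (X w) m a b c h (p, q))].
Proof.
move=> HS B mB.
pose f (x : \bar R) : \bar R := (m%:E * x + (h (pt p) - h (pt q))%:E)%E.
have mf : measurable_fun setT f.
  apply: emeasurable_funD; last exact: measurable_cst.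
  exact: measurable_funeM.
have := lattice_lpp_sites (X := X) HS (mf measurableT B mB).
by congr (<<s _ >> _); apply/seteqP; split => w => [[_]//|hw].
Qed.

Lemma measurable_rescaled d (T : measurableType d) (X : T -> site -> R) u :
  random_function X -> measurable_fun setT (fun w => rescaled_lpp (X w) m a b c h u).
Proof.
move=> mX; apply: emeasurable_funD; last exact: measurable_cst.
by apply: measurable_funeM; apply: measurable_lattice_lpp => z _ _; exact: mX.
Qed.

Lemma rescaled_lattice X u v : pt u.1 = pt v.1 -> pt u.2 = pt v.2 ->
  rescaled_lpp X m a b c h u = rescaled_lpp X m a b c h v.
Proof. by rewrite /rescaled_lpp => -> ->. Qed.

End rescaled.

Section speed.
Context {R : realType} (dO : nat -> measure_display) (Omega : forall n, measurableType (dO n))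
  (P : forall n, probability (Omega n) R) (X : forall n, Omega n -> int * int -> R)
  (m a b c : nat -> R) (h : nat -> int * int -> R)
  (dL : measure_display) (OmegaL : measurableType dL) (PL : probability OmegaL R)
  (L : OmegaL -> (R * R) * (R * R) -> \bar R).
Hypothesis m_gt0 : forall n, 0 < m n.
Hypothesis HL : directed_landscape PL L.
Local Notation R4 := ((R * R) * (R * R))%type.
Local Notation d := (fun n (w : Omega n) => rescaled_lpp (X w) (m n) (a n) (b n) (c n) (h n)).
Local Notation pt n := (lattice_point (a n) (b n) (c n)).
Hypothesis mobile : forall (u_ : nat -> R4) (u : R4),
  R4up u -> u_ n @[n --> \oo] --> u ->
  cvg_in_distribution [set F : \bar R -> R | continuous F]
    P (fun n w => d n w (u_ n)) PL (fun w => L w u).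

Let ramp_conv u (x y : R) : R4up u -> x < y -> conv_test P PL d L (fun f => ramp x y (f u)).
Proof.
move=> uu xy; apply: (mobile_point mobile) => //; first exact: ramp_continuous.
by exists 1 => z; have /andP[h1 h2] := ramp_bounds x y z; rewrite ger0_norm.
Qed.

(** Whether a path exists is not random: without one, [d_n] is -oo at [u] surely and the mean of the
    ramp is 0, while under the landscape it is at least 1/2. *)
Lemma eventually_connected (u : R4) : R4up u -> \forall n \near \oo,
  (pt n u.1).1 <= (pt n u.2).1 /\ (pt n u.2).2 <= (pt n u.1).2.
Proof.
case: u => [[x s] [y t]] uu; have st : s < t by [].
have e0 : 0 < (1 / 2 : R) by rewrite divr_gt0.
have [M M0 HM] := landscape_ramp HL e0.
pose r := (t - s) `^ 3^-1; pose v := (y - x) / r ^+ 2; pose B := - (r * (M + v ^+ 2)).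
have B1 : B - 1 < B by lra.
have [/(_ (lexx _)) h1 _] := HM x s y t r v (B - 1) B st erefl erefl B1.
have [_ _ _ cv] := ramp_conv uu B1.
have l : 1 / 4 < ev PL ((fun f => ramp (B - 1) B (f ((x, s), (y, t)))) \o L).
  by apply: lt_le_trans h1; lra.
move/cvgr_gt : cv => /(_ _ l); apply: filterS => n /= h2.
apply/andP; apply: contraPT isT => nc _; move: h2; apply/negP; rewrite -leNgt.
rewrite (_ : _ \o _ = fun=> 0) ?[ev _ _]ev_cst; first by lra.
by apply/funext => w /=; rewrite (rescaled_eqNy (p := (x, s)) (q := (y, t)) (h n) (m_gt0 n) (X w) nc) ramp0 ?leNye.
Qed.

(* Otherwise the rows of the times in ]0, delta] coincide along a subsequence, and then
   d (p, r) = d (p, q) + d (q, r) for collinear lattice points; but the parabola makes the right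
   side tend to -oo as q moves away. *)
Lemma speed_diverges (delta : R) : 0 < delta -> \forall n \near \oo, 1 <= c n * delta.
Proof.
move=> d0; have e0 : 0 < (1 / 4 : R) by rewrite divr_gt0.
have [M M0 HM] := landscape_ramp HL e0.
pose r1 := (3 * delta / 4 - delta / 4) `^ 3^-1.
pose r2 := (delta / 2 - delta / 4) `^ 3^-1; pose r3 := (3 * delta / 4 - delta / 2) `^ 3^-1.
have r10 : 0 < r1 by apply: powR_gt0; lra.
have r20 : 0 < r2 by apply: powR_gt0; lra.
have r32 : r3 = r2 by rewrite /r3 /r2; congr (_ `^ _); lra.
(* [q] is displaced so far that each of the two legs is at most [- K - 1], while the straight
   connection from [p] to [r] is at least [- 2 K + 1], each with probability at least 3/4. *)
pose K := 1 + r1 * M; pose z := M + (K + 1) / r2 + 1; pose y := z * r2 ^+ 2.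
have K1 : 1 <= K by rewrite lerDl mulr_ge0// ltW.
have z1 : 1 <= z.
  have : 0 <= (K + 1) / r2 by rewrite divr_ge0 ?ltW//; lra.
  rewrite /z; lra.
have rz : r2 * (M - z ^+ 2) <= - K - 1.
  have h1 : z <= z ^+ 2 by rewrite expr2 ler_peMl//; lra.
  have h2 : r2 * (M - z ^+ 2) <= r2 * (- ((K + 1) / r2)).
    by rewrite ler_wpM2l ?ltW//; move: h1; rewrite /z; lra.
  by move: h2; rewrite mulrN mulrCA divff ?gt_eqF// mulr1; lra.
pose p : R * R := (0, delta / 4); pose q : R * R := (y, delta / 2).
pose r : R * R := (0, 3 * delta / 4).
have pq : R4up (p, q) by rewrite /R4up/=; lra.
have qr : R4up (q, r) by rewrite /R4up/=; lra.
have pr : R4up (p, r) by rewrite /R4up/=; lra.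
have ab1 : - K - 1 < - K by lra.
have ab2 : - (2 * K) < - (2 * K) + 1 by lra.
have Epq : ev PL (fun w => ramp (- K - 1) (- K) (L w (p, q))) <= 1 / 4.
  have vE : z = (y - 0) / r2 ^+ 2 by rewrite /y subr0 mulfK// gt_eqF// exprn_gt0.
  exact: (HM 0 (delta / 4) y (delta / 2) r2 z _ _ pq erefl vE ab1).2.
have Eqr : ev PL (fun w => ramp (- K - 1) (- K) (L w (q, r))) <= 1 / 4.
  have vE : - z = (0 - y) / r3 ^+ 2 by rewrite r32 /y sub0r mulNr mulfK// gt_eqF// exprn_gt0.
  by apply: (HM y (delta / 2) 0 (3 * delta / 4) r3 (- z) _ _ qr erefl vE ab1).2; rewrite r32 sqrrN.
have Epr : 1 - 1 / 4 <= ev PL (fun w => ramp (- (2 * K)) (- (2 * K) + 1) (L w (p, r))).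
  have vE : 0 = (0 - 0) / r1 ^+ 2 by rewrite subr0 mul0r.
  apply: (HM 0 (delta / 4) 0 (3 * delta / 4) r1 0 _ _ pr erefl vE ab2).1.
  by rewrite expr0n /= addr0; move: K1; rewrite /K; lra.
(* Its mean under the landscape is at most [1/4 + 1/4 - 3/4], whereas additivity within a common row
   would make it nonnegative surely. *)
pose G (f : R4 -> \bar R) := ramp (- K - 1) (- K) (f (p, q)) + ramp (- K - 1) (- K) (f (q, r)) -
  ramp (- (2 * K)) (- (2 * K) + 1) (f (p, r)).
have tG : conv_test P PL d L G.
  by apply: conv_testB; [apply: conv_testD|]; exact: ramp_conv.
have GL : ev PL (G \o L) < 0.
  have mL u : measurable_fun setT (fun w => L w u) by have [h1 _ _ _ _] := HL; exact: h1.
  rewrite [ev _ _]evB ?evD; try (apply: bdd_measD); try exact: bdd_meas_ramp.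
  by lra.
have [_ _ _ /cvgr_lt /(_ _ GL) eG] := tG.
have o0 : R4up ((0, 0), (0, delta) : R * R) by [].
near=> n.
have [k1 k1'] : (pt n p).1 <= (pt n q).1 /\ (pt n q).2 <= (pt n p).2.
  by near: n; exact: (eventually_connected pq).
have [k2 k2'] : (pt n q).1 <= (pt n r).1 /\ (pt n r).2 <= (pt n q).2.
  by near: n; exact: (eventually_connected qr).
have [_ k3] : (pt n (0, 0)).1 <= (pt n (0, delta)).1 /\ (pt n (0, delta)).2 <= (pt n (0, 0)).2.
  by near: n; exact: (eventually_connected o0).
have nG : ev (P n) (G \o d n) < 0 by near: n.
rewrite leNgt; apply/negP => cd.
(* A path from time 0 to time [delta] exists, so the row of [delta] is not above row 0. *)
have cd2 : -1 < c n * delta.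
  move: k3; rewrite /= mulr0 oppr0 floor0 -ltzD1 add0r => k3.
  have := floorD1_gt (- (c n * delta)); set f := Num.floor _ in k3 *.
  have : f <= 0 by rewrite -ltzD1 add0r.
  rewrite -(ler_int R) intrD mulr1z; lra.
(* Since [|c n * delta| < 1], the positive times up to [3 delta / 4] share one row. Time 0 is
   avoided: it always lies in row 0. *)
have row k : 0 < k <= 3 / 4 -> Num.floor (- (c n * (k * delta))) = if 0 < c n then -1 else 0.
  move=> /andP[h1 h2]; apply: floor_def; rewrite mulrCA.
  have [c0|c0] := ltP 0 (c n).
    by have := mulr_gt0 c0 d0 => h3; rewrite intrD/=; apply/andP; split; nra.
  have := mulr_le0_ge0 c0 (ltW d0) => h3; rewrite intrD/=; apply/andP; split; nra.
have rowp : (pt n p).2 = if 0 < c n then -1 else 0.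
  by rewrite /= (_ : delta / 4 = 1 / 4 * delta) ?row//; lra.
have rowq : (pt n q).2 = if 0 < c n then -1 else 0.
  by rewrite /= (_ : delta / 2 = 1 / 2 * delta) ?row//; lra.
have rowr : (pt n r).2 = if 0 < c n then -1 else 0.
  by rewrite /= (_ : 3 * delta / 4 = 3 / 4 * delta) ?row//; lra.
have [bG _] := conv_test_bdd tG.
move: nG; apply/negP; rewrite -leNgt -(ev_cst (P n) 0); apply: ev_le => // [|w].
  exact: bdd_meas_cst.
have := rescaled_row (h n) (m_gt0 n) (X w) (etrans rowq (esym rowp))
  (etrans rowr (esym rowp)) (introT andP (conj k1 k2)).
rewrite /G /comp; set A := rescaled_lpp _ _ _ _ _ _ (p, r).
set B := rescaled_lpp _ _ _ _ _ _ (p, q); set C := rescaled_lpp _ _ _ _ _ _ (q, r) => ABC.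
have /andP[b1 b2] := ramp_bounds (- K - 1) (- K) B.
have /andP[b3 b4] := ramp_bounds (- K - 1) (- K) C.
have /andP[b5 b6] := ramp_bounds (- (2 * K)) (- (2 * K) + 1) A.
have [lA|lA] := leP A (- (2 * K))%:E; first by rewrite (ramp0 ab2 lA); lra.
have [lB|lB] := leP (- K)%:E B; first by rewrite (ramp1 ab1 lB); lra.
have [lC|lC] := leP (- K)%:E C; first by rewrite (ramp1 ab1 lC); lra.
have : (A < A)%E; last by rewrite ltxx.
apply: le_lt_trans ABC _; apply: lt_trans lA.
by rewrite (_ : - (2 * K) = - K + - K) ?EFinD ?lteD//; lra.
Unshelve. all: by end_near. Qed.

End speed.

Section functionals.
Context {R : realType} {U : eqType}.
Implicit Types (H : (U -> \bar R) -> R) (f g : U -> \bar R) (D : seq U).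
Local Notation c := (@contract R).

Lemma lip_measurable (phi : R -> R) (K : R) : 0 <= K ->
  (forall x y, `|phi x - phi y| <= K * `|x - y|) -> measurable_fun setT phi.
Proof.
move=> K0 h; apply: continuous_measurable_fun => y; apply/cvgrPdist_lt => e e0.
have K1 : 0 < K + 1 by lra.
have : nbhs y (ball y (e / (K + 1))) by apply: nbhsx_ballx; rewrite divr_gt0.
apply: filterS => y'; rewrite -ball_normE /ball_/= ltr_pdivlMr// => h'.
apply: le_lt_trans h'; apply: le_trans (h _ _) _.
by have := normr_ge0 (y - y'); nra.
Qed.

Lemma contract_lip_ext D H f g : contract_lip D H -> (forall u, u \in D -> f u = g u) -> H f = H g.
Proof.
move=> [C C0 HC] fg; apply/eqP; rewrite -subr_eq0 -normr_le0 -(mulr0 C).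
by apply: HC => // u uD; rewrite fg// subrr normr0.
Qed.

Lemma contract_lip_cst D (k : R) : contract_lip D (fun=> k).
Proof. by exists 0 => // f g e _ _; rewrite subrr normr0 mul0r. Qed.

Lemma contract_lip_mul D H H' : contract_lip D H -> contract_lip D H' ->
  (forall f, 0 <= H f <= 1) -> (forall f, 0 <= H' f <= 1) -> contract_lip D (fun f => H f * H' f).
Proof.
move=> [C C0 HC] [C' C'0 HC'] H1 H2; exists (C + C') => [|f g e e0 fg]; first exact: addr_ge0.
have := HC f g e e0 fg; have := HC' f g e e0 fg.
have /andP[h1 h2] := H1 g; have /andP[h3 h4] := H2 f => k1 k2.
rewrite (_ : _ - _ = H' f * (H f - H g) + H g * (H' f - H' g)); last by ring.
apply: le_trans (ler_normD _ _) _; rewrite mulrDl !normrM (ger0_norm h1) (ger0_norm h3).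
by apply: lerD; [apply: le_trans k2|apply: le_trans k1]; exact: ler_piMl.
Qed.

Lemma contract_lip_measurable d (T : measurableType d) (x : T -> U -> \bar R) D H :
  contract_lip D H -> (forall u, u \in D -> measurable_fun setT (fun w => c (x w u))) ->
  measurable_fun setT (H \o x).
Proof.
move=> lH mx; move: H lH.
apply: (@contract_lip_test _ _ D (fun H => measurable_fun setT (H \o x))).
- elim=> [|[u phi] s IH] Hs Hn.
    rewrite (_ : _ \o _ = fun=> 1); first exact: measurable_cst.
    by apply/funext => w; rewrite /= /product big_nil.
  rewrite (_ : _ \o _ = fun w => phi (c (x w u)) * (product s \o x) w); last first.
    by apply/funext => w; rewrite /= /product big_cons.
  apply: measurable_funM; last first.
    by apply: IH => [p ps|i il]; [apply: Hs; rewrite inE ps orbT|exact: (Hn i.+1)].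
  have [_ [K K0 HK]] := Hn 0%N isT.
  apply: (measurableT_comp (lip_measurable K0 HK)).
  by apply: mx; apply: Hs; exact: mem_head.
- by move=> H H' mH mH'; exact: measurable_funD.
- by move=> k H mH; apply: measurable_funM => //; exact: measurable_cst.
- by move=> H h; exact: measurable_unif.
Qed.

(** The key is the index of a time strip: each [G k] collects the factors of one strip, so that
    independence of strips applies to the [G k]. *)
Lemma product_by_key (key : U -> nat) (K : nat) D s : (forall u, u \in D -> (key u < K)%N) ->
  (forall p, p \in unzip1 s -> p \in D) -> (forall i, (i < size s)%N -> nice (nth id (unzip2 s) i)) ->
  exists G : nat -> (U -> \bar R) -> R,
    [/\ forall f, product s f = \prod_(k <- iota 0 K) G k f,
        forall k, contract_lip [seq u <- D | key u == k] (G k) & forall k f, 0 <= G k f <= 1].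
Proof.
move=> kD; elim: s => [|[u phi] s IH] Hs Hn.
  exists (fun _ _ => 1); split => [f|k|k f]; last by rewrite ler01 lexx.
    by rewrite /product big_nil big1.
  exact: contract_lip_cst.
have [p ps|i il|G [G1 G2 G3]] := IH _ _; first by apply: Hs; rewrite inE ps orbT.
  exact: (Hn i.+1).
have uD : u \in D by apply: Hs; exact: mem_head.
have [phi01 [C C0 HC]] := Hn 0%N isT.
exists (fun k f => if k == key u then phi (c (f u)) * G k f else G k f); split => [f|k|k f].
- rewrite /product big_cons -/(product s f) G1 [RHS](bigD1_seq (key u)) ?iota_uniq//=; last first.
    by rewrite mem_iota add0n kD.
  rewrite eqxx (bigD1_seq (key u)) ?iota_uniq ?mem_iota ?add0n ?kD//= mulrA; congr (_ * _).
  by apply: eq_bigr => k /negbTE ->.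
- have [kE|] := eqVneq k (key u); last by move=> _; exact: G2.
  apply: contract_lip_mul => //; apply: (contract_lip_at (F := fun x => phi (c x))).
    by rewrite mem_filter kE eqxx.
  by exists C.
- case: ifP => _; last exact: G3.
  by have /andP[h1 h2] := G3 k f; have /andP[h3 h4] := phi01 (c (f u)); rewrite mulr_ge0//= mulr_ile1.
Qed.

End functionals.

(** * Comparison with almost minorants *)

Section minorants.
Context {R : realType} (dO : nat -> measure_display) (Omega : forall n, measurableType (dO n))
  (P : forall n, probability (Omega n) R)
  (dL : measure_display) (OmegaL : measurableType dL) (PL : probability OmegaL R) (U : eqType).
Variables (d : forall n, Omega n -> U -> \bar R) (L : OmegaL -> U -> \bar R).
Local Notation c := (@contract R).

(* If [Y f] is almost a minorant of [f] and the laws of [c (Y f u)] and [c (f u)] are close, then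
   [f u] and [Y f u] are close in mean, as |A - B| = A - B + 2 (B - A)^+. *)
Lemma conv_on_minorant (D : seq U) :
  (forall u, u \in D -> conv_test P PL d L (fun f => c (f u))) ->
  (forall e : R, 0 < e -> exists (Y : (U -> \bar R) -> U -> \bar R) (E : U -> (U -> \bar R) -> R),
     [/\ forall H, contract_lip D H -> conv_test P PL d L (fun f => H (Y f)),
         forall u, u \in D -> conv_test P PL d L (E u) /\ ev PL (E u \o L) <= e,
         forall u n (w : Omega n), u \in D ->
           c (Y (d w) u) <= c (d w u) + E u (d w) /\ 0 <= E u (d w) &
         forall u, u \in D -> ev PL (fun w => `|c (L w u) - c (Y (L w) u)|) <= e]) ->
  conv_on P PL d L D.
Proof.
move=> mD A H lH; have [C C0 HC] := lH.
have mL : measurable_fun setT (H \o L).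
  by apply: (contract_lip_measurable lH) => u uD; have [] := mD u uD.
have mn n : measurable_fun setT (H \o @d n).
  by apply: (contract_lip_measurable lH) => u uD; have [] := mD u uD.
have [M HM] := contract_lip_bounded lH.
apply: conv_test_approx => //; first by exists M.
(* Each point of [D] contributes at most [3 q]: [q] for the mean distance of [L] and [Y L], and
   [2 q] for the term [2 E]. *)
move=> e e0; pose q := e / (3 * (C + 1) * ((size D)%:R + 1)).
have q0 : 0 < q.
  by rewrite divr_gt0// !mulr_gt0//; have := ler0n R (size D); lra.
have [Y [E [tH tE dE LE]]] := A q q0.
pose K f := C * \sum_(u <- D) (c (f u) - c (Y f u) + 2 * E u f).
have tY u : u \in D -> conv_test P PL d L (fun f => c (Y f u)).
  by move=> uD; apply: (tH (fun f => c (f u))); exact: contract_lip_contract.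
have tK : conv_test P PL d L K.
  apply: conv_testZ; apply: conv_test_sum => u uD; apply: conv_testD.
    by apply: conv_testB; [exact: mD|exact: tY].
  by apply: conv_testZ; have [] := tE u uD.
have Hdist f : `|H f - H (Y f)| <= C * \sum_(u <- D) `|c (f u) - c (Y f u)|.
  apply: HC => [|u uD]; first by apply: sumr_ge0.
  by rewrite (big_rem u)//= lerDl sumr_ge0.
have small (F : U -> OmegaL -> R) : (forall u, u \in D -> bdd_meas (F u)) ->
    (forall u, u \in D -> ev PL (F u) <= 3 * q) ->
    ev PL (fun w => C * \sum_(u <- D) F u w) < e.
  move=> bF Fq; rewrite evZ; last exact: bdd_meas_sum.
  rewrite ev_sum//; apply: (@le_lt_trans _ _ (C * ((size D)%:R * (3 * q)))).
    rewrite ler_wpM2l// (@le_trans _ _ (\sum_(u <- D) 3 * q))//.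
      by rewrite big_seq [leRHS]big_seq; exact: ler_sum.
    by rewrite big_const_seq count_predT iter_addr addr0 [leRHS]mulr_natl.
  rewrite /q; set N : R := (size D)%:R; have N0 : 0 <= N by exact: ler0n.
  rewrite (_ : C * _ = e * ((C * N) / ((C + 1) * (N + 1)))); last by field; apply/andP; split; lra.
  rewrite gtr_pMr// ltr_pdivrMr ?mul1r; last by rewrite mulr_gt0//; lra.
  by rewrite mulrDl mulrDr mulr1; have := mulr_ge0 C0 N0; lra.
have bL u : u \in D -> bdd_meas (fun w => c (L w u)).
  by move=> uD; have [_] := conv_test_bdd (mD u uD).
have bYL u : u \in D -> bdd_meas (fun w => c (Y (L w) u)).
  by move=> uD; have [_] := conv_test_bdd (tY u uD).
have bEL u : u \in D -> bdd_meas (E u \o L).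
  by move=> uD; have [_] := conv_test_bdd (tE u uD).1.
exists (fun f => H (Y f)), K; split => //.
- exact: tH.
- apply: small => u uD.
    by apply: bdd_measD; [apply: bdd_measB; [exact: bL|exact: bYL]|apply: bdd_measZ; exact: bEL].
  rewrite evD ?evZ; [|exact: bEL|by apply: bdd_measB; [exact: bL|exact: bYL]|
    by apply: bdd_measZ; exact: bEL].
  have := LE u uD; have [_ h] := tE u uD.
  have : ev PL (fun w => c (L w u) - c (Y (L w) u)) <= ev PL (fun w => `|c (L w u) - c (Y (L w) u)|).
    by apply: ev_le => [||w]; [by apply: bdd_measB; [exact: bL|exact: bYL]|
      by apply: bdd_meas_norm; apply: bdd_measB; [exact: bL|exact: bYL]|exact: ler_norm].
  move: h; rewrite /comp; lra.
- have bHL : bdd_meas (H \o L) by split => //; exists M => w; exact: HM.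
  have [_ bHY] := conv_test_bdd (tH H lH).
  have bN u : u \in D -> bdd_meas (fun w => `|c (L w u) - c (Y (L w) u)|).
    by move=> uD; apply: bdd_meas_norm; apply: bdd_measB; [exact: bL|exact: bYL].
  apply: le_lt_trans (ev_dist_le PL bHL bHY _ (fun w => Hdist (L w))) _.
    by apply: bdd_measZ; exact: bdd_meas_sum.
  by apply: small => // u uD; apply: le_trans (LE u uD) _; lra.
- move=> n w; apply: le_trans (Hdist _) _; rewrite ler_wpM2l// big_seq [leRHS]big_seq.
  apply: ler_sum => u uD; have [h1 h2] := dE u n w uD.
  by rewrite ler_norml; apply/andP; split; lra.
Qed.

End minorants.

Section products.
Context {R : realType} d (T : measurableType d) (P : probability T R).

Lemma ev_prod_sites (V : choiceType) (X : T -> V -> R) (I : eqType) (S : I -> set V)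
    (g : I -> T -> R) (s : seq I) :
  random_function X -> independent P (@measurable _ R) (fun i w => X w i) ->
  uniq s -> (forall i j, i \in s -> j \in s -> i != j -> S i `&` S j = set0) ->
  (forall i w, 0 <= g i w <= 1) ->
  (forall i (B : set R), measurable B -> <<s coordinates X (S i) >> [set w | B (g i w)]) ->
  ev P (fun w => \prod_(i <- s) g i w) = \prod_(i <- s) ev P (g i).
Proof.
move=> mX iX us dS g01 mg.
have mgi i : measurable_fun setT (g i).
  by move=> _ B mB; rewrite setTI; apply: (measurable_coordinates mX); exact: mg.
apply: ev_prod_indep => // c.
have mA i : measurable [set w | c i < g i w].
  apply: (measurable_coordinates mX (S := S i)).
  have := mg i `]c i, +oo[%classic (measurable_itv _); congr (<<s _ >> _).
  by apply/seteqP; split => w /=; rewrite in_itv/= andbT.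
have ind i : (fun w => (c i < g i w)%R%:R : R) = \1_[set w | c i < g i w].
  by apply/funext => w; rewrite indicE; congr (nat_of_bool _)%:R; apply/idP/idP => [h|/set_mem//]; exact: mem_set.
pose A (r : seq I) := [set w | forall i, i \in r -> c i < g i w].
have indA (r : seq I) : (fun w => \prod_(i <- r) (c i < g i w)%R%:R : R) = \1_(A r).
  apply/funext => w; rewrite indicE; elim: r => [|i r IH].
    by rewrite big_nil mem_set.
  rewrite big_cons IH; have [ci|ci] := boolP (c i < g i w).
    rewrite mul1r; congr (nat_of_bool _)%:R; apply/idP/idP => /set_mem h; apply: mem_set => j.
      by rewrite inE => /predU1P[->|/h].
    by move=> jr; apply: h; rewrite inE jr orbT.
  rewrite mul0r memNset// => h; move/negP: ci; apply; exact: h (mem_head _ _).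
have sigA (r : seq I) : {subset r <= s} ->
    <<s coordinates X (\bigcup_(i in [set` r]) S i) >> (A r).
  elim: r => [|i r IH] rs.
    by rewrite (_ : A [::] = setT); [exact: (@measurableT _ (g_sigma_algebraType _))|
      apply/seteqP; split].
  have sub (S1 S2 : set V) B : S1 `<=` S2 -> <<s coordinates X S1 >> B -> <<s coordinates X S2 >> B.
    move=> S12; apply: sub_sigma_algebra2 => _ [j [B' [Sj mB' ->]]].
    by exists j, B'; split => //; exact: S12.
  rewrite (_ : A (i :: r) = [set w | c i < g i w] `&` A r).
    apply: (@measurableI _ (g_sigma_algebraType (coordinates X _))).
      apply: (sub (S i)) => [z Sz|]; first by exists i => //=; exact: mem_head.
      have := mg i `]c i, +oo[%classic (measurable_itv _); congr (<<s _ >> _).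
      by apply/seteqP; split => w /=; rewrite in_itv/= andbT.
    apply: (sub (\bigcup_(j in [set` r]) S j)) => [z [j jr Sz]|].
      by exists j => //=; rewrite inE jr orbT.
    by apply: IH => j jr; apply: rs; rewrite inE jr orbT.
  apply/seteqP; split => [w h|w [h1 h2] j]; last by rewrite inE => /predU1P[->|/h2].
  by split => [|j jr]; apply: h; rewrite inE ?eqxx// jr orbT.
have mAr (r : seq I) : {subset r <= s} -> measurable (A r).
  by move=> rs; exact: measurable_coordinates (sigA r rs).
suff H (r : seq I) : {subset r <= s} -> uniq r ->
    ev P (fun w => \prod_(j <- r) (c j < g j w)%R%:R) =
    \prod_(j <- r) ev P (fun w => (c j < g j w)%R%:R) by exact: H.
elim: r => [|i r IH] rs ur.
  rewrite big_nil -[RHS](ev_cst P); congr (ev P _).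
  by apply/funext => w; rewrite big_nil.
have rs' : {subset r <= s} by move=> j jr; apply: rs; rewrite inE jr orbT.
have si : i \in s by apply: rs; exact: mem_head.
have {}IH : ev P (fun w => \prod_(j <- r) (c j < g j w)%R%:R) =
    \prod_(j <- r) ev P (fun w => (c j < g j w)%R%:R) by apply: IH => //; case/andP: ur.
rewrite big_cons -IH ind !indA !ev_indic//; [|exact: mAr|exact: mAr].
rewrite -fineM ?fin_num_measure//; last exact: mAr.
congr fine; rewrite -(sites_independent mX iX (S := S i) (S' := \bigcup_(j in [set` r]) S j)).
- congr (P _); apply/seteqP; split => [w h|w [h1 h2] j]; last by rewrite inE => /predU1P[->|/h2].
  by split => [|j jr]; apply: h; rewrite inE ?eqxx// jr orbT.
- apply/seteqP; split => // z [Sz [j /= jr Sj]].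
  have ij : i != j by apply: contraTneq jr => <-; case/andP: ur.
  have : (S i `&` S j) z by [].
  by rewrite dS// rs'.
- have := mg i `]c i, +oo[%classic (measurable_itv _); congr (<<s _ >> _).
  by apply/seteqP; split => w /=; rewrite in_itv/= andbT.
- exact: sigA.
Qed.

End products.

Section landscape_independence.
Context {R : realType} (dL : measure_display) (OmegaL : measurableType dL)
  (PL : probability OmegaL R) (L : OmegaL -> (R * R) * (R * R) -> \bar R).
Hypothesis HL : directed_landscape PL L.
Local Notation R4 := ((R * R) * (R * R))%type.

Lemma prod_indic (T : Type) (I : eqType) (s : seq I) (A : I -> set T) w :
  \prod_(i <- s) \1_(A i) w = \1_(\bigcap_(i in [set` s]) A i) w :> R.
Proof.
elim: s => [|i s IH]; first by rewrite big_nil indicE mem_set// => i /=.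
rewrite big_cons IH !indicE; have [/set_mem Ai|/negP nAi] := boolP (w \in A i).
  rewrite mul1r; congr (nat_of_bool _)%:R; apply/idP/idP => /set_mem h; apply: mem_set => j /=.
    by rewrite inE => /predU1P[->|/h].
  by move=> js; apply: h; rewrite /= inE js orbT.
rewrite mul0r memNset// => h; apply: nAi; apply: mem_set; apply: h; exact: mem_head.
Qed.

Lemma ev_prod_landscape (K : nat) (sg tu : nat -> R) (D : nat -> seq R4)
    (G : nat -> (R4 -> \bar R) -> R) :
  (forall k, sg k < tu k) -> (forall k, tu k <= sg k.+1) ->
  (forall k u, u \in D k -> u.1.2 = sg k /\ u.2.2 = tu k) ->
  (forall k, contract_lip (D k) (G k)) -> (forall k f, 0 <= G k f <= 1) ->
  ev PL (fun w => \prod_(k <- iota 0 K) G k (L w)) = \prod_(k <- iota 0 K) ev PL (G k \o L).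
Proof.
move=> st ts HD lG G01.
have [mL _ _ /(_ K (fun i => sg i) (fun i => tu i) (fun i => st i)) ind _] := HL.
have order i j : (i < j)%N -> tu i <= sg j.
  elim: j => [//|j IH]; rewrite ltnS leq_eqVlt => /predU1P[->//|/IH h].
  by apply: le_trans h _; apply: le_trans (ts j); exact: ltW.
have {ind} [|ind _] := ind.
  apply/trivIsetP => i j _ _ ij; rewrite -subset0 => x [] /=; rewrite !in_itv/=.
  move=> /andP[h1 h2] /andP[h3 h4]; move: ij; rewrite -val_eqE neq_ltn => /orP[/order|/order]; lra.
have mG k : measurable_fun setT (G k \o L).
  by apply: (contract_lip_measurable (lG k)) => u _; apply: measurable_contract; exact: mL.
apply: (ev_prod_indep (g := fun k w => G k (L w))) => //; first exact: iota_uniq.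
(* A function on the plane read as a field that forgets the times; through it [G i] becomes a
   functional of the slice. *)
move=> c; pose un (f : R * R -> \bar R) (u : R4) : \bar R := f (u.1.1, u.2.1).
pose A (i : 'I_K) := [set f : R * R -> \bar R | c i < G i (un f)].
pose lev k : set OmegaL := [set w | c k < G k (L w)].
have levE (i : 'I_K) : lev i = (fun w => time_slice (sg i) (tu i) (L w)) @^-1` A i.
  suff E w : G i (L w) = G i (un (time_slice (sg i) (tu i) (L w))).
    by apply/seteqP; split => w; rewrite /lev /A /= E.
  apply: (contract_lip_ext (lG i)) => -[[x s] [y t]] /HD /= [-> ->].
  by [].
have mlev k : measurable (lev k).
  rewrite (_ : lev k = (G k \o L) @^-1` `]c k, +oo[); first by rewrite -[_ @^-1` _]setTI; exact: mG.
  by apply/seteqP; split => w; rewrite /lev/= in_itv/= andbT.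
have mA i : cylindrical (A i).
  pose T := g_sigma_algebraType [set B | exists (z : R * R) (C : set (\bar R)), measurable C /\
    B = [set f : R * R -> \bar R | C (f z)]].
  have mev z : measurable_fun [set: T] (fun f : R * R -> \bar R => f z).
    by move=> _ C mC; rewrite setTI; apply: sub_sigma_algebra; exists z, C.
  have := @contract_lip_measurable _ _ _ T un _ _ (lG i) (fun u _ => measurable_contract (mev _)).
  move=> /(_ measurableT `]c i, +oo[%classic (measurable_itv _)); rewrite setTI.
  by congr (<<s _ >> _); apply/seteqP; split => f; rewrite /A/= in_itv/= andbT.
have levind k : (fun w => (c k < G k (L w))%R%:R : R) = \1_(lev k).
  apply/funext => w; rewrite indicE; congr (nat_of_bool _)%:R.
  by apply/idP/idP => [h|/set_mem//]; exact: mem_set.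
have iE (F : nat -> R) : \prod_(k <- iota 0 K) F k = \prod_(i <- index_enum 'I_K) F i.
  by rewrite (_ : iota 0 K = index_iota 0 K) ?big_mkord// /index_iota subn0.
rewrite [RHS]iE; have -> : (fun w => \prod_(k <- iota 0 K) (c k < G k (L w))%R%:R : R) =
    \1_(\bigcap_(i in [set` index_enum 'I_K]) lev i).
  apply/funext => w; rewrite iE -prod_indic; apply: eq_bigr => i _.
  by rewrite -[RHS](congr1 (@^~ w) (levind i)).
under eq_bigr do rewrite levind ev_indic//.
rewrite ev_indic; last by apply: fin_bigcap_measurable => // i _.
have := ind (index_enum 'I_K) A (index_enum_uniq _) mA.
have -> : \bigcap_(i in [set` index_enum 'I_K]) lev i = \bigcap_(i in [set` index_enum 'I_K]) ((fun w => time_slice (sg i) (tu i) (L w)) @^-1` A i) by apply: eq_bigcapr => i _; exact: levE.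
move=> ->; rewrite (eq_bigr (fun i : 'I_K => (fine (PL (lev i)))%:E)) ?prodEFin// => i _.
by rewrite -levE fineK ?fin_num_measure.
Qed.

End landscape_independence.

Lemma near_seq (T : Type) (F : set_system T) (I : eqType) (s : seq I) (Q : I -> T -> Prop) :
  Filter F -> (forall i, i \in s -> \forall x \near F, Q i x) ->
  \forall x \near F, forall i, i \in s -> Q i x.
Proof.
move=> FF; elim: s => [|i s IH] H; first exact: nearW.
have h1 := H i (mem_head _ _).
have h2 : \forall x \near F, forall j, j \in s -> Q j x.
  by apply: IH => j js; apply: H; rewrite inE js orbT.
near=> x => j; rewrite inE => /predU1P[->|]; [by near: x|].
by move: j; near: x.
Unshelve. all: by end_near. Qed.

(** Finite initial parts of an enumeration of the rationals, so that a maximum over them involves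
    finitely many points. *)
Definition rationals {R : realType} (k : nat) : seq R :=
  [seq ratr q | q <- pmap (@choice.unpickle rat) (iota 0 k)].

Lemma rationals_dense (R : realType) (z e : R) : 0 < e ->
  \forall k \near \oo, exists2 z', z' \in rationals k & `|z - z'| < e.
Proof.
move=> e0; have [q] := @rat_in_itvoo R (z - e) (z + e) ltac:(lra).
rewrite in_itv/= => /andP[q1 q2]; exists (choice.pickle q).+1 => // k /= qk.
exists (ratr q); last by rewrite ltr_norml; apply/andP; split; lra.
rewrite map_f// mem_pmap; apply/mapP; exists (choice.pickle q); last by rewrite choice.pickleK.
by rewrite mem_iota.
Qed.

(** * Finite-dimensional convergence: separated strips, adjacent strips, arbitrary grid times *)

Section finite_dimensional.
Context {R : realType} (dO : nat -> measure_display) (Omega : forall n, measurableType (dO n))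
  (P : forall n, probability (Omega n) R) (X : forall n, Omega n -> int * int -> R)
  (m a b c : nat -> R) (h : nat -> int * int -> R)
  (dL : measure_display) (OmegaL : measurableType dL) (PL : probability OmegaL R)
  (L : OmegaL -> (R * R) * (R * R) -> \bar R).
Hypothesis X_iid : forall n, iid_array (P n) (@X n).
Hypothesis m_gt0 : forall n, 0 < m n.
Hypothesis HL : directed_landscape PL L.
Local Notation R4 := ((R * R) * (R * R))%type.
Local Notation d := (fun n (w : Omega n) => rescaled_lpp (X w) (m n) (a n) (b n) (c n) (h n)).
Local Notation pt n := (lattice_point (a n) (b n) (c n)).
Local Notation C := (@contract R).
Hypothesis mobile : forall (u_ : nat -> R4) (u : R4),
  R4up u -> u_ n @[n --> \oo] --> u ->
  cvg_in_distribution [set F : \bar R -> R | continuous F]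
    P (fun n w => d n w (u_ n)) PL (fun w => L w u).
Hypothesis sheet : forall s t : R, s < t ->
  cvg_in_distribution (@graph_continuous R)
    P (fun n w => time_slice s t (d n w)) PL (fun w => time_slice s t (L w)).

Let mX n : random_function (@X n). Proof. by case: (X_iid n). Qed.

Let mL u : measurable_fun setT (fun w => L w u). Proof. by have [h1 _ _ _ _] := HL; exact: h1. Qed.

Let contract_conv (u : R4) : R4up u -> conv_test P PL d L (fun f => C (f u)).
Proof.
move=> uu; apply: (mobile_point mobile) => //; first exact: continuous_contract.
by exists 1 => z; exact: contract_le1.
Qed.

Let ramp_conv (u : R4) (x y : R) : R4up u -> x < y -> conv_test P PL d L (fun f => ramp x y (f u)).
Proof.
move=> uu xy; apply: (mobile_point mobile) => //; first exact: ramp_continuous.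
by exists 1 => z; have /andP[h1 h2] := ramp_bounds x y z; rewrite ger0_norm.
Qed.

(** Once [c n * delta >= 1], times at distance [delta] lie in different rows. Separated strips then
    use disjoint rows, and the means of products factorise under [P n] as they do under the
    landscape. *)
Lemma blocks_conv (delta : R) (K : nat) (sg tu : nat -> R) (D : seq R4) : 0 < delta ->
  (forall k, sg k < tu k) -> (forall k, tu k + delta <= sg k.+1) ->
  (forall u, u \in D -> exists k, [/\ (k < K)%N, u.1.2 = sg k & u.2.2 = tu k]) ->
  conv_on P PL d L D.
Proof.
move=> delta0 st ts HD.
have [key Hkey] : {key : R4 -> nat & forall u, u \in D -> [/\ (key u < K)%N, u.1.2 = sg (key u) & u.2.2 = tu (key u)]}.
  apply: (@choice _ _ (fun u k => u \in D -> [/\ (k < K)%N, u.1.2 = sg k & u.2.2 = tu k])) => u.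
  by have [/HD[k hk]|_] := boolP (u \in D); [exists k|exists 0%N].
apply: conv_on_product => s sD Hs.
have keyD u : u \in D -> (key u < K)%N by move=> /Hkey[].
have [G [GE lG G01]] := product_by_key keyD sD Hs.
have HDk k u : u \in [seq u <- D | key u == k] -> u.1.2 = sg k /\ u.2.2 = tu k.
  by rewrite mem_filter => /andP[/eqP <- /Hkey[]].
have tG k : conv_test P PL d L (G k).
  exact: (slice_conv HL mobile sheet (st k) (HDk k)).
have order i j : (i < j)%N -> tu i + delta <= sg j.
  elim: j => [//|j IH]; rewrite ltnS leq_eqVlt => /predU1P[->//|/IH hi].
  by apply: le_trans hi _; apply: le_trans (ts j); have := st j; lra.
have prodE f : product s f = \prod_(k <- iota 0 K) G k f by exact: GE.
have p01 f : 0 <= product s f <= 1.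
  by rewrite prodE prodr_ge0 ?prodr_ile1// => k _; have /andP[] := G01 k f.
apply: (conv_test_eq (fun f => esym (prodE f))); split.
- by exists 1 => f; rewrite -prodE; have /andP[h1 h2] := p01 f; rewrite ger0_norm.
- move=> n; have [] := @bdd_meas_prod R _ (Omega n) nat (iota 0 K) (fun k => G k \o d n) => // k _.
  by have [] := conv_test_bdd (tG k).
- have [] := @bdd_meas_prod R _ OmegaL nat (iota 0 K) (fun k => G k \o L) => // k _.
  by have [] := conv_test_bdd (tG k).
rewrite [X in _ --> X](ev_prod_landscape HL K st _ HDk lG G01); last first.
  by move=> k; have := ts k; lra.
have cv : \prod_(k <- iota 0 K) ev (P n) (G k \o d n) @[n --> \oo] -->
    \prod_(k <- iota 0 K) ev PL (G k \o L).
  apply: cvg_big => [|k _]; first exact: mul_continuous.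
  by have [] := tG k.
apply: cvg_trans cv; apply: near_eq_cvg.
have := speed_diverges m_gt0 HL mobile delta0; apply: filterS => n cd.
have iX : independent (P n) (@measurable _ R) (fun i w => @X n w i) by have [] := X_iid n.
pose S k := [set z : int * int |
  Num.floor (- (c n * tu k)) <= z.2 <= Num.floor (- (c n * sg k))].
have disj i j : (i < j)%N -> S i `&` S j = set0.
  move=> /order ij; rewrite -subset0 => z [/andP[z1 _] /andP[_ z2]].
  have c0 : 0 < c n by rewrite -(pmulr_lgt0 _ delta0); lra.
  (* The gap lowers the argument of the floor by at least 1, so the last row of strip [i] lies
     strictly above the first row of strip [j]. *)
  have h1 : - (c n * sg j) <= - (c n * tu i) + (-1)%:~R.
    by have := ler_wpM2l (ltW c0) ij; rewrite mulrDr; lra.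
  have := le_trans z1 (le_trans z2 (le_floor h1)).
  by rewrite floorDrz ?intr_int// intrKfloor lerBrDr gerDl ler10.
suff : ev (P n) (fun w => \prod_(k <- iota 0 K) G k (d n w)) =
    \prod_(k <- iota 0 K) ev (P n) (fun w => G k (d n w)) by move->.
apply: (@ev_prod_sites R _ (Omega n) (P n) (int * int)%type (@X n) _ S _ _ (@mX n) iX) => //.
  exact: iota_uniq.
- by move=> i j _ _; rewrite neq_ltn => /orP[|ji]; [exact: disj|rewrite setIC; exact: disj].
- move=> k B mB; pose T' := g_sigma_algebraType (coordinates (@X n) (S k)).
  have := @contract_lip_measurable R _ _ T' (d n) _ _ (lG k).
  move=> /(_ _ measurableT B mB); rewrite setTI; apply => -[p q] /HDk /= [p2 q2].
  apply: (@measurable_contract _ _ T') => _ B' mB'; rewrite setTI.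
  apply: (@rescaled_sites _ (m n) (a n) (b n) (c n) (h n) _ (Omega n) (@X n) p q (S k) _ B' mB').
  move=> z; rewrite /before /S /= p2 q2 => h1 h2; apply/andP; split.
    by case/orP: h2 => [/eqP ->|/orP[/ltW//|/andP[/eqP <- _]]]; rewrite /= ?q2.
  by case/orP: h1 => [/ltW//|/andP[/eqP -> _]]; rewrite lexx.
Qed.

Lemma ev_dist_contract_cvg (x : nat -> OmegaL -> \bar R) (y : OmegaL -> \bar R) :
  (forall k, measurable_fun setT (x k)) -> measurable_fun setT y ->
  {ae PL, forall w, C (x k w) @[k --> \oo] --> C (y w)} ->
  ev PL (fun w => `|C (y w) - C (x k w)|) @[k --> \oo] --> 0.
Proof.
move=> mx my cv; rewrite -[X in _ --> X](ev_cst PL (0 : R)).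
apply: (ev_dominated_cvg (M := 2)) => [k|k w||].
- apply: measurableT_comp => //; apply: measurable_funB; exact: measurable_contract.
- by rewrite normr_id contract_dist2.
- apply: filterS cv => w cw; apply/cvgrPdist_le => e e0.
  move/cvgrPdist_le : cw => /(_ e e0); apply: filterS => k.
  by rewrite sub0r normrN normr_id.
- exact: measurable_cst.
Qed.

(** The row of a common time belongs to both strips, so each end time is moved back by [del j]. The
    shortened connection followed by a piece of duration [del j] at constant position is a minorant
    of the original one, and that piece is rarely below [- 2 q]. *)
Lemma adjacent_conv (t : nat -> R) (gap : R) (K : nat) (D : seq R4) : 0 < gap ->
  (forall k, t k + gap <= t k.+1) ->
  (forall u, u \in D -> exists k, [/\ (k < K)%N, u.1.2 = t k & u.2.2 = t k.+1]) ->
  conv_on P PL d L D.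
Proof.
move=> gap0 tgap HD.
have upD u : u \in D -> R4up u /\ u.1.2 + gap <= u.2.2.
  by move=> /HD[k [_ h1 h2]]; rewrite /R4up/= h1 h2; have := tgap k; split => //; lra.
pose del (j : nat) : R := gap / 2 * harmonic j.
have del0 j : 0 < del j by rewrite mulr_gt0// ?divr_gt0// /harmonic/= invr_gt0.
have del1 j : del j <= gap / 2.
  have h1 : harmonic j <= 1 :> R by rewrite /harmonic/= invf_le1 ?ltr0n// ler1n.
  by rewrite /del ler_piMr// divr_ge0// ltW.
have cdel : del j @[j --> \oo] --> (0 : R).
  rewrite -[X in _ --> X](mulr0 (gap / 2)); apply: cvgMl_tmp; exact: cvg_harmonic.
pose sh (r : R) (u : R4) : R4 := (u.1, (u.2.1, u.2.2 - r)).
pose ga (r : R) (u : R4) : R4 := ((u.2.1, u.2.2 - r), (u.2.1, u.2.2)).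
have shup j u : u \in D -> R4up (sh (del j) u).
  by move=> /upD[_]; have := del1 j; rewrite /R4up /sh/=; lra.
have gaup j (u : R4) : R4up (ga (del j) u) by have := del0 j; rewrite /R4up /ga/=; lra.
apply: conv_on_minorant => [u /upD[uu _]|e e0]; first exact: contract_conv.
have e8 : 0 < e / 8 by rewrite divr_gt0.
have [M M0 HM] := landscape_ramp HL e8.
pose q := e / 16; have q0 : 0 < q by rewrite divr_gt0.
have qq : - (2 * q) < - q by lra.
(* The scale of the short piece is the cube root of [del j], so the second condition makes [M] times
   this scale at most [q]. *)
have : \forall j \near \oo, (forall u, u \in D ->
    ev PL (fun w => `|C (L w u) - C (L w (sh (del j) u))|) < e) /\ del j < (q / M) ^+ 3.
  near=> j; split; last first.
    by near: j; apply: (cvgr_lt _ cdel); rewrite exprn_gt0// divr_gt0.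
  near: j; apply: near_seq => u uD.
  apply: cvgr_lt e0; apply: ev_dist_contract_cvg => //; apply: aeW => w.
  have [_ /(_ w u) cu _ _ _] := HL; have [cw _] := cu (upD u uD).1.
  have : sh (del j) u @[j --> \oo] --> u.
    apply/cvg_ballP => r r0; move/cvgrPdist_lt : cdel => /(_ r r0); apply: filterS => j.
    rewrite sub0r normrN => h1; split; first exact: ballxx.
    split; first exact: ballxx.
    by rewrite -ball_normE /ball_/sh/= opprB addrC subrK.
  by move=> cs; apply: continuous_cvg; [exact: continuous_contract|exact: continuous_cvg cw cs].
move=> /filter_ex[j [Hj qj]].
(* A short piece above [- 2 q] costs at most [2 q]; otherwise the loss is at most 2, the diameter of
   the range of [contract]. *)
exists (fun f u => f (sh (del j) u)), (fun u f => 4 * q + 2 * (1 - ramp (- (2 * q)) (- q) (f (ga (del j) u)))).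
split => [H [K' K'0 HK]|u uD|u n w uD|u uD]; last exact/ltW/Hj.
- pose D' := [seq sh (del j) u | u <- D].
  have tD' : conv_on P PL d L D'.
    apply: (@blocks_conv (del j) K t (fun k => t k.+1 - del j)) => // [k|k|_ /mapP[u uD ->]].
    + by have := tgap k; have := del1 j; lra.
    + by lra.
    + by have [k [kK h1 h2]] := HD u uD; exists k; rewrite /sh/= h1 h2.
  apply: tD'; exists K' => // f g r r0 fg; apply: HK => // u uD; apply: fg.
  exact: map_f.
- have tr := ramp_conv (gaup j u) qq; split.
    apply: conv_testD; first exact: conv_test_cst.
    by apply: conv_testZ; apply: conv_testB tr; exact: conv_test_cst.
  have [_ br] := conv_test_bdd tr.
  have b1 : bdd_meas (fun=> 1 : R) := bdd_meas_cst (OmegaL) 1.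
  have b2 := bdd_measB b1 br; have b3 := bdd_measZ 2 b2.
  rewrite [ev _ _](evD PL (bdd_meas_cst OmegaL (4 * q)) b3) (evZ PL 2 b2) (evB PL b1 br) !ev_cst.
  have vE : 0 = (u.2.1 - u.2.1) / ((u.2.2 - (u.2.2 - del j)) `^ 3^-1) ^+ 2 :> R by rewrite subrr mul0r.
  have st : u.2.2 - del j < u.2.2 by have := del0 j; lra.
  have [h1 _] := HM u.2.1 (u.2.2 - del j) u.2.1 u.2.2 _ 0 _ _ st erefl vE qq.
  have {}h1 : 1 - e / 8 <= ev PL (fun w => ramp (- (2 * q)) (- q) (L w (ga (del j) u))).
    apply: h1; rewrite expr0n addr0 lerN2 -ler_pdivlMr// opprB addrC subrK.
    apply: (@le_trans _ _ (((q / M) ^+ 3) `^ 3^-1)).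
      apply: ge0_ler_powR; rewrite ?nnegrE ?invr_ge0 ?exprn_ge0 ?divr_ge0 ?ltW//.
    have qM : 0 <= q / M by rewrite divr_ge0// ltW.
    by rewrite -powR_mulrn// -powRrM divff// powRr1.
  by move: h1; rewrite /comp /q; lra.
- have := rescaled_triangle (a n) (b n) (c n) (h n) (m_gt0 n) (X w) u.1 (u.2.1, u.2.2 - del j) u.2.
  have /andP[r1 r2] := ramp_bounds (- (2 * q)) (- q) (d n w (ga (del j) u)).
  rewrite -!surjective_pairing; set A := rescaled_lpp _ _ _ _ _ _ (_, _).
  set B := rescaled_lpp _ _ _ _ _ _ (_, _) => tri; split; last by lra.
  have [bad|good] := leP (d n w (ga (del j) u)) (- (2 * q))%:E.
    rewrite (ramp0 qq bad) subr0 mulr1; have := contract_dist2 (d n w (sh (del j) u)) (d n w u).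
    by rewrite ler_norml => /andP[_]; lra.
  have : C (A + (- (2 * q))%:E)%E <= C (d n w u).
    by rewrite le_contract; apply: le_trans tri; rewrite leeD2l// /B; move: good; rewrite /ga -surjective_pairing => /ltW.
  have := contract_addr A (- (2 * q)).
  by rewrite normrN gtr0_norm ?mulr_gt0// -/(sh (del j) u) /A; lra.
Unshelve. all: by end_near. Qed.

(* Metric composition through the first intermediate time, with the maximum over a finite set. *)
Lemma span_conv (t : nat -> R) (gap : R) (K l : nat) (D : seq R4) : 0 < gap ->
  (forall k, t k + gap <= t k.+1) ->
  (forall u, u \in D -> exists i j, [/\ (i < j)%N, (j <= i + l.+1)%N, (j <= K)%N,
     u.1.2 = t i & u.2.2 = t j]) ->
  conv_on P PL d L D.
Proof.
move=> gap0 tgap; elim: l D => [|l IH] D HD.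
  apply: (adjacent_conv (K := K) gap0 tgap) => u /HD[i [j [ij ji jK h1 h2]]].
  by exists i; split => //; [lia|rewrite h2; congr t; lia].
have tlt i j : (i < j)%N -> t i < t j.
  elim: j => [//|j IHj]; rewrite ltnS leq_eqVlt => /predU1P[->|/IHj]; have := tgap j; lra.
have [ij Hij] : {ij : R4 -> nat * nat & forall u, u \in D -> [/\ ((ij u).1 < (ij u).2)%N,
    ((ij u).2 <= (ij u).1 + l.+2)%N, ((ij u).2 <= K)%N, u.1.2 = t (ij u).1 & u.2.2 = t (ij u).2]}.
  apply: (@choice _ _ (fun u (ij : nat * nat) => u \in D -> [/\ (ij.1 < ij.2)%N,
    (ij.2 <= ij.1 + l.+2)%N, (ij.2 <= K)%N, u.1.2 = t ij.1 & u.2.2 = t ij.2])) => u.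
  have [/HD[i [j hij]]|_] := boolP (u \in D); last by exists (0%N, 0%N).
  by exists (i, j) => _.
(* The intermediate time is the one right after the start: the first leg spans one strip and the
   second one strip fewer than [u], as the induction on [l] requires. *)
pose long u := ((ij u).1.+1 < (ij u).2)%N; pose mid u := t (ij u).1.+1.
pose fst_leg (u : R4) (z : R) : R4 := (u.1, (z, mid u)).
pose snd_leg (u : R4) (z : R) : R4 := ((z, mid u), u.2).
have upD u : u \in D -> R4up u by move=> /Hij[h1 _ _ h2 h3]; rewrite /R4up/= h2 h3 tlt.
have up1 u z : u \in D -> R4up (fst_leg u z).
  by move=> /Hij[h1 _ _ h2 h3]; rewrite /R4up/= h2 /mid tlt.
have up2 u z : u \in D -> long u -> R4up (snd_leg u z).
  by move=> /Hij[h1 _ _ h2 h3] lu; rewrite /R4up/= h3 /mid tlt.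
(* [W] is the composition over finitely many points, which approximates [L]. [Y0] truncates the
   legs, and so becomes a Lipschitz functional of finitely many values. *)
pose W (Z : seq R) (f : R4 -> \bar R) u := \big[maxe/-oo%E]_(z <- Z) (f (fst_leg u z) + f (snd_leg u z))%E.
pose Y0 (M : R) (Z : seq R) (f : R4 -> \bar R) u : \bar R :=
  \big[maxe/-oo%E]_(z <- Z) (truncate M (f (fst_leg u z)) + truncate M (f (snd_leg u z)))%:E.
pose Y M Z f u := if long u then Y0 M Z f u else f u.
(* Truncation from above only lowers a leg. A leg below [- M] is raised, and then its term here is
   1. *)
pose bad (M : R) (f : R4 -> \bar R) u z := (1 - ramp (- M) (- M + 1) (f (fst_leg u z))) +
  (1 - ramp (- M) (- M + 1) (f (snd_leg u z))).
pose E M Z u f := if long u then 2 * \sum_(z <- Z) bad M f u z else 0.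
have rM (M : R) : - M < - M + 1 by lra.
have bad0 M f u z : 0 <= bad M f u z.
  have /andP[r1 r2] := ramp_bounds (- M) (- M + 1) (f (fst_leg u z)).
  by have /andP[r3 r4] := ramp_bounds (- M) (- M + 1) (f (snd_leg u z)); rewrite /bad; lra.
have mW Z u : measurable_fun setT (fun w => W Z (L w) u).
  rewrite /W; elim: Z => [|z Z IZ]; first by under eq_fun do rewrite big_nil; exact: measurable_cst.
  under eq_fun do rewrite big_cons; apply: measurable_maxe => //.
  by apply: emeasurable_funD; exact: mL.
have mT (M : nat) v : measurable_fun setT (fun w => truncate M%:R (L w v)).
  apply: (@contract_lip_measurable R R4 _ _ L [:: v] (fun f => truncate M%:R (f v))) => [|u _].
    apply: contract_lip_at; first exact: mem_head.
    exists ((1 + M%:R) ^+ 2) => [|x y]; first exact: sqr_ge0.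
    exact: truncate_lip.
  exact: measurable_contract.
have mY0 (M : nat) Z u : measurable_fun setT (fun w => Y0 M%:R Z (L w) u).
  rewrite /Y0; elim: Z => [|z Z IZ]; first by under eq_fun do rewrite big_nil; exact: measurable_cst.
  under eq_fun do rewrite big_cons; apply: measurable_maxe => //; apply/measurable_EFinP.
  exact: measurable_funD.
have tE (M : R) Z u : u \in D -> conv_test P PL d L (E M Z u).
  move=> uD; have [lu|lu] := boolP (long u); rewrite /E ?lu ?(negbTE lu); last exact: conv_test_cst.
  apply: conv_testZ; apply: conv_test_sum => z _; apply: conv_testD;
    (apply: conv_testB; [exact: conv_test_cst|apply: ramp_conv => //]); [exact: up1|exact: up2].
have Lfin u w : R4up u -> exists r : R, L w u = r%:E.
  move=> uu; have [_ /(_ w u uu)[_ fin] _ _ _] := HL.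
  by exists (fine (L w u)); rewrite fineK.
have bC (x : OmegaL -> \bar R) : measurable_fun setT x -> bdd_meas (fun w => C (x w)).
  by move=> mx; split; [exact: measurable_contract|exists 1 => w; exact: contract_le1].
have cW u : u \in D -> long u ->
    ev PL (fun w => `|C (L w u) - C (W (rationals k) (L w) u)|) @[k --> \oo] --> 0.
  move=> uD lu; apply: ev_dist_contract_cvg => //.
  have [_ cL _ _ comp] := HL; apply: filterS comp => w comp.
  have [u1 u2] : u.1.2 < mid u /\ mid u < u.2.2 by split; [exact: (up1 u 0 uD)|exact: (up2 u 0 uD lu)].
  have [le_L [z0 eq_L]] := comp _ _ _ u.1.1 u.2.1 u1 u2.
  pose f z := (L w (fst_leg u z) + L w (snd_leg u z))%E.
  have {}le_L z : (f z <= L w u)%E.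
    by have := le_L z; rewrite /f /fst_leg /snd_leg; case: (u) => [[? ?] [? ?]].
  have {}eq_L : f z0 = L w u.
    by move: eq_L; rewrite /f /fst_leg /snd_leg; case: (u) => [[? ?] [? ?]].
  have cf : C (f z) @[z --> z0] --> C (L w u).
    rewrite -eq_L; apply: continuous_cvg; first exact: continuous_contract.
    have [r1 E1] := Lfin _ w (up1 u z0 uD); have [r2 E2] := Lfin _ w (up2 u z0 uD lu).
    apply: cvgeD; first by rewrite E1 E2.
      apply: continuous_cvg; first by have [] := cL w _ (up1 u z0 uD).
      apply/cvg_ballP => r r0; apply: filterS (nbhsx_ballx z0 r r0) => z bz.
      by split; [exact: ballxx|split => //; exact: ballxx].
    apply: continuous_cvg; first by have [] := cL w _ (up2 u z0 uD lu).
    apply/cvg_ballP => r r0; apply: filterS (nbhsx_ballx z0 r r0) => z bz.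
    by split; [split => //; exact: ballxx|exact: ballxx].
  apply/cvgrPdist_le => e e0; move/cvgrPdist_le : cf => /(_ e e0) /nbhs_ballP[r r0 Hr].
  have := rationals_dense z0 r0; apply: filterS => k [z zk z0z].
  have h1 : C (W (rationals k) (L w) u) <= C (L w u).
    by rewrite le_contract /W; elim/big_ind : _ => [|x y xu yu|i _]; [exact: leNye|rewrite ge_max xu yu|exact: le_L].
  have h2 : C (f z) <= C (W (rationals k) (L w) u).
    by rewrite le_contract /W (big_rem z)//= le_max lexx.
  have : `|C (L w u) - C (f z)| <= e by apply: Hr; rewrite -ball_normE.
  by rewrite !ler_norml => /andP[h3 h4]; apply/andP; split; lra.
have big_nat_ge (r : R) : \forall k \near \oo, `|r| <= k%:R :> R.
  exists (Num.trunc `|r|).+1 => // k /= rk.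
  by rewrite ltW// (lt_le_trans (truncnS_gt _))// ler_nat.
have cY u Z : u \in D -> long u ->
    ev PL (fun w => `|C (W Z (L w) u) - C (Y0 k%:R Z (L w) u)|) @[k --> \oo] --> 0.
  move=> uD lu; apply: ev_dist_contract_cvg => //; apply: aeW => w; apply: cvg_near_cst.
  have : \forall k \near \oo, forall z, z \in Z ->
      L w (fst_leg u z) = (truncate k%:R (L w (fst_leg u z)))%:E /\
      L w (snd_leg u z) = (truncate k%:R (L w (snd_leg u z)))%:E.
    apply: near_seq => z zZ; have [r1 E1] := Lfin _ w (up1 u z uD).
    have [r2 E2] := Lfin _ w (up2 u z uD lu); rewrite E1 E2.
    near=> k; rewrite !truncate_id//; [near: k; exact: big_nat_ge|near: k; exact: big_nat_ge].
  apply: filterS => k Hk; congr C; rewrite /Y0 /W; apply: eq_big_seq => z zZ.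
  by have [h1 h2] := Hk z zZ; rewrite [in RHS]h1 [in RHS]h2 EFinD.
have cE u Z : u \in D -> ev PL (E k%:R Z u \o L) @[k --> \oo] --> 0.
  move=> uD; have [lu|/negbTE lu] := boolP (long u); last first.
    by rewrite /E lu; under eq_fun do rewrite [ev _ _]ev_cst; exact: cvg_cst.
  rewrite -[X in _ --> X](ev_cst PL (0 : R)).
  apply: (ev_dominated_cvg (M := 2 * \sum_(z <- Z) 2)).
  - by move=> k; have [] := tE k%:R Z u uD.
  - move=> k w; rewrite /E /= lu ger0_norm; last by rewrite mulr_ge0// sumr_ge0.
    rewrite ler_wpM2l//; apply: ler_sum => z _; rewrite /bad.
    have /andP[r1 r2] := ramp_bounds (- k%:R) (- k%:R + 1) (L w (fst_leg u z)).
    by have /andP[r3 r4] := ramp_bounds (- k%:R) (- k%:R + 1) (L w (snd_leg u z)); lra.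
  - apply: aeW => w; apply: cvg_near_cst.
    have : \forall k \near \oo, forall z, z \in Z -> bad k%:R (L w) u z = 0.
      apply: near_seq => z zZ; have [r1 E1] := Lfin _ w (up1 u z uD).
      have [r2 E2] := Lfin _ w (up2 u z uD lu); rewrite /bad E1 E2.
      near=> k.
      have k1 : `| `|r1| + 1| <= k%:R by near: k; exact: big_nat_ge.
      have k2 : `| `|r2| + 1| <= k%:R by near: k; exact: big_nat_ge.
      have n1 := ler_norm (- r1); have n2 := ler_norm (- r2); rewrite !normrN in n1 n2.
      have {}k1 := le_trans (ler_norm _) k1; have {}k2 := le_trans (ler_norm _) k2.
      by rewrite !ramp1 ?lee_fin//; lra.
    apply: filterS => k Hk; rewrite /E /= lu big_seq big1 ?mulr0// => z zZ; exact: Hk.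
  - exact: measurable_cst.
apply: conv_on_minorant => [u /upD|e e0]; first exact: contract_conv.
have e2 : 0 < e / 2 by rewrite divr_gt0.
have /filter_ex[k Hk] : \forall k \near \oo, forall u, u \in D -> long u ->
    ev PL (fun w => `|C (L w u) - C (W (rationals k) (L w) u)|) < e / 2.
  apply: near_seq => u uD; have [lu|_] := boolP (long u); last exact: nearW.
  by move/cvgr_lt: (cW u uD lu) => /(_ _ e2); apply: filterS.
set Z := rationals k in Hk.
have /filter_ex[M [HM1 HM2]] : \forall M \near \oo, (forall u, u \in D -> long u ->
    ev PL (fun w => `|C (W Z (L w) u) - C (Y0 M%:R Z (L w) u)|) < e / 2) /\
    (forall u, u \in D -> ev PL (E M%:R Z u \o L) < e).
  near=> M; split; near: M; apply: near_seq => u uD.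
    have [lu|_] := boolP (long u); last exact: nearW.
    by move/cvgr_lt: (cY u Z uD lu) => /(_ _ e2); apply: filterS.
  by move/cvgr_lt: (cE u Z uD) => /(_ _ e0).
exists (Y M%:R Z), (E M%:R Z); split => [H [B B0 HB]|u uD|u n w uD|u uD].
- pose D1 := [seq u <- D | long u].
  pose D' := [seq u <- D | ~~ long u] ++ [seq fst_leg u z | u <- D1, z <- Z] ++
    [seq snd_leg u z | u <- D1, z <- Z].
  have tD' : conv_on P PL d L D'.
    apply: IH => u; rewrite !mem_cat => /orP[|/orP[|]].
    + rewrite mem_filter /long -leqNgt => /andP[lu /Hij[h1 h2 h3 h4 h5]].
      by exists (ij u).1, (ij u).2; split => //; lia.
    + move=> /allpairsP[[v z] [/= + _ ->]]; rewrite mem_filter => /andP[_ /Hij[h1 h2 h3 h4 h5]].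
      by exists (ij v).1, (ij v).1.+1; split => //; lia.
    + move=> /allpairsP[[v z] [/= + _ ->]].
      rewrite mem_filter => /andP[lv /Hij[h1 h2 h3 h4 h5]].
      by exists (ij v).1.+1, (ij v).2; split => //; lia.
  apply: tD'; exists (B * (1 + 2 * (1 + M%:R) ^+ 2)).
    by rewrite mulr_ge0// addr_ge0// mulr_ge0// sqr_ge0.
  move=> f g r r0 fg; rewrite -mulrA; apply: HB.
    by rewrite mulr_ge0// addr_ge0// mulr_ge0// sqr_ge0.
  have s0 : 0 <= (1 + M%:R) ^+ 2 * r by rewrite mulr_ge0// sqr_ge0.
  move=> u uD; rewrite /Y; case: ifP => [lu|/negbT lu]; last first.
    apply: le_trans (fg u _) _; last by rewrite mulrDl mul1r -mulrA; lra.
    by rewrite mem_cat mem_filter lu uD.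
  rewrite /Y0 !contract_bigmax; apply: le_trans (_ : 2 * ((1 + M%:R) ^+ 2 * r) <= _); last first.
    by rewrite mulrDl mul1r -mulrA; lra.
  apply: bigmaxr_dist => [|z zZ]; first by rewrite mulr_ge0.
  apply: le_trans (contract_lip1 _ _) _.
  rewrite opprD addrACA; apply: le_trans (ler_normD _ _) _; rewrite mulr_natl mulr2n.
  apply: lerD; (apply: le_trans (truncate_lip _ _ (ler0n _ _)) _; rewrite ler_wpM2l ?sqr_ge0//; apply: fg);
    rewrite !mem_cat.
    by apply/orP; right; apply/orP; left; apply/allpairsP; exists (u, z); rewrite /D1 mem_filter lu uD.
  by apply/orP; right; apply/orP; right; apply/allpairsP; exists (u, z); rewrite /D1 mem_filter lu uD.
- split; last exact/ltW/HM2.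
  exact: tE.
- rewrite /Y /E; case: ifP => lu; last by rewrite addr0.
  split; last by rewrite mulr_ge0// sumr_ge0.
  have [/allP good|/allPn[z zZ]] := boolP (all (fun z => ((- M%:R)%:E < d n w (fst_leg u z))%E &&
      ((- M%:R)%:E < d n w (snd_leg u z))%E) Z).
    have : C (Y0 M%:R Z (d n w) u) <= C (d n w u).
      rewrite le_contract /Y0 big_seq; elim/big_ind : _ => [|x y xu yu|z zZ].
      + exact: leNye.
      + by rewrite ge_max xu yu.
      have tr (x : \bar R) : ((- M%:R)%:E < x)%E -> ((truncate M%:R x)%:E <= x)%E.
        case: x => [x| |]//=; rewrite ?leey// lte_fin lee_fin => hx.
        by have := ler0n R M; case_clamp; lra.
      have := rescaled_triangle (a n) (b n) (c n) (h n) (m_gt0 n) (X w) u.1 (z, mid u) u.2.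
      rewrite -!surjective_pairing EFinD; apply: le_trans.
      by have /andP[g1 g2] := good z zZ; apply: leeD; exact: tr.
    have : 0 <= \sum_(z <- Z) bad M%:R (d n w) u z by exact: sumr_ge0.
    by move=> h1 h2; lra.
  have := contract_dist2 (Y0 M%:R Z (d n w) u) (d n w u).
  rewrite ler_norml => /andP[_ h1] h2.
  suff : 1 <= \sum_(z <- Z) bad M%:R (d n w) u z by lra.
  rewrite (big_rem z)//=; apply: ler_wpDr; first exact: sumr_ge0.
  have /andP[r1 r2] := ramp_bounds (- M%:R) (- M%:R + 1) (d n w (fst_leg u z)).
  have /andP[r3 r4] := ramp_bounds (- M%:R) (- M%:R + 1) (d n w (snd_leg u z)).
  move: h2; rewrite negb_and -!leNgt /bad => /orP[/(ramp0 (rM _)) ->|/(ramp0 (rM _)) ->]; lra.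
- have [lu|lu] := boolP (long u); rewrite /Y ?lu ?(negbTE lu); last first.
    rewrite (_ : (fun _ => _) = fun=> 0) ?ev_cst ?ltW//.
    by apply/funext => w; rewrite subrr normr0.
  have bW : bdd_meas (fun w => `|C (L w u) - C (W Z (L w) u)|).
    by apply: bdd_meas_norm; apply: bdd_measB; apply: bC.
  have bY : bdd_meas (fun w => `|C (W Z (L w) u) - C (Y0 M%:R Z (L w) u)|).
    by apply: bdd_meas_norm; apply: bdd_measB; apply: bC.
  apply: (@le_trans _ _ (ev PL (fun w => `|C (L w u) - C (W Z (L w) u)| +
    `|C (W Z (L w) u) - C (Y0 M%:R Z (L w) u)|))).
    apply: ev_le => [||w]; [|exact: bdd_measD|exact: ler_distD].
    by apply: bdd_meas_norm; apply: bdd_measB; apply: bC.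
  by rewrite evD//; have := Hk u uD lu; have := HM1 u uD lu; lra.
Unshelve. all: by end_near. Qed.

End finite_dimensional.

(** * Ottaviani's inequality *)

Section ottaviani.
Context {R : realType} d (T : measurableType d) (P : probability T R).
Local Notation pr A := (fine (P A)).

Lemma pr_le (A B : set T) : measurable A -> measurable B -> A `<=` B -> pr A <= pr B.
Proof.
by move=> mA mB AB; rewrite fine_le ?fin_num_measure//; apply: le_measure => //; exact: mem_set.
Qed.

Lemma prU (A B : set T) : measurable A -> measurable B -> A `&` B = set0 ->
  pr (A `|` B) = pr A + pr B.
Proof. by move=> mA mB AB; rewrite measureU// fineD ?fin_num_measure. Qed.

Lemma pr_ge0 (A : set T) : 0 <= pr A. Proof. exact: fine_ge0 (measure_ge0 P A). Qed.

Lemma pr_le1 (A : set T) : measurable A -> pr A <= 1.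
Proof. by move=> mA; rewrite -[leRHS]/(fine 1%:E) fine_le ?fin_num_measure// probability_le1. Qed.

(* Ottaviani's inequality: the first event [E i] along [s] is independent of [G i]. *)
Lemma ottaviani (V : choiceType) (X : T -> V -> R) (I : eqType) (r : rel I) (S S' : I -> set V)
    (E G : I -> set T) (e : R) (s : seq I) :
  random_function X -> independent P (@measurable _ R) (fun i w => X w i) ->
  (forall i, S i `&` S' i = set0) -> (forall i, <<s coordinates X (S i) >> (E i)) ->
  (forall i j, r j i -> <<s coordinates X (S i) >> (E j)) ->
  (forall i, <<s coordinates X (S' i) >> (G i)) -> 0 <= e ->
  (forall i, i \in s -> 1 - e <= pr (G i)) -> pairwise r s ->
  pr (\bigcup_(i in [set` s]) E i) <= pr (\bigcup_(i in [set` s]) (E i `&` G i)) + e.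
Proof.
move=> mX iX SS' sE rE sG e0 eG rs.
have mE i : measurable (E i) := measurable_coordinates mX (sE i).
have mG i : measurable (G i) := measurable_coordinates mX (sG i).
have mU (l : seq I) (F : I -> set T) : (forall i, measurable (F i)) -> measurable (\bigcup_(i in [set` l]) F i).
  by move=> mF; apply: fin_bigcup_measurable => //; exact: finite_seq.
(* [W] is the disjoint union over [i] of the events that [E i] is the first to occur and [G i]
   holds; each piece has at least [1 - e] times the probability of the first occurrence. *)
suff [W [mW WU WE]] : exists W, [/\ measurable W, W `<=` \bigcup_(i in [set` s]) (E i `&` G i) &
    (1 - e) * pr (\bigcup_(i in [set` s]) E i) <= pr W].
  have := pr_le mW (mU s _ (fun i => measurableI _ _ (mE i) (mG i))) WU.
  have := pr_le1 (mU s _ mE); have := pr_ge0 (\bigcup_(i in [set` s]) E i); nra.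
elim/last_ind: s eG rs => [|s i IH] eG.
  by move=> _; exists set0; split => //; rewrite set_nil bigcup_set0 measure0 mulr0.
rewrite pairwise_rcons => /andP[/allP ri ps].
have eG' j : j \in s -> 1 - e <= pr (G j) by move=> js; apply: eG; rewrite mem_rcons inE js orbT.
have [W [mW WU WE]] := IH eG' ps.
pose U := \bigcup_(j in [set` s]) E j; pose A := E i `\` U.
have sA : <<s coordinates X (S i) >> A.
  apply: (@measurableD _ (g_sigma_algebraType (coordinates X (S i)))); first exact: sE.
  apply: (@fin_bigcup_measurable _ (g_sigma_algebraType (coordinates X (S i)))); first exact: finite_seq.
  by move=> j /= js; apply: rE; exact: ri.
have mA := measurable_coordinates mX sA.
have UE : \bigcup_(j in [set` rcons s i]) E j = U `|` A.
  apply/seteqP; split => [w [j /=]|w [[j js Ej]|[Ei _]]].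
  - rewrite mem_rcons inE => /predU1P[->|js] Ej; last by left; exists j.
    by have [Uw|nU] := pselect (U w); [left|right].
  - by exists j => //=; rewrite mem_rcons inE js orbT.
  - by exists i => //=; rewrite mem_rcons mem_head.
have mUU : measurable U by exact: mU.
exists (W `|` (A `&` G i)); split.
- by apply: measurableU => //; exact: measurableI.
- move=> w [/WU[j js EGj]|[[Ei _] Gi]].
    by exists j => //=; rewrite mem_rcons inE js orbT.
  by exists i => //=; rewrite mem_rcons mem_head.
have WinU : W `<=` U by move=> w /WU[j js [Ej _]]; exists j.
rewrite UE !prU//; [|exact: measurableI| |].
- rewrite (sites_independent mX iX (SS' i) sA (sG i)) fineM ?fin_num_measure//.
  have := eG i (eqbRL (mem_rcons _ _ _) (mem_head _ _)).
  by have := pr_ge0 A; move: WE; rewrite -/U; nra.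
- by rewrite -subset0 => w [/WinU Uw [[_ nU] _]].
- by rewrite /A setDE setICA setICr setI0.
Qed.

End ottaviani.

Definition int_range (M : nat) : seq int := [seq (k%:Z - M%:Z)%R | k <- iota 0 (M + M).+1].

Lemma int_rangeP (M : nat) (i : int) : (i \in int_range M) = (`|i| <= M%:Z).
Proof.
apply/mapP/idP => [[k]|]; first by rewrite mem_iota => /andP[_ h1 ->]; rewrite ler_norml; apply/andP; split; lia.
move=> iM; exists (absz (i + M%:Z)); first by rewrite mem_iota; move: iM; rewrite ler_norml => /andP[h1 h2]; lia.
by move: iM; rewrite ler_norml => /andP[h1 h2]; lia.
Qed.

Lemma floor_bound (R : realType) (x B : R) : `|x| <= B -> Num.floor x \in int_range (Num.trunc B).+2.
Proof.
move=> xB; rewrite int_rangeP; have h1 := floor_le x; have h2 := floorD1_gt x; have h3 := truncnS_gt B.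
rewrite intrD in h2; move: xB; rewrite !ler_norml => /andP[h4 h5].
rewrite -!(ler_int R) rmorphN /= -!pmulrn -[_.+2%:R]natr1.
by apply/andP; split; lra.
Qed.

(** * Suprema over boxes of start and end points *)

Section boxes.
Context {R : realType} dT (T : measurableType dT) (P : probability T R).
Variables (X : T -> int * int -> R) (m a b c : R) (h : int * int -> R).
Hypotheses (m0 : 0 < m) (mX : random_function X)
  (iX : independent P (@measurable _ R) (fun i w => X w i)).
Local Notation R2 := (R * R)%type.
Local Notation R4 := (R2 * R2)%type.
Local Notation pt := (lattice_point a b c).
Local Notation d := (fun w => rescaled_lpp (X w) m a b c h).
Local Notation pr A := (fine (P A)).

Let sites (D : set R2) (M : nat) : seq (int * int) :=
  [seq z <- [seq (i, j) | i <- int_range M, j <- int_range M] | `[< exists2 p, D p & pt p = z >]].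

Let sites_exist (D : set R2) (B : R) : (forall p, D p -> `|p.1| <= B /\ `|p.2| <= B) ->
  exists s : seq (int * int), (forall z, z \in s -> exists2 p, D p & pt p = z) /\
    (forall p, D p -> pt p \in s).
Proof.
move=> DB; pose A := (`|a| + `|b| + `|c|) * `|B|; exists (sites D (Num.trunc A).+2); split => [z|p Dp].
  by rewrite mem_filter => /andP[/asboolP].
rewrite mem_filter; apply/andP; split; first by apply/asboolP; exists p.
have [h1 h2] := DB p Dp; have hB := ler_norm B.
have k1 : `|a * p.1| <= `|a| * `|B| by rewrite normrM ler_wpM2l// (le_trans h1).
have k2 : `|b * p.2| <= `|b| * `|B| by rewrite normrM ler_wpM2l// (le_trans h2).
have k3 : `|c * p.2| <= `|c| * `|B| by rewrite normrM ler_wpM2l// (le_trans h2).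
have n1 := mulr_ge0 (normr_ge0 a) (normr_ge0 B); have n2 := mulr_ge0 (normr_ge0 b) (normr_ge0 B).
have n3 := mulr_ge0 (normr_ge0 c) (normr_ge0 B).
apply/allpairsP; exists (pt p); split => //; apply: floor_bound; rewrite /A !mulrDl.
  by apply: le_trans (ler_normD _ _) _; lra.
by rewrite normrN; lra.
Qed.

Let before_eq : rel (int * int) := fun x y => (x == y) || before x y.

Let before_eq_trans : transitive before_eq.
Proof.
move=> y x z /orP[/eqP ->//|xy] /orP[/eqP <-|yz]; rewrite /before_eq ?xy ?orbT//.
by rewrite (before_trans xy yz) orbT.
Qed.

Let before_eq_total : total before_eq.
Proof.
move=> x y; rewrite /before_eq; have [//|xy] := eqVneq x y.
exact: before_total xy.
Qed.

Let not_both x y : before x y -> before_eq y x = false.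
Proof.
move=> xy; apply/negP => /orP[/eqP E|yx]; first by move: xy; rewrite E before_irr.
by have := before_trans xy yx; rewrite before_irr.
Qed.

Let event_sites (al : R) p q (S : set (int * int)) :
  (forall z, before (pt p) z -> (z == pt q) || before z (pt q) -> S z) ->
  <<s coordinates X S >> [set w | (al%:E < d w (p, q))%E].
Proof.
move=> HS; have := rescaled_sites m h (X := X) HS (emeasurable_itv `]al%:E, +oo[).
by congr (<<s _ >> _); apply/seteqP; split => w /=; rewrite in_itv/= andbT.
Qed.

Let union_sites (S : set (int * int)) (I : eqType) (s : seq I) (F : I -> set T) :
  (forall i, <<s coordinates X S >> (F i)) -> <<s coordinates X S >> (\bigcup_(i in [set` s]) F i).
Proof.
move=> sF; apply: (@fin_bigcup_measurable _ (g_sigma_algebraType (coordinates X S))).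
  exact: finite_seq.
by move=> i _; exact: sF.
Qed.

Let mevent al p q : measurable [set w | (al%:E < d w (p, q))%E].
Proof. by apply: (measurable_coordinates mX (S := setT)); exact: event_sites. Qed.

Let add_gt (x y : \bar R) (a' b' : R) : (a'%:E < x)%E -> (b'%:E < y)%E -> ((a' + b')%:E < x + y)%E.
Proof. by rewrite EFinD; exact: lteD. Qed.

(* Ottaviani's inequality for the start points, explored from the last site backwards, and then
   for the end points, explored forwards. *)
Lemma box_tail (Dp Dq : set R2) (gm gp : R2 -> R2) (B al e eta : R) (D : seq R4) : 0 <= eta ->
  (forall p, Dp p \/ Dq p -> `|p.1| <= B /\ `|p.2| <= B) ->
  (forall p, Dp p -> 1 - eta <= pr [set w | ((- e)%:E < d w (gm p, p))%E]) ->
  (forall q, Dq q -> 1 - eta <= pr [set w | ((- e)%:E < d w (q, gp q))%E]) ->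
  (forall p q w, Dp p -> Dq q -> (-oo < d w (gm p, q))%E -> (gm p, gp q) \in D) ->
  pr (\bigcup_(u in [set u | Dp u.1 /\ Dq u.2]) [set w | (al%:E < d w u)%E]) <=
  pr [set w | exists2 u, u \in D & ((al - 2 * e)%:E < d w u)%E] + 2 * eta.
Proof.
move=> eta0 DB Pm Pp HD.
have [lp [lp1 lp2]] := @sites_exist Dp B (fun p Dp => DB p (or_introl Dp)).
have [lq [lq1 lq2]] := @sites_exist Dq B (fun q Dq => DB q (or_intror Dq)).
(* The metric depends on its arguments only through their lattice points, so one representative per
   site turns the union over the box into a finite one. *)
have repr (Dr : set R2) (l : seq (int * int)) : (forall z, z \in l -> exists2 p, Dr p & pt p = z) ->
    {r : int * int -> R2 & forall z, z \in l -> Dr (r z) /\ pt (r z) = z}.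
  move=> H; apply: (@choice _ _ (fun z p => z \in l -> Dr p /\ pt p = z)) => z.
  by have [/H[p Drp pz]|_] := boolP (z \in l); [exists p|exists (0, 0)].
have [rp Hrp] := repr _ _ lp1; have [rq Hrq] := repr _ _ lq1.
pose sp := sort (fun x y => before_eq y x) lp; pose sq := sort before_eq lq.
have spP z : (z \in sp) = (z \in lp) by rewrite mem_sort.
have sqP z : (z \in sq) = (z \in lq) by rewrite mem_sort.
pose p_ z := if z \in lp then rp z else (0, 0); pose q_ z := if z \in lq then rq z else (0, 0).
pose E z := if z \in lp then \bigcup_(y in [set` sq]) [set w | (al%:E < d w (rp z, rq y))%E] else set0.
pose G z := if z \in lp then [set w | ((- e)%:E < d w (gm (rp z), rp z))%E] else set0.
pose E' y := if y \in lq then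
  \bigcup_(z in [set` sp]) [set w | ((al - e)%:E < d w (gm (rp z), rq y))%E] else set0.
pose G' y := if y \in lq then [set w | ((- e)%:E < d w (rq y, gp (rq y)))%E] else set0.
have s0 S : <<s coordinates X S >> (set0 : set T).
  exact: (@measurable0 _ (g_sigma_algebraType (coordinates X S))).
(* Connections that leave [z] use the sites of [S1 z], connections that arrive at [z] those of
   [S2 z]; the latter include [z], because the weight of the end point counts. *)
pose S1 z : set (int * int) := [set x | before z x].
pose S2 z : set (int * int) := [set x | before_eq x z].
have S12 z : S1 z `&` S2 z = set0.
  by rewrite -subset0 => x [/= h1]; rewrite /S2/= not_both.
have sE z z' : before_eq z z' -> <<s coordinates X (S1 z) >> (E z').
  move=> zz'; rewrite /E; case: ifP => [z'p|_]; last exact: s0.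
  apply: union_sites => y; apply: event_sites => x; rewrite (Hrp z' z'p).2 => h1 _.
  by case/orP: zz' => [/eqP ->//|zz']; exact: before_trans zz' h1.
have sG z : <<s coordinates X (S2 z) >> (G z).
  rewrite /G; case: ifP => [zp|_]; last exact: s0.
  by apply: event_sites => x _; rewrite (Hrp z zp).2.
have sE' y y' : before_eq y' y -> <<s coordinates X (S2 y) >> (E' y').
  move=> yy'; rewrite /E'; case: ifP => [y'q|_]; last exact: s0.
  apply: union_sites => z; apply: event_sites => x _; rewrite (Hrq y' y'q).2 => h1.
  exact: before_eq_trans h1 yy'.
have sG' y : <<s coordinates X (S1 y) >> (G' y).
  rewrite /G'; case: ifP => [yq|_]; last exact: s0.
  by apply: event_sites => x h1 _; move: h1; rewrite (Hrq y yq).2.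
have refl z : before_eq z z by rewrite /before_eq eqxx.
have mE z : measurable (E z) := measurable_coordinates mX (sE z z (refl z)).
have mG z : measurable (G z) := measurable_coordinates mX (sG z).
have mE' z : measurable (E' z) := measurable_coordinates mX (sE' z z (refl z)).
have mG' z : measurable (G' z) := measurable_coordinates mX (sG' z).
have mU (l : seq (int * int)) (F : int * int -> set T) : (forall i, measurable (F i)) ->
    measurable (\bigcup_(i in [set` l]) F i).
  by move=> mF; apply: fin_bigcup_measurable => //; exact: finite_seq.
have st1 : pr (\bigcup_(z in [set` sp]) E z) <= pr (\bigcup_(z in [set` sp]) (E z `&` G z)) + eta.
  apply: (@ottaviani _ _ T P (int * int)%type X _ (fun x y => before_eq y x) S1 S2) => //.
  - by move=> z; exact: sE.
  - move=> z; rewrite spP => zp; rewrite /G zp; apply: Pm; exact: (Hrp z zp).1.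
  - rewrite -sorted_pairwise; last by move=> y x z h1 h2; exact: before_eq_trans h2 h1.
    by apply: sort_sorted => x y; exact: before_eq_total.
have st2 : pr (\bigcup_(z in [set` sq]) E' z) <= pr (\bigcup_(z in [set` sq]) (E' z `&` G' z)) + eta.
  apply: (@ottaviani _ _ T P (int * int)%type X _ before_eq S2 S1) => //.
  - by move=> z; rewrite setIC.
  - by move=> z; exact: sE'.
  - move=> z; rewrite sqP => zq; rewrite /G' zq; apply: Pp; exact: (Hrq z zq).1.
  - rewrite -sorted_pairwise; last exact: before_eq_trans.
    exact: sort_sorted.
have i1 : \bigcup_(u in [set u | Dp u.1 /\ Dq u.2]) [set w | (al%:E < d w u)%E] =
    \bigcup_(z in [set` sp]) E z.
  apply/seteqP; split => [w [[p q] [/= Dpp Dqq] hw]|w [z /=]].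
    have pp := lp2 p Dpp; have qq := lq2 q Dqq.
    exists (pt p); first by rewrite /= spP.
    rewrite /E pp; exists (pt q); first by rewrite /= sqP.
    rewrite /= (@rescaled_lattice _ m a b c h _ _ (p, q))//=.
      by rewrite (Hrp _ pp).2.
    by rewrite (Hrq _ qq).2.
  rewrite spP /E => zp; rewrite zp => -[y /=]; rewrite sqP => yq hw.
  by exists (rp z, rq y) => //=; split; [exact: (Hrp z zp).1|exact: (Hrq y yq).1].
have i2 : \bigcup_(z in [set` sp]) (E z `&` G z) `<=` \bigcup_(y in [set` sq]) E' y.
  move=> w [z /=]; rewrite spP /E /G => zp; rewrite zp => -[[y /= ysq hw] Gw].
  exists y => //; rewrite /E'; move: (ysq); rewrite sqP => ->; exists z; first by rewrite /= spP.
  apply: lt_le_trans (rescaled_triangle a b c h m0 (X w) _ (rp z) _).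
  by rewrite addrC; exact: add_gt.
have i3 : \bigcup_(y in [set` sq]) (E' y `&` G' y) `<=`
    [set w | exists2 u, u \in D & ((al - 2 * e)%:E < d w u)%E].
  move=> w [y /=]; rewrite sqP /E' /G' => yq; rewrite yq => -[[z /=]]; rewrite spP => zp hw Gw.
  exists (gm (rp z), gp (rq y)).
    apply: (HD _ _ w (Hrp z zp).1 (Hrq y yq).1); exact: le_lt_trans (leNye _) hw.
  apply: lt_le_trans (rescaled_triangle a b c h m0 (X w) _ (rq y) _).
  by rewrite (_ : al - 2 * e = (al - e) + (- e)); [exact: add_gt|ring].
have mF : measurable [set w | exists2 u, u \in D & ((al - 2 * e)%:E < d w u)%E].
  rewrite (_ : mkset _ = \bigcup_(u in [set` D]) [set w | ((al - 2 * e)%:E < d w u)%E]).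
    by apply: fin_bigcup_measurable => [|[p q] _]; [exact: finite_seq|exact: mevent].
  by apply/seteqP; split => w [u uD hw]; exists u.
have k1 := pr_le P (mU sp _ (fun z => measurableI _ _ (mE z) (mG z))) (mU sq _ mE') i2.
have k2 := pr_le P (mU sq _ (fun z => measurableI _ _ (mE' z) (mG' z))) mF i3.
by rewrite i1; lra.
Qed.

End boxes.

(** * Suprema over balls and maxima over grids *)

Section tails_to_means.
Context {R : realType} d (T : measurableType d) (P : probability T R).

(** The tails at all levels are summed with the staircase, after an affine map of [[-1, 1]] onto
    [[0, 1]]; undoing this map doubles [zeta]. *)
Lemma ev_tail_le (A B : T -> R) (delta zeta : R) : bdd_meas A -> bdd_meas B ->
  (forall w, -1 <= A w <= 1) -> (forall w, -1 <= B w) -> 0 <= delta -> 0 <= zeta ->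
  (forall a, -1 < a < 1 ->
     fine (P [set w | a < A w]) <= fine (P [set w | a - delta < B w]) + zeta) ->
  ev P A <= ev P B + delta + 2 * zeta.
Proof.
move=> bA bB A1 B1 d0 z0 H.
pose x w := 2^-1 * (A w + 1); pose y w := clamp 0 1 (2^-1 * (B w + delta + 1)).
have bx : bdd_meas x by apply: bdd_measZ; apply: bdd_measD => //; exact: bdd_meas_cst.
have b2 : bdd_meas (fun w => 2^-1 * (B w + delta + 1)).
  by apply: bdd_measZ; apply: bdd_measD; [apply: bdd_measD => //|]; exact: bdd_meas_cst.
have by_ : bdd_meas y.
  split; last by exists 1 => w; have /andP[h1 h2] := clamp_bounds (2^-1 * (B w + delta + 1)) (@ler01 R);
    rewrite ger0_norm.
  have mc : measurable_fun setT (clamp 0 1 : R -> R).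
    by apply: (@lip_measurable _ _ 1) => // u v; rewrite mul1r; exact: clamp_lip.
  exact: (measurableT_comp mc b2.1).
have x01 w : 0 <= x w <= 1 by have := A1 w; rewrite /x; lra.
have y01 w : 0 <= y w <= 1 by exact: clamp_bounds.
have yB w : y w <= 2^-1 * (B w + delta + 1).
  by have := B1 w; rewrite /y; case_clamp; lra.
have evx : ev P x = 2^-1 * (ev P A + 1).
  by rewrite evZ ?evD ?ev_cst//; [exact: bdd_meas_cst|apply: bdd_measD => //; exact: bdd_meas_cst].
have evy : ev P y <= 2^-1 * (ev P B + delta + 1).
  apply: le_trans (ev_le P by_ b2 yB) _.
  have c1 k : bdd_meas (fun _ : T => k : R) by exact: bdd_meas_cst.
  have b3 := bdd_measD bB (c1 delta); have b4 := bdd_measD b3 (c1 1).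
  by rewrite (evZ P _ b4) (evD P b3 (c1 1)) (evD P bB (c1 delta)) !ev_cst.
have setE (g : T -> R) k : (fun w => (k < g w)%R%:R : R) = \1_[set w | k < g w].
  apply/funext => w; rewrite indicE; congr (nat_of_bool _)%:R.
  by apply/idP/idP => [h|/set_mem//]; exact: mem_set.
have mset (g : T -> R) k : measurable_fun setT g -> measurable [set w | k < g w].
  move=> mg; rewrite (_ : mkset _ = g @^-1` `]k, +oo[); first by rewrite -[_ @^-1` _]setTI; exact: mg.
  by apply/seteqP; split => w; rewrite /= in_itv/= andbT.
suff H' (N : nat) : ev P x <= ev P y + zeta + 2 * N.+1%:R^-1.
  have : ev P x <= ev P y + zeta.
    apply/ler_addgt0Pr => e e0; pose N := Num.trunc (2 / e).
    apply: le_trans (H' N) _; rewrite lerD2l ler_pdivrMr// mulrC -ler_pdivrMr//.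
    exact/ltW/truncnS_gt.
  by rewrite evx; lra.
have N0 : 0 < N.+1%:R :> R by rewrite ltr0n.
pose lev (g : T -> R) (k : nat) w : R := (k%:R / N.+1%:R < g w)%R%:R.
have blev g k : measurable_fun setT g -> bdd_meas (lev g k) by move=> mg; exact: bdd_meas_level.
(* Level 0 corresponds to [a = -1], which [H] leaves out; it is bounded by 1 and costs one share
   [N.+1%:R^-1] of the average. *)
have levle (k : nat) : ev P (lev x k) <= ev P (lev y k) + zeta + (k == 0%N)%:R.
  have [->|k0] := eqVneq k 0%N.
    apply: (@le_trans _ _ (ev P (fun=> 1))).
      apply: ev_le => [||w]; [exact: blev bx.1|exact: bdd_meas_cst|by rewrite /lev; case: ltP].
    rewrite ev_cst; have : 0 <= ev P (lev y 0%N) by apply: ev_ge0 => w; rewrite /lev.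
    by rewrite /=; lra.
  rewrite addr0 /lev !setE !ev_indic; [|exact: mset by_.1|exact: mset bx.1].
  pose q : R := k%:R / N.+1%:R; pose a := 2 * q - 1.
  have q0 : 0 < q by rewrite divr_gt0// ltr0n lt0n.
  have [q1|q1] := leP 1 q.
    rewrite (_ : mkset _ = set0) ?measure0 ?addr_ge0 ?fine_ge0//.
    by rewrite -subset0 => w /=; have := x01 w; rewrite -/q; lra.
  have := H a; rewrite (_ : [set w | a < A w] = [set w | q < x w]); last first.
    by apply/seteqP; split => w; rewrite /= /a /x; lra.
  move=> /(_ ltac:(rewrite /a; apply/andP; split; lra)) h; apply: le_trans h _; rewrite lerD2r.
  apply: pr_le; [exact: mset bB.1|exact: mset by_.1|move=> w].
  by rewrite /= -/q /a /y; case_clamp; lra.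
have sx w := (andP (staircase (ltn0Sn N) (x01 w))).1.
have sy w := (andP (staircase (ltn0Sn N) (y01 w))).2.
have bs g : measurable_fun setT g -> bdd_meas (fun w => N.+1%:R^-1 * \sum_(k <- iota 0 N.+1) lev g k w).
  by move=> mg; apply: bdd_measZ; apply: bdd_meas_sum => k _; exact: blev.
have evs g : measurable_fun setT g -> ev P (fun w => N.+1%:R^-1 * \sum_(k <- iota 0 N.+1) lev g k w) =
    N.+1%:R^-1 * \sum_(k <- iota 0 N.+1) ev P (lev g k).
  move=> mg; rewrite evZ ?ev_sum//; last by apply: bdd_meas_sum => k _; exact: blev.
  by move=> k _; exact: blev.
have k1 : ev P x <= N.+1%:R^-1 * \sum_(k <- iota 0 N.+1) ev P (lev x k).
  by rewrite -(evs x bx.1); apply: ev_le => //; exact: bs bx.1.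
have k2 : N.+1%:R^-1 * \sum_(k <- iota 0 N.+1) ev P (lev y k) <= ev P y + N.+1%:R^-1.
  rewrite -(evs y by_.1) -[X in _ + X](ev_cst P) -evD//; last exact: bdd_meas_cst.
  by apply: ev_le => //; [exact: bs by_.1|apply: bdd_measD => //; exact: bdd_meas_cst].
have k3 : \sum_(k <- iota 0 N.+1) ev P (lev x k) <=
    \sum_(k <- iota 0 N.+1) ev P (lev y k) + N.+1%:R * zeta + 1.
  have cz : \sum_(k <- iota 0 N.+1) zeta = N.+1%:R * zeta.
    by rewrite big_const_seq count_predT size_iota iter_addr addr0 mulr_natl.
  have c1 : \sum_(k <- iota 0 N.+1) (k == 0%N)%:R = 1 :> R.
    rewrite -[iota 0 N.+1]/(0%N :: iota 1 N) big_cons big_seq big1 ?addr0// => k.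
    by rewrite mem_iota; case: k.
  by apply: le_trans (ler_sum _ (fun k _ => levle k)) _; rewrite !big_split cz c1.
have : N.+1%:R^-1 * \sum_(k <- iota 0 N.+1) ev P (lev x k) <=
    N.+1%:R^-1 * \sum_(k <- iota 0 N.+1) ev P (lev y k) + zeta + N.+1%:R^-1.
  apply: le_trans (ler_wpM2l _ k3) _; first by rewrite invr_ge0 ltW.
  by rewrite !mulrDr mulr1 mulKf// gt_eqF.
move=> hs; apply: (le_trans k1); apply: (le_trans hs); move: k2.
by set q := N.+1%:R^-1; set Z := q * _; move: (ev P y) => Y k2; lra.
Qed.

End tails_to_means.

Section grids.
Context {R : realType}.
Local Notation R2 := (R * R)%type.
Local Notation R4 := (R2 * R2)%type.

Definition mesh (k : nat) : R := k.+1%:R^-1.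

Definition grid_point (k : nat) (i j : int) : R2 := (mesh k * i%:~R, mesh k * j%:~R).

(** Indices up to [(k + 1)^2] times the mesh [1 / (k + 1)]: the grid becomes finer and fills larger
    boxes at once. *)
Definition grid (k : nat) : seq R4 :=
  let r := int_range (k.+1 * k.+1) in
  [seq u <- [seq (p, q) | p <- [seq grid_point k i j | i <- r, j <- r],
     q <- [seq grid_point k i j | i <- r, j <- r]] | u.1.2 < u.2.2].

Lemma mesh_gt0 k : 0 < mesh k. Proof. by rewrite invr_gt0. Qed.

Lemma mesh_small (e : R) : 0 < e -> \forall k \near \oo, mesh k < e.
Proof.
move=> e0; exists (Num.trunc e^-1) => // k /= ek.
rewrite /mesh -[ltRHS]invrK ltf_pV2 ?posrE ?invr_gt0//.
by apply: lt_le_trans (truncnS_gt _) _; rewrite ler_nat ltnS.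
Qed.

Lemma grid_mem k i1 j1 i2 j2 : let r := int_range (k.+1 * k.+1) in
  i1 \in r -> j1 \in r -> i2 \in r -> j2 \in r -> (grid_point k i1 j1).2 < (grid_point k i2 j2).2 ->
  (grid_point k i1 j1, grid_point k i2 j2) \in grid k.
Proof.
move=> r h1 h2 h3 h4 h; rewrite mem_filter; apply/andP; split; first exact: h.
by apply: allpairs_f; apply: allpairs_f.
Qed.

Lemma mesh_floor k x : mesh k * (Num.floor (x / mesh k))%:~R <= x <
  mesh k * (Num.floor (x / mesh k))%:~R + mesh k.
Proof.
have m0 := mesh_gt0 k; have h1 := floor_le (x / mesh k); have h2 := floorD1_gt (x / mesh k).
have xE : x = mesh k * (x / mesh k) by rewrite mulrC divfK// gt_eqF.
apply/andP; split; first by rewrite [leRHS]xE ler_pM2l.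
rewrite [ltLHS]xE -[X in _ + X]mulr1 -mulrDr ltr_pM2l//.
by rewrite intrD mulr1z in h2.
Qed.

Lemma floor_mesh_range (k : nat) (x B : R) (l : int) : `|x| <= B -> `|l| <= 2 -> B + 3 <= k.+1%:R ->
  Num.floor (x / mesh k) + l \in int_range (k.+1 * k.+1).
Proof.
move=> xB l2 Bk; rewrite int_rangeP; have h1 := floor_le (x / mesh k); have h2 := floorD1_gt (x / mesh k).
have xk : `|x / mesh k| <= B * k.+1%:R by rewrite /mesh invrK normrM [X in _ * X]ger0_norm// ler_wpM2r.
have l2' : `|l%:~R : R| <= 2 by rewrite -intr_norm (_ : 2 = 2%:~R) ?ler_int.
have k1 : 1 <= k.+1%:R :> R by rewrite ler1n.
have B2 : B * k.+1%:R + 3 <= k.+1%:R * k.+1%:R by nra.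
rewrite intrD mulr1z in h2; move: xk l2'; rewrite !ler_norml => /andP[h3 h4] /andP[h5 h6].
by rewrite -!(ler_int R) rmorphN intrD /= -!pmulrn natrM; apply/andP; split; lra.
Qed.

Lemma grid_approx (u : R4) (B : R) : R4up u ->
  `|u.1.1| <= B -> `|u.1.2| <= B -> `|u.2.1| <= B -> `|u.2.2| <= B ->
  exists2 v : nat -> R4, v k @[k --> \oo] --> u & \forall k \near \oo, v k \in grid k.
Proof.
move=> uu b1 b2 b3 b4; pose f k x := Num.floor (x / mesh k).
pose v k : R4 := (grid_point k (f k u.1.1) (f k u.1.2), grid_point k (f k u.2.1) (f k u.2.2)).
have cf x e : 0 < e -> \forall k \near \oo, ball x e (mesh k * (f k x)%:~R).
  move=> e0; have := mesh_small e0; apply: filterS => k ke; have := mesh_floor k x.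
  by rewrite -/(f k x) -ball_normE /ball_/= ltr_norml => /andP[h1 h2]; apply/andP; split; lra.
have cv : v k @[k --> \oo] --> u.
  apply/cvg_ballP => e e0; near=> k; split; split => /=; near: k; exact: cf.
exists v => //.
have e0 : 0 < u.2.2 - u.1.2 by rewrite subr_gt0.
near=> k.
have Bk : B + 3 <= k.+1%:R.
  near: k; exists (Num.trunc (B + 3)) => // k /= kB.
  by apply: ltW; apply: lt_le_trans (truncnS_gt _) _; rewrite ler_nat ltnS.
have mk : mesh k < u.2.2 - u.1.2 by near: k; exact: mesh_small.
have r x : `|x| <= B -> f k x \in int_range (k.+1 * k.+1).
  by move=> xB; have := @floor_mesh_range k x B 0 xB isT Bk; rewrite addr0.
apply: grid_mem; rewrite ?r//.
have /andP[h1 h2] := mesh_floor k u.1.2; have /andP[h3 h4] := mesh_floor k u.2.2.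
by rewrite /= /f; lra.
Unshelve. all: by end_near. Qed.

Definition grid_max (k : nat) (r : R4) (s : R) (f : R4 -> \bar R) : \bar R :=
  \big[maxe/-oo%E]_(u <- [seq u <- grid k | `[< ball r s u >]]) f u.

Definition ball_sup (r : R4) (s : R) (f : R4 -> \bar R) : \bar R := ereal_sup (f @` ball r s).

Lemma grid_max_le k r s f : (grid_max k r s f <= ball_sup r s f)%E.
Proof.
rewrite /grid_max big_seq; elim/big_ind : _ => [|x y xu yu|u].
- exact: leNye.
- by rewrite ge_max xu yu.
by rewrite mem_filter => /andP[/asboolP bu _]; apply: ereal_sup_ubound; exists u.
Qed.

Lemma grid_max_ge k r s f u : u \in grid k -> ball r s u -> (f u <= grid_max k r s f)%E.
Proof.
move=> uk bu; rewrite /grid_max (big_rem u)/= ?le_max ?lexx// mem_filter uk andbT.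
exact/asboolP.
Qed.

Lemma ball_sup_ge r s f u : ball r s u -> (f u <= ball_sup r s f)%E.
Proof. by move=> bu; apply: ereal_sup_ubound; exists u. Qed.

Lemma ball_sup_attained r s (f : R4 -> \bar R) (e : R) : 0 < e ->
  -1 < contract (ball_sup r s f) - e ->
  exists2 u, ball r s u & contract (ball_sup r s f) - e < contract (f u).
Proof.
move=> e0 h; apply: contrapT => H; set y := _ - e in h.
have y1 : y < 1 by have := contract_le_1 (ball_sup r s f); rewrite /y; lra.
have yE : contract (expand y) = y by rewrite expandK// inE/= ler_norml !ltW.
suff : contract (ball_sup r s f) <= y by rewrite /y; lra.
rewrite -yE le_contract; apply: ge_ereal_sup => _ [u bu <-].
by rewrite -le_contract yE leNgt; apply/negP => hu; apply: H; exists u.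
Qed.

Lemma grid_max_lip k r s (D : seq R4) : (forall u, u \in grid k -> ball r s u -> u \in D) ->
  contract_lip D (fun f => contract (grid_max k r s f)).
Proof.
move=> sub; exists 1 => // f g e e0 fg; rewrite mul1r /grid_max !contract_bigmax.
apply: bigmaxr_dist => // u; rewrite mem_filter => /andP[/asboolP bu uk]; apply: fg; exact: sub.
Qed.

End grids.

Section landscape_sup.
Context {R : realType} (dL : measure_display) (OmegaL : measurableType dL)
  (PL : probability OmegaL R) (L : OmegaL -> (R * R) * (R * R) -> \bar R).
Hypothesis HL : directed_landscape PL L.
Local Notation R4 := ((R * R) * (R * R))%type.
Local Notation C := (@contract R).

(** Off the diagonal [L] is above -oo only on [R4up], where it is continuous. A point of the ball
    that almost reaches the supremum can therefore be approached by grid points. *)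
Lemma landscape_grid_max (r : R4) (s : R) w : 0 < s -> ball r s `<=` @R4o R ->
  C (grid_max k r s (L w)) @[k --> \oo] --> C (ball_sup r s (L w)).
Proof.
move=> s0 sub; apply/cvgrPdist_le => e e0.
have lek k : C (grid_max k r s (L w)) <= C (ball_sup r s (L w)) by rewrite le_contract grid_max_le.
have e2 : 0 < e / 2 by rewrite divr_gt0.
have [small|big] := leP (C (ball_sup r s (L w)) - e / 2) (-1).
  apply: nearW => k; rewrite ger0_norm ?subr_ge0//.
  by have := contract_ge_N1 (grid_max k r s (L w)); lra.
have [u bu hu] := ball_sup_attained e2 big.
have [_ cL offL _ _] := HL.
have uu : R4up u.
  apply: contrapT => nu; have := offL w u nu; rewrite ifF; last by apply/eqP; exact: sub bu.
  by move=> E; move: hu; rewrite E /=; lra.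
have [cu _] := cL w u uu.
have [||||v cv vk] := @grid_approx R u (Num.max (Num.max `|u.1.1| `|u.1.2|) (Num.max `|u.2.1| `|u.2.2|)) uu;
  rewrite ?le_max ?lexx ?orbT//.
have : C (L w (v k)) @[k --> \oo] --> C (L w u).
  by apply: continuous_cvg; [exact: continuous_contract|exact: continuous_cvg cu cv].
move=> /cvgrPdist_le /(_ _ e2) h.
have bv : \forall k \near \oo, ball r s (v k).
  by have := cv _ (open_nbhs_nbhs (conj (ball_open r s) bu)).
near=> k; rewrite ger0_norm ?subr_ge0//.
have h1 : `|C (L w u) - C (L w (v k))| <= e / 2 by near: k.
have h2 : (L w (v k) <= grid_max k r s (L w))%E by apply: grid_max_ge; near: k.
by move: h1 h2; rewrite -le_contract ler_norml => /andP[_ h1] h2; lra.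
Unshelve. all: by end_near. Qed.

End landscape_sup.

(** * Rounding to the grid and short connections *)

Section rounding.
Context {R : realType}.
Local Notation R2 := (R * R)%type.
Local Notation R4 := (R2 * R2)%type.
Implicit Types (p q : R2) (u v : R4).

(** The offset -1 here and the offset 2 in [round_up] move the time by between one and two meshes,
    so that connections to the rounded points have durations bounded away from 0. *)
Definition round_down (k : nat) p : R2 :=
  grid_point k (Num.floor (p.1 / mesh k)) (Num.floor (p.2 / mesh k) + -1).

Definition round_up (k : nat) p : R2 :=
  grid_point k (Num.floor (p.1 / mesh k)) (Num.floor (p.2 / mesh k) + 2).

Lemma round_down_bounds k p : let q := round_down k p in
  q.1 <= p.1 < q.1 + mesh k /\ q.2 + mesh k <= p.2 < q.2 + 2 * mesh k.
Proof.
have /andP[f1 f2] := mesh_floor k p.1; have /andP[f3 f4] := mesh_floor k p.2.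
rewrite /round_down /grid_point /= intrD mulrDr mulrN1; split; first by rewrite f1 f2.
by apply/andP; split; lra.
Qed.

Lemma round_up_bounds k p : let q := round_up k p in
  q.1 <= p.1 < q.1 + mesh k /\ q.2 - 2 * mesh k <= p.2 < q.2 - mesh k.
Proof.
have /andP[f1 f2] := mesh_floor k p.1; have /andP[f3 f4] := mesh_floor k p.2.
rewrite /round_up /grid_point /= intrD mulrDr [mesh k * 2]mulrC; split; first by rewrite f1 f2.
by apply/andP; split; lra.
Qed.

Definition coord_box (B : R) : set R4 := (`[- B, B] `*` `[- B, B]) `*` (`[- B, B] `*` `[- B, B]).

(** For fixed [rho > 0] this is a compact subset of [R4up], so [mobile_compact] applies to it. *)
Definition short (B rho : R) : set R4 := [set u | [/\ coord_box B u,
  rho <= u.2.2 - u.1.2 <= 2 * rho & `|u.2.1 - u.1.1| <= rho]].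

Lemma short_down (A : R) k p : `|p.1| <= A -> `|p.2| <= A -> mesh k < 1 :> R ->
  short (A + 3) (mesh k) (round_down k p, p).
Proof.
have [/andP[h1 h2] /andP[h3 h4]] := round_down_bounds k p; have := mesh_gt0 (R := R) k.
move: (round_down k p) h1 h2 h3 h4 => [q1 q2]; case: p => [p1 p2]; move: (mesh k) => rho.
rewrite /short /coord_box /= !in_itv/= !ler_norml.
move=> h1 h2 h3 h4 h5 /andP[k1 k2] /andP[k3 k4] h6.
by split; [split; split|..]; apply/andP; split; lra.
Qed.

Lemma short_up (A : R) k p : `|p.1| <= A -> `|p.2| <= A -> mesh k < 1 :> R ->
  short (A + 3) (mesh k) (p, round_up k p).
Proof.
have [/andP[h1 h2] /andP[h3 h4]] := round_up_bounds k p; have := mesh_gt0 (R := R) k.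
move: (round_up k p) h1 h2 h3 h4 => [q1 q2]; case: p => [p1 p2]; move: (mesh k) => rho.
rewrite /short /coord_box /= !in_itv/= !ler_norml.
move=> h1 h2 h3 h4 h5 /andP[k1 k2] /andP[k3 k4] h6.
by split; [split; split|..]; apply/andP; split; lra.
Qed.

Lemma short_R4up B rho : 0 < rho -> short B rho `<=` @R4up R.
Proof. by move=> r0 u [_ /andP[h1 _] _]; rewrite /R4up/=; lra. Qed.

Lemma ball_coord (p0 p : R2) (s : R) : ball p0 s p ->
  `|p.1| <= `|p0.1| + s /\ `|p.2| <= `|p0.2| + s.
Proof.
move=> [b1 b2]; move: b1 b2; rewrite -!ball_normE /ball_/= => b1 b2.
have j1 := ler_normB p0.1 (p0.1 - p.1); have j2 := ler_normB p0.2 (p0.2 - p.2).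
by rewrite !subKr in j1 j2; split; lra.
Qed.

Lemma grid_rounded k (r : R4) (s s' A : R) p p' : ball r.1 s p -> ball r.2 s p' ->
  `|p.1| <= A -> `|p.2| <= A -> `|p'.1| <= A -> `|p'.2| <= A -> A + 3 <= k.+1%:R ->
  mesh k < (s' - s) / 2 -> (round_down k p).2 < (round_up k p').2 ->
  (round_down k p, round_up k p') \in [seq u <- grid k | `[< ball r s' u >]].
Proof.
move=> bp bp' k1 k2 k3 k4 Ak ks late; rewrite mem_filter; apply/andP; split.
  have [/andP[f1 f2] /andP[f3 f4]] := round_down_bounds k p.
  have [/andP[f5 f6] /andP[f7 f8]] := round_up_bounds k p'.
  have m0 := mesh_gt0 (R := R) k.
  have bb (x y e : R) : ball x e y -> - e < x - y /\ x - y < e.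
    by rewrite -ball_normE /ball_/= ltr_norml => /andP.
  have bb' (x y e : R) : - e < x - y -> x - y < e -> ball x e y.
    by move=> h1 h2; rewrite -ball_normE /ball_/= ltr_norml h1.
  apply/asboolP; case: bp => /bb[b1 b1'] /bb[b2 b2']; case: bp' => /bb[b3 b3'] /bb[b4 b4'].
  move: (round_down k p) (round_up k p') (mesh k) ks f1 f2 f3 f4 f5 f6 f7 f8 m0 {late} => q q' rho.
  move=> ks f1 f2 f3 f4 f5 f6 f7 f8 m0; split; split => /=; apply: bb'; lra.
apply: grid_mem => //.
- by have := @floor_mesh_range R k p.1 A 0 k1 isT Ak; rewrite addr0.
- exact: (@floor_mesh_range R k p.2 A (-1) k2 isT Ak).
- by have := @floor_mesh_range R k p'.1 A 0 k3 isT Ak; rewrite addr0.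
- exact: (@floor_mesh_range R k p'.2 A 2 k4 isT Ak).
Qed.

Lemma compact_short B rho : compact (short B rho).
Proof.
have cb : compact (coord_box B).
  by apply: compact_setX; apply: compact_setX; exact: segment_compact.
have dc (f : R4 -> R) : (forall u v e, ball u e v -> `|f u - f v| < 2 * e) -> continuous f.
  move=> hf u; apply/cvgrPdist_lt => e e0; have e2 : 0 < e / 2 by rewrite divr_gt0.
  by apply: filterS (nbhsx_ballx u _ e2) => v /hf; rewrite mulrC divfK.
have c1 : continuous (fun u : R4 => u.2.2 - u.1.2).
  apply: dc => u v e [[b1 b2] [b3 b4]]; move: b2 b4; rewrite -!ball_normE /ball_/= !ltr_norml.
  by move=> /andP[? ?] /andP[? ?]; apply/andP; split; lra.
have c2 : continuous (fun u : R4 => u.2.1 - u.1.1).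
  apply: dc => u v e [[b1 b2] [b3 b4]]; move: b1 b3; rewrite -!ball_normE /ball_/= !ltr_norml.
  by move=> /andP[? ?] /andP[? ?]; apply/andP; split; lra.
have cl1 : closed ((fun u : R4 => u.2.2 - u.1.2) @^-1` `[rho, 2 * rho]).
  by apply: closed_comp => [u _|]; [exact: c1|exact: itv_closed].
have cl2 : closed ((fun u : R4 => u.2.1 - u.1.1) @^-1` `[- rho, rho]).
  by apply: closed_comp => [u _|]; [exact: c2|exact: itv_closed].
rewrite (_ : short B rho = coord_box B `&` ((fun u : R4 => u.2.2 - u.1.2) @^-1` `[rho, 2 * rho] `&`
    (fun u : R4 => u.2.1 - u.1.1) @^-1` `[- rho, rho])).
  by apply: compact_closedI => //; exact: closedI.
apply/seteqP; split => u; rewrite /short/= !in_itv/= -ler_norml; first by case=> h1 h2 h3; split.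
by case=> h1 [h2 h3]; split.
Qed.

End rounding.

(** For [rho < 1] a duration of at least [rho] gives a scale [l] with [rho <= l^2], so a
    displacement up to [rho] costs at most [l] in the parabola. The total loss [l (M + 1)] is small
    because [l] is at most the cube root of [2 rho]. *)
Lemma landscape_short (R : realType) (dL : measure_display) (OmegaL : measurableType dL)
    (PL : probability OmegaL R) (L : OmegaL -> (R * R) * (R * R) -> \bar R) (e q : R) :
  directed_landscape PL L -> 0 < e -> 0 < q -> exists2 z : R, 0 < z &
  forall B rho u, 0 < rho -> rho < 1 -> rho < z -> short B rho u ->
    1 - e <= ev PL (fun w => ramp (- q) (- (q / 2)) (L w u)).
Proof.
move=> HL e0 q0; have [M M0 HM] := landscape_ramp HL e0.
have M1 : 0 < M + 1 by exact: addr_gt0.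
pose z := (q / 2) / (M + 1); have z0 : 0 < z by rewrite !divr_gt0.
exists (z ^+ 3 / 2) => [|B rho [[x t] [y t']] r0 r1 rz [_ /= /andP[h1 h2] h3]].
  by rewrite divr_gt0// exprn_gt0.
have qq : - q < - (q / 2) by clear -q0; lra.
have tau0 : 0 < t' - t by exact: lt_le_trans h1.
have tt : t < t' by rewrite -subr_gt0.
have tz : t' - t <= z ^+ 3 by clear -h2 rz; lra.
pose l := (t' - t) `^ 3^-1; pose v := (y - x) / l ^+ 2.
have l0 : 0 < l by exact: powR_gt0.
have l3 : l ^+ 3 = t' - t by rewrite -powR_mulrn ?ltW// -powRrM mulVf// powRr1// ltW.
have lz : l <= z.
  have z3 : z = (z ^+ 3) `^ 3^-1 by rewrite -powR_mulrn ?ltW// -powRrM divff// powRr1// ltW.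
  rewrite [leRHS]z3; apply: ge0_ler_powR => //; rewrite ?nnegrE ?invr_ge0 ?exprn_ge0//; exact: ltW.
have l2 : rho <= l ^+ 2.
  have [l1|l1] := leP l 1; last by exact: le_trans (ltW r1) (exprn_ege1 2 (ltW l1)).
  by rewrite (le_trans h1)// -l3 exprS ler_piMl// exprn_ge0// ltW.
have v1 : v ^+ 2 <= 1.
  have : `|v| <= 1.
    rewrite /v normrM normfV [X in _ / X]ger0_norm; last by rewrite exprn_ge0// ltW.
    by rewrite ler_pdivrMr ?exprn_gt0// mul1r (le_trans h3).
  by rewrite -[v ^+ 2]real_normK ?num_real// => h4; rewrite expr_le1.
have [h4 _] := HM x t y t' l v _ _ tt erefl erefl qq.
apply: h4; rewrite lerN2; apply: (@le_trans _ _ (z * (M + 1))); last by rewrite /z divfK// gt_eqF.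
apply: ler_pM => //; [exact: ltW|by rewrite addr_ge0 ?sqr_ge0// ltW|by rewrite lerD2l].
Qed.

(** * Domination of ball suprema by grid maxima *)

Section suprema.
Context {R : realType} (dO : nat -> measure_display) (Omega : forall n, measurableType (dO n))
  (P : forall n, probability (Omega n) R) (X : forall n, Omega n -> int * int -> R)
  (m a b c : nat -> R) (h : nat -> int * int -> R)
  (dL : measure_display) (OmegaL : measurableType dL) (PL : probability OmegaL R)
  (L : OmegaL -> (R * R) * (R * R) -> \bar R).
Hypothesis X_iid : forall n, iid_array (P n) (@X n).
Hypothesis m_gt0 : forall n, 0 < m n.
Hypothesis HL : directed_landscape PL L.
Local Notation R4 := ((R * R) * (R * R))%type.
Local Notation d := (fun n (w : Omega n) => rescaled_lpp (X w) (m n) (a n) (b n) (c n) (h n)).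
Local Notation pt n := (lattice_point (a n) (b n) (c n)).
Local Notation C := (@contract R).
Hypothesis mobile : forall (u_ : nat -> R4) (u : R4),
  R4up u -> u_ n @[n --> \oo] --> u ->
  cvg_in_distribution [set F : \bar R -> R | continuous F]
    P (fun n w => d n w (u_ n)) PL (fun w => L w u).
Hypothesis sheet : forall s t : R, s < t ->
  cvg_in_distribution (@graph_continuous R)
    P (fun n w => time_slice s t (d n w)) PL (fun w => time_slice s t (L w)).

Let mX n : random_function (@X n). Proof. by case: (X_iid n). Qed.

Lemma grid_conv k : conv_on P PL d L (grid k).
Proof.
pose M := (k.+1 * k.+1)%N; pose t (i : nat) : R := mesh k * (i%:R - M%:R).
have gap i : t i + mesh k <= t i.+1 by rewrite /t -natr1; lra.
apply: (span_conv X_iid m_gt0 HL mobile sheet (K := (M + M)%N) (l := (M + M)%N) (mesh_gt0 k) gap).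
move=> u; rewrite mem_filter => /andP[ut /allpairsP[[p q] [Hp Hq uE]]].
have [[i1 j1] [_ + pE]] := allpairsP (Hp : p \in [seq grid_point k i j | i <- int_range M, j <- int_range M]).
have [[i2 j2] [_ + qE]] := allpairsP (Hq : q \in [seq grid_point k i j | i <- int_range M, j <- int_range M]).
rewrite /= in pE qE uE *; rewrite !int_rangeP !ler_norml => /andP[h1 h2] /andP[h3 h4].
have tE (j : int) : - M%:Z <= j -> t (absz (j + M%:Z)) = mesh k * j%:~R.
  move=> hj; rewrite /t; congr (_ * _).
  have : (absz (j + M%:Z))%:Z = j + M%:Z by lia.
  by move/(congr1 (fun z : int => z%:~R : R)); rewrite intrD -!pmulrn => ->; lra.
have jj : j1 < j2.
  by move: ut; rewrite uE pE qE /= ltr_pM2l ?mesh_gt0// ltr_int.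
exists (absz (j1 + M%:Z)), (absz (j2 + M%:Z)); rewrite uE pE qE /= !tE//.
by split => //; lia.
Qed.

(** [d n] takes one value per pair of lattice points, so the supremum runs over a countable set. *)
Lemma measurable_ball_sup n (r : R4) (s : R) :
  measurable_fun setT (fun w => ball_sup r s (d n w)).
Proof.
pose site := (int * int)%type; pose Q (j : site * site) := exists u, [/\ ball r s u, pt n u.1 = j.1 & pt n u.2 = j.2].
have [rep Hrep] : {rep : site * site -> R4 & forall j, Q j -> pt n (rep j).1 = j.1 /\ pt n (rep j).2 = j.2}.
  apply: (@choice _ _ (fun j u => Q j -> pt n u.1 = j.1 /\ pt n u.2 = j.2)) => j.
  by have [[u [_ h1 h2]]|nQ] := pselect (Q j); [exists u|exists r].
rewrite (_ : (fun _ => _) = (fun w => ereal_sup [set d n w (rep j) | j in Q])).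
  by apply: (measurable_countable_sup (f := fun j w => d n w (rep j))) => j _; exact: measurable_rescaled.
apply/funext => w; congr ereal_sup; apply/seteqP; split => [_ [u bu <-]|_ [j Qj <-]].
  have Qu : Q (pt n u.1, pt n u.2) by exists u.
  by have [h1 h2] := Hrep _ Qu; exists (pt n u.1, pt n u.2) => //; exact: rescaled_lattice.
have [u [bu h1 h2]] := Qj; have [h3 h4] := Hrep _ Qj.
by exists u => //; apply: rescaled_lattice; rewrite ?h3 ?h4.
Qed.

(** Start points are rounded backwards in time and end points forwards, which enlarges the ball. The
    short connections to the rounded points are good uniformly by [mobile_compact]; [box_tail] then
    compares the tails, and [ev_tail_le] turns tails into means. *)
Lemma lpp_ball_sup (r : R4) (s s' e : R) : 0 < s -> s < s' -> 0 < e ->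
  \forall k \near \oo, \forall n \near \oo,
    ev (P n) (fun w => C (ball_sup r s (d n w))) <= ev (P n) (fun w => C (grid_max k r s' (d n w))) + e.
Proof.
(* The total loss is [2 q + 4 eta], that is [3 e / 4]. *)
move=> s0 ss e0; pose q := e / 4; pose eta := e / 16.
have q0 : 0 < q by rewrite divr_gt0.
have eta0 : 0 < eta by rewrite divr_gt0.
have eta2 : 0 < eta / 2 by rewrite divr_gt0.
have s2 : 0 < (s' - s) / 2 by rewrite divr_gt0// subr_gt0.
have aux1 y : 1 - eta / 2 <= y -> 1 - y < eta by lra.
have aux2 y y' : 1 - y < eta -> y <= y' -> 1 - eta <= y' by lra.
have aux3 (y1 y2 y3 : R) : 1 <= y3 -> y1 <= y2 - y3 -> - y2 + 1 <= - y1 by lra.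
have aux4 (y1 y2 y3 y4 : R) : y2 - y4 < y3 -> y3 < y1 - y4 -> y2 < y1 by lra.
have aux5 (y y' : R) : y <= y' + 2 * q + 2 * (2 * eta) -> y <= y' + e by rewrite /q /eta; lra.
have [z z0 HL2] := landscape_short HL eta2 q0.
pose A0 := Num.max (Num.max `|r.1.1| `|r.1.2|) (Num.max `|r.2.1| `|r.2.2|) + s.
near=> k; pose rho : R := mesh k.
have rho0 : 0 < rho := mesh_gt0 k.
have rho1 : rho < 1 by rewrite /rho; near: k; exact: mesh_small.
have rhos : rho < (s' - s) / 2 by rewrite /rho; near: k; exact: mesh_small.
have rhoz : rho < z by rewrite /rho; near: k; exact: mesh_small.
have Bk : A0 + 3 <= k.+1%:R.
  near: k; exists (Num.trunc (A0 + 3)) => // k /= kB.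
  by apply: ltW; apply: lt_le_trans (truncnS_gt _) _; rewrite ler_nat ltnS.
have qq : - q < - (q / 2) by rewrite ltrN2 ltr_pdivrMr// ltr_pMr// ltr1n.
pose F (x : \bar R) : R := 1 - ramp (- q) (- (q / 2)) x.
have cF : continuous F.
  by move=> x; apply: cvgB; [exact: cvg_cst|exact: ramp_continuous].
have bF : exists M, forall x, `|F x| <= M.
  exists 1 => x; have /andP[r1 r2] := ramp_bounds (- q) (- (q / 2)) x.
  by rewrite /F ger0_norm ?subr_ge0// gerBl.
have mL u : measurable_fun setT (fun w => L w u) by have [h1 _ _ _ _] := HL; exact: h1.
have evF d' (T : measurableType d') (Q : probability T R) (x : T -> \bar R) : measurable_fun setT x ->
    ev Q (fun w => F (x w)) = 1 - ev Q (fun w => ramp (- q) (- (q / 2)) (x w)).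
  by move=> mx; rewrite /F (evB Q (bdd_meas_cst T 1) (bdd_meas_ramp qq mx)) ev_cst.
have up := short_R4up (B := A0 + 3) rho0.
have small u : short (A0 + 3) rho u -> ev PL (fun w => F (L w u)) < eta.
  move=> hu; have := HL2 _ _ _ rho0 rho1 rhoz hu; rewrite evF//.
  exact: aux1.
have unif := mobile_compact mobile cF bF (@compact_short R (A0 + 3) rho) up small.
have fast := speed_diverges m_gt0 HL mobile rho0.
near=> n.
have Hu u : short (A0 + 3) rho u -> ev (P n) (fun w => F (d n w u)) < eta by move: u; near: n.
have cn : 1 <= c n * rho by near: n.
have iX : independent (P n) (@measurable _ R) (fun i w => @X n w i) by have [] := X_iid n.
have md u : measurable_fun setT (fun w => d n w u) by exact: measurable_rescaled.
have mset al (x : Omega n -> \bar R) : measurable_fun setT x -> measurable [set w | (al%:E < x w)%E].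
  by move=> mx; rewrite -[X in measurable X]setTI; exact: emeasurable_fun_o_infty.
have prd u : short (A0 + 3) rho u -> 1 - eta <= fine (P n [set w | ((- q)%:E < d n w u)%E]).
  move=> /Hu; rewrite evF// -ev_indic; last exact: mset.
  have : ev (P n) (fun w => ramp (- q) (- (q / 2)) (d n w u)) <= ev (P n) (\1_[set w | ((- q)%:E < d n w u)%E]).
    apply: ev_le => // [||w]; [exact: bdd_meas_ramp|by apply: bdd_meas_indic; exact: mset|].
    rewrite indicE; have [wA|wA] := boolP (w \in _).
      by have /andP[] := ramp_bounds (- q) (- (q / 2)) (d n w u).
    by rewrite ramp0// leNgt; apply/negP => hw; move/negP: wA; apply; exact: mem_set.
  by move=> k1 k2; exact: aux2 k2 k1.
have bA1 p : ball r.1 s p -> `|p.1| <= A0 /\ `|p.2| <= A0.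
  move=> /ball_coord[h1 h2]; split; [apply: le_trans h1 _|apply: le_trans h2 _];
  by rewrite lerD2r !le_max lexx ?orbT.
have bA2 p : ball r.2 s p -> `|p.1| <= A0 /\ `|p.2| <= A0.
  move=> /ball_coord[h1 h2]; split; [apply: le_trans h1 _|apply: le_trans h2 _];
  by rewrite lerD2r !le_max lexx ?orbT.
pose D := [seq u <- grid k | `[< ball r s' u >]].
have HD p p' w : ball r.1 s p -> ball r.2 s p' -> (-oo < d n w (round_down k p, p'))%E ->
    (round_down k p, round_up k p') \in D.
  move=> bp bp' hd; have [k1 k2] := bA1 p bp; have [k3 k4] := bA2 p' bp'.
  apply: (grid_rounded (A := A0) bp bp') => //.
  (* The rounded pair must have increasing times to belong to the grid. There is a path from
     [round_down k p] to [p'], and time [rho] is worth at least one row, so [p'] precedes the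
     rounded start by less than [rho]; [round_up] adds more than that. *)
  have late : (round_down k p).2 - rho < p'.2.
    rewrite ltNge; apply/negP => le.
    have c0 : 0 < c n by rewrite -(pmulr_lgt0 _ rho0) (lt_le_trans ltr01).
    have h1 : - (c n * (round_down k p).2) + 1%:~R <= - (c n * p'.2).
      have := ler_wpM2l (ltW c0) le; rewrite mulrBr mulr1z.
      exact: aux3.
    have := le_floor h1; rewrite floorDrz ?intr_int// intrKfloor => h2.
    move: hd; rewrite rescaled_eqNy ?ltxx// negb_and -!ltNge; apply/orP; right.
    by apply: lt_le_trans h2; rewrite /= ltrDl.
  have [_ /andP[_]] := round_up_bounds k p'; rewrite -/rho.
  exact: aux4.
have mG : measurable_fun setT (fun w => C (grid_max k r s' (d n w))).
  have [_ mg _ _] := grid_conv (grid_max_lip (D := grid k) (fun u uk (_ : ball r s' u) => uk)).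
  exact: mg.
have mS := @measurable_ball_sup n r s.
have bC (x : Omega n -> \bar R) : measurable_fun setT (fun w => C (x w)) -> bdd_meas (fun w => C (x w)).
  by move=> mx; split => //; exists 1 => w; exact: contract_le1.
have bS := bC _ (measurable_contract mS); have bG := bC _ mG.
have tails x : -1 < x < 1 -> fine (P n [set w | x < C (ball_sup r s (d n w))]) <=
    fine (P n [set w | x - 2 * q < C (grid_max k r s' (d n w))]) + 2 * eta.
  move=> /andP[x1 x2].
  have xE : C (expand x) = x by rewrite expandK// inE/= ler_norml !ltW.
  have [al alE] : exists al : R, expand x = al%:E.
    exists (fine (expand x)); rewrite fineK// fin_numE expand_eqoo expand_eqNoo -!ltNge.
    by rewrite x1 x2.
  have k1 := @box_tail R _ (Omega n) (P n) (@X n) (m n) (a n) (b n) (c n) (h n) (m_gt0 n) (@mX n) iX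
    (ball r.1 s) (ball r.2 s) (round_down k) (round_up k) A0 al q eta D (ltW eta0) _ _ _ HD.
  have {}k1 := k1 (fun p hp => match hp with or_introl h1 => bA1 p h1 | or_intror h2 => bA2 p h2 end)
    (fun p bp => prd _ (short_down (bA1 p bp).1 (bA1 p bp).2 rho1))
    (fun p bp => prd _ (short_up (bA2 p bp).1 (bA2 p bp).2 rho1)).
  have S1 : [set w | x < C (ball_sup r s (d n w))] =
      \bigcup_(u in [set u : R4 | ball r.1 s u.1 /\ ball r.2 s u.2]) [set w | (al%:E < d n w u)%E].
    apply/seteqP; split => w /=; rewrite -[in x < _]xE lt_contract alE.
      by move=> /ereal_sup_gt[_ [u [b1 b2] <-] hu]; exists u.
    by move=> [u [b1 b2] hu]; apply: lt_le_trans hu _; apply: ball_sup_ge; split.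
  rewrite S1; apply: le_trans k1 _; rewrite lerD2r; apply: pr_le.
  - rewrite (_ : mkset _ = \bigcup_(u in [set` D]) [set w | ((al - 2 * q)%:E < d n w u)%E]).
      by apply: fin_bigcup_measurable => [|u _]; [exact: finite_seq|exact: mset].
    by apply/seteqP; split => w [u uD hw]; exists u.
  - rewrite (_ : mkset _ = (fun w => C (grid_max k r s' (d n w))) @^-1` `]x - 2 * q, +oo[).
      by rewrite -[_ @^-1` _]setTI; exact: mG.
    by apply/seteqP; split => w; rewrite /= in_itv/= andbT.
  - move=> w [u]; rewrite mem_filter => /andP[/asboolP bu uk] hu /=.
    have h1 : C (al - 2 * q)%:E < C (grid_max k r s' (d n w)).
      by rewrite lt_contract; apply: lt_le_trans hu _; exact: grid_max_ge.
    have := contract_addr al%:E (- (2 * q)); rewrite -alE xE normrN gtr0_norm ?mulr_gt0// alE -EFinD.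
    by move=> h2; exact: le_lt_trans h2 h1.
have q2 : 0 <= 2 * q by rewrite mulr_ge0// ltW.
have eta22 : 0 <= 2 * eta by rewrite mulr_ge0// ltW.
have S11 w : -1 <= C (ball_sup r s (d n w)) <= 1 by rewrite contract_ge_N1 contract_le_1.
exact: aux5 (ev_tail_le bS bG S11 (fun w => contract_ge_N1 _) q2 eta22 tails).
Unshelve. all: by end_near. Qed.

End suprema.

(** * Convergence in the hypograph topology *)

Section convergence_in_law.
Context {R : realType} (dO : nat -> measure_display) (Omega : forall n, measurableType (dO n))
  (P : forall n, probability (Omega n) R) (X : forall n, Omega n -> int * int -> R)
  (m a b c : nat -> R) (h : nat -> int * int -> R)
  (dL : measure_display) (OmegaL : measurableType dL) (PL : probability OmegaL R)
  (L : OmegaL -> (R * R) * (R * R) -> \bar R).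
Hypothesis X_iid : forall n, iid_array (P n) (@X n).
Hypothesis m_gt0 : forall n, 0 < m n.
Hypothesis HL : directed_landscape PL L.
Local Notation R4 := ((R * R) * (R * R))%type.
Local Notation d := (fun n (w : Omega n) => rescaled_lpp (X w) (m n) (a n) (b n) (c n) (h n)).
Local Notation C := (@contract R).
Hypothesis mobile : forall (u_ : nat -> R4) (u : R4),
  R4up u -> u_ n @[n --> \oo] --> u ->
  cvg_in_distribution [set F : \bar R -> R | continuous F]
    P (fun n w => d n w (u_ n)) PL (fun w => L w u).
Hypothesis sheet : forall s t : R, s < t ->
  cvg_in_distribution (@graph_continuous R)
    P (fun n w => time_slice s t (d n w)) PL (fun w => time_slice s t (L w)).

Let max_conv k r s : conv_test P PL d L (fun f => C (grid_max k r s f)).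
Proof.
apply: (grid_conv X_iid m_gt0 HL mobile sheet (k := k)).
by apply: grid_max_lip => u.
Qed.

Let bdd_contract d' (T : measurableType d') (x : T -> \bar R) :
  measurable_fun setT (fun w => C (x w)) -> bdd_meas (fun w => C (x w)).
Proof. by move=> mx; split => //; exists 1 => w; exact: contract_le1. Qed.

Let bdd_max_n k r s n : bdd_meas (fun w => C (grid_max k r s (d n w))).
Proof. by have [+ _] := conv_test_bdd (max_conv k r s); apply. Qed.

Let bdd_max_L k r s : bdd_meas (fun w => C (grid_max k r s (L w))).
Proof. by have [_] := conv_test_bdd (max_conv k r s). Qed.

Let bdd_sup_n r s n : bdd_meas (fun w => C (ball_sup r s (d n w))).
Proof. by apply/bdd_contract/measurable_contract; exact: measurable_ball_sup. Qed.

Let bdd_sup_L (r : R4) (s : R) : 0 < s -> ball r s `<=` @R4o R ->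
  bdd_meas (fun w => C (ball_sup r s (L w))).
Proof.
move=> s0 sub; apply: bdd_contract.
apply: (measurable_fun_cvg (h := fun k w => C (grid_max k r s (L w)))) => [k|w _].
  by have [] := bdd_max_L k r s.
exact: (landscape_grid_max HL).
Qed.

(* The mean of the supremum of L over a ball is monotone in the radius, so it is almost constant
   between two suitable radii s < s'; sup of d_n over the smaller ball is squeezed between the
   maxima over the grid points of the two balls. *)
Lemma radius_choice (r : R4) (e tau : R) : 0 < e -> ball r (2 * e) `<=` @R4o R -> 0 < tau ->
  exists s : R, e <= s <= 2 * e /\ \forall k \near \oo,
    ev PL (fun w => C (ball_sup r s (L w)) - C (grid_max k r s (L w))) <= tau /\
    \forall n \near \oo,
      ev (P n) (fun w => C (ball_sup r s (d n w)) - C (grid_max k r s (d n w))) <= tau.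
Proof.
move=> e0 sub tau0.
have aux1 (x0 x x' n t : R) : x0 + n * t <= x -> t < x' - x -> x0 + (n + 1) * t <= x' by lra.
have aux2 (x0 x n : R) : x0 + n * (tau / 4) <= x -> -1 <= x0 -> x <= 1 -> 8 < n * tau -> False by lra.
have aux3 (x y : R) : x - tau / 4 < y -> x - y <= tau by lra.
have aux4 (x M M' p p' y y' : R) : x <= M' + tau / 4 -> `|y - M| < tau / 8 -> `|y' - M'| < tau / 8 ->
    y' <= p' -> p - tau / 4 < y -> p' - p <= tau / 4 -> x - M <= tau.
  by rewrite !ltr_norml => h1 /andP[h2 h3] /andP[h4 h5] h6 h7 h8; lra.
have t4 : 0 < tau / 4 by rewrite divr_gt0.
have t8 : 0 < tau / 8 by rewrite divr_gt0.
pose phi s := ev PL (fun w => C (ball_sup r s (L w))).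
have subs s : s <= 2 * e -> ball r s `<=` @R4o R.
  by move=> s2; apply: subset_trans sub; exact: le_ball.
(* The means lie in [[-1, 1]], so [N > 8 / tau] increments cannot all exceed [tau / 4]. *)
pose N := (Num.trunc (8 / tau)).+1; pose s_ (i : nat) := e + e * (i%:R / N%:R).
have N0 : 0 < N%:R :> R by rewrite ltr0n.
have s_lt i : s_ i < s_ i.+1.
  by rewrite /s_ ltrD2l ltr_pM2l// ltr_pM2r ?invr_gt0// ltr_nat.
have s_ge i : e <= s_ i by rewrite lerDl mulr_ge0 ?divr_ge0// ltW.
have s_le i : (i <= N)%N -> s_ i <= 2 * e.
  move=> iN; have : i%:R / N%:R <= 1 :> R by rewrite ler_pdivrMr// mul1r ler_nat.
  by rewrite /s_ => h1; have := ler_wpM2l (ltW e0) h1; lra.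
have phi1 i : (i <= N)%N -> -1 <= phi (s_ i) <= 1.
  move=> iN; have bs : bdd_meas (fun w => C (ball_sup r (s_ i) (L w))).
    by apply: bdd_sup_L; [exact: lt_le_trans (s_ge i)|exact/subs/s_le].
  rewrite -[X in X <= _ <= _](ev_cst PL) -[X in _ <= _ <= X](ev_cst PL).
  apply/andP; split; apply: ev_le => //; try exact: bdd_meas_cst.
    by move=> w; exact: contract_ge_N1.
  by move=> w; exact: contract_le_1.
have [i iN hi] : exists2 i, (i < N)%N & phi (s_ i.+1) - phi (s_ i) <= tau / 4.
  apply: contrapT => H.
  have step i : (i <= N)%N -> phi (s_ 0%N) + i%:R * (tau / 4) <= phi (s_ i).
    elim: i => [|i IH] iN; first by rewrite mul0r addr0.
    have [h1|h1] := leP (phi (s_ i.+1) - phi (s_ i)) (tau / 4); first by case: H; exists i.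
    by rewrite -[i.+1%:R]natr1; exact: aux1 (IH (ltnW iN)) h1.
  have /andP[p1 _] := phi1 0%N (leq0n _); have /andP[_ p2] := phi1 N (leqnn _).
  have := step N (leqnn _).
  move=> h1; apply: aux2 h1 p1 p2 _.
  by rewrite -ltr_pdivrMr//; exact: truncnS_gt.
set s := s_ i in hi *; set s' := s_ i.+1 in hi *.
have ss : s < s' := s_lt i.
have s0 : 0 < s := lt_le_trans e0 (s_ge i).
have s2 : s <= 2 * e := s_le i (ltnW iN).
have s'2 : s' <= 2 * e := s_le i.+1 iN.
have s'0 : 0 < s' := lt_trans s0 ss.
have bS := bdd_sup_L s0 (subs s s2); have bS' := bdd_sup_L s'0 (subs s' s'2).
exists s; split; first by rewrite s2 andbT; exact: s_ge.
have cphi : ev PL (fun w => C (grid_max k r s (L w))) @[k --> \oo] --> phi s.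
  apply: (ev_dominated_cvg (M := 1)).
  - by move=> k; have [] := bdd_max_L k r s.
  - by move=> k w; exact: contract_le1.
  - by apply: aeW => w; apply: (landscape_grid_max HL) => //; exact: subs.
  - by have [] := bS.
have := lpp_ball_sup X_iid m_gt0 HL mobile sheet r s0 ss t4.
move/cvgr_gt: cphi => /(_ (phi s - tau / 4)); rewrite ltrBlDr ltrDl => /(_ t4); apply: filterS2 => k hk hS.
split; first by rewrite evB//; exact: aux3 hk.
have [_ _ _ /cvgrPdist_lt /(_ _ t8) c1] := max_conv k r s.
have [_ _ _ /cvgrPdist_lt /(_ _ t8) c2] := max_conv k r s'.
near=> n.
have k1 : ev (P n) (fun w => C (ball_sup r s (d n w))) <=
    ev (P n) (fun w => C (grid_max k r s' (d n w))) + tau / 4 by near: n.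
have k2 : `|ev PL (fun w => C (grid_max k r s (L w))) - ev (P n) (fun w => C (grid_max k r s (d n w)))| < tau / 8.
  by near: n.
have k3 : `|ev PL (fun w => C (grid_max k r s' (L w))) - ev (P n) (fun w => C (grid_max k r s' (d n w)))| < tau / 8.
  by near: n.
have k4 : ev PL (fun w => C (grid_max k r s' (L w))) <= phi s'.
  by apply: ev_le => // w; rewrite le_contract grid_max_le.
by rewrite evB//; exact: aux4 k1 k2 k3 k4 hk hi.
Unshelve. all: by end_near. Qed.

Section lipschitz_functional.
Variables (G : (R4 -> \bar R) -> R) (K B : R).
Hypotheses (K0 : 0 <= K) (GB : forall f, `|G f| <= B)
  (GK : forall e f g, 0 <= e -> hypo_near e f g -> `|G f - G g| <= K * e).

(** Makes [G] a Lipschitz function of the finitely many values [v r]; with ball suprema as [v] this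
    is [smash]. *)
Let spikes (cs : seq R4) (v : R4 -> \bar R) : R4 -> \bar R :=
  fun r => if r \in cs then v r else -oo%E.

Let spikes_dist cs v v' (e : R) : 0 <= e -> (forall r, r \in cs -> `|C (v r) - C (v' r)| <= e) ->
  `|G (spikes cs v) - G (spikes cs v')| <= K * 2 * e.
Proof.
move=> e0 H; rewrite -mulrA; apply: GK; first by rewrite mulr_ge0.
by apply: (hypo_near_spikes (cs := cs)) => // r rcs; rewrite /spikes ?rcs ?(negbTE rcs)//; exact: H.
Qed.

Let spikes_lip cs : contract_lip cs (fun v => G (spikes cs v)).
Proof. by exists (K * 2) => [|f g e e0 fg]; [rewrite mulr_ge0|exact: spikes_dist]. Qed.

Let approx (e : R) : 0 < e -> exists k (cs : seq R4), [/\ 0 < k,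
  forall r, r \in cs -> ball r (2 * k) `<=` @R4o R &
  forall s f, (forall r, r \in cs -> k <= s r <= 2 * k) ->
    `|G f - G (spikes cs (fun r => ball_sup r (s r) f))| <= e].
Proof.
(* [hypo_near_smash] loses [22 q], hence [G] loses [22 K q <= e]; the added 1 covers the case
   [K = 0]. *)
move=> e0; pose q := e / (22 * K + 1).
have K1 : 0 < 22 * K + 1 by rewrite ltr_wpDl// mulr_ge0.
have q0 : 0 < q by rewrite divr_gt0.
have [cs Hcs cov] := @hypo_net R q q0; have k0 : 0 < q / 16 by rewrite divr_gt0.
exists (q / 16), cs; split => // [r /Hcs[]//|s f hs].
have near : hypo_near (22 * q) f (smash cs s f).
  apply: (hypo_near_smash (k := q / 16)) => // [|r rcs]; first by lra.
  have [h1 h2] := Hcs r rcs; have /andP[h3 h4] := hs r rcs; split => //.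
    by apply/andP; split => //; lra.
  by apply: subset_trans h2; exact: le_ball.
have q22 : 0 <= 22 * q by rewrite mulr_ge0// ltW.
apply: le_trans (GK q22 near) _.
rewrite /q (_ : K * _ = e * ((22 * K) / (22 * K + 1))); last by field; rewrite gt_eqF.
by rewrite ler_piMr//; [exact: ltW|rewrite ler_pdivrMr// mul1r lerDl].
Qed.

Let lip_measurable_field d' (T : measurableType d') (x : T -> R4 -> \bar R) :
  (forall r s, 0 < s -> ball r s `<=` @R4o R -> measurable_fun setT (fun w => C (ball_sup r s (x w)))) ->
  measurable_fun setT (G \o x).
Proof.
move=> mx; apply: measurable_unif => e e0; have [k [cs [k0 bcs Hcs]]] := approx e0.
exists (fun f => G (spikes cs (fun r => ball_sup r k f))); last first.
  by move=> f; apply: (Hcs (fun=> k)) => r _; apply/andP; split; lra.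
apply: (contract_lip_measurable (x := fun w r => ball_sup r k (x w)) (spikes_lip cs)) => r rcs.
apply: mx => //; apply: subset_trans (bcs r rcs); apply: le_ball; lra.
Qed.

(** Spikes at ball suprema approximate [G]; spikes at grid maxima give the finite-dimensional
    functional [H]. As a grid maximum never exceeds the ball supremum, the two are close in mean
    absolute value as soon as their means are, and [radius_choice] provides this for the landscape
    and for all large [n]. *)
Lemma hypo_lip_conv : conv_test P PL d L G.
Proof.
have mn n : measurable_fun setT (G \o d n).
  by apply: lip_measurable_field => r s _ _; have [] := bdd_sup_n r s n.
have mL : measurable_fun setT (G \o L).
  by apply: lip_measurable_field => r s s0 sub; have [] := bdd_sup_L s0 sub.
split => //; first by exists B.
apply/cvgrPdist_lt => e e0; have e8 : 0 < e / 8 by rewrite divr_gt0.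
have aux1 (x : R) : x <= e / 8 -> e / 8 + x <= e / 4 by lra.
have aux2 (x y x' y' : R) : `|x - y| <= e / 4 -> `|x' - y'| <= e / 4 -> `|y - y'| < e / 4 -> `|x - x'| < e.
  rewrite !ler_norml !ltr_norml => /andP[? ?] /andP[? ?] /andP[? ?].
  by apply/andP; split; lra.
have [k0 [cs [k00 bcs Hcs]]] := approx e8.
pose N : R := (size cs)%:R; have N0 : 0 <= N by exact: ler0n.
pose tau := e / (8 * (K * 2 * N + 1)).
have KN : 0 <= K * 2 * N by rewrite !mulr_ge0.
have KN1 : 0 < K * 2 * N + 1 by exact: ltr_wpDl.
have tau0 : 0 < tau by rewrite divr_gt0// mulr_gt0.
have [s Hs] : {s : R4 -> R & forall r, r \in cs -> k0 <= s r <= 2 * k0 /\ \forall k \near \oo,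
    ev PL (fun w => C (ball_sup r (s r) (L w)) - C (grid_max k r (s r) (L w))) <= tau /\
    \forall n \near \oo,
      ev (P n) (fun w => C (ball_sup r (s r) (d n w)) - C (grid_max k r (s r) (d n w))) <= tau}.
  apply: (@choice _ _ (fun r s => r \in cs -> k0 <= s <= 2 * k0 /\ \forall k \near \oo,
    ev PL (fun w => C (ball_sup r s (L w)) - C (grid_max k r s (L w))) <= tau /\
    \forall n \near \oo,
      ev (P n) (fun w => C (ball_sup r s (d n w)) - C (grid_max k r s (d n w))) <= tau)) => r.
  have [rcs|_] := boolP (r \in cs); last by exists 0.
  by have [s hs] := radius_choice k00 (bcs r rcs) tau0; exists s.
have /filter_ex[k Hk] : \forall k \near \oo, forall r, r \in cs ->
    ev PL (fun w => C (ball_sup r (s r) (L w)) - C (grid_max k r (s r) (L w))) <= tau /\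
    \forall n \near \oo,
      ev (P n) (fun w => C (ball_sup r (s r) (d n w)) - C (grid_max k r (s r) (d n w))) <= tau.
  by apply: near_seq => r rcs; have [_] := Hs r rcs.
have srange r : r \in cs -> k0 <= s r <= 2 * k0 by move=> /Hs[].
pose H f := G (spikes cs (fun r => grid_max k r (s r) f)).
have tH : conv_test P PL d L H.
  apply: (grid_conv X_iid m_gt0 HL mobile sheet (k := k)).
  exists (K * 2) => [|f g q q0 fg]; first by rewrite mulr_ge0.
  apply: spikes_dist => // r _; have [|A A0 HA] := @grid_max_lip R k r (s r) (grid k).
    by move=> u.
  rewrite /grid_max !contract_bigmax; apply: bigmaxr_dist => // u.
  by rewrite mem_filter => /andP[_ uk]; exact: fg.
have key d' (T : measurableType d') (Q : probability T R) (x : T -> R4 -> \bar R) :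
    measurable_fun setT (G \o x) -> measurable_fun setT (H \o x) ->
    (forall r, r \in cs -> bdd_meas (fun w => C (ball_sup r (s r) (x w)))) ->
    (forall r, r \in cs -> bdd_meas (fun w => C (grid_max k r (s r) (x w)))) ->
    (forall r, r \in cs ->
      ev Q (fun w => C (ball_sup r (s r) (x w)) - C (grid_max k r (s r) (x w))) <= tau) ->
    `|ev Q (G \o x) - ev Q (H \o x)| <= e / 4.
  move=> mG mH bS bM hx.
  have bG : bdd_meas (G \o x) by split => //; exists B => w; exact: GB.
  have bH : bdd_meas (H \o x) by split => //; exists B => w; exact: GB.
  pose D r w := C (ball_sup r (s r) (x w)) - C (grid_max k r (s r) (x w)).
  have bD r : r \in cs -> bdd_meas (D r) by move=> rcs; apply: bdd_measB; [exact: bS|exact: bM].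
  have bsum : bdd_meas (fun w => \sum_(r <- cs) D r w) by exact: bdd_meas_sum.
  have bK := bdd_measZ (K * 2) bsum; have bE := bdd_measD (bdd_meas_cst T (e / 8)) bK.
  apply: (@le_trans _ _ (ev Q (fun w => e / 8 + K * 2 * \sum_(r <- cs) D r w))).
    apply: ev_dist_le => // w /=.
    apply: le_trans (ler_distD (G (spikes cs (fun r => ball_sup r (s r) (x w)))) _ _) _.
    apply: lerD; first exact: Hcs.
    have D0 r : 0 <= D r w by rewrite subr_ge0 le_contract grid_max_le.
    apply: spikes_dist => [|r rcs]; first by apply: sumr_ge0.
    by rewrite ger0_norm ?D0// (big_rem r)//= lerDl sumr_ge0.
  rewrite (evD Q (bdd_meas_cst T (e / 8)) bK) ev_cst (evZ Q _ bsum) ev_sum//.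
  have : \sum_(r <- cs) ev Q (D r) <= N * tau.
    apply: (@le_trans _ _ (\sum_(r <- cs) tau)).
      by rewrite big_seq [leRHS]big_seq; apply: ler_sum => r; exact: hx.
    by rewrite big_const_seq count_predT iter_addr addr0 /N [leRHS]mulr_natl.
  move=> h1; have K2 : 0 <= K * 2 by rewrite mulr_ge0.
  have h2 := ler_wpM2l K2 h1.
  have h3 : K * 2 * (N * tau) <= e / 8.
    rewrite /tau (_ : K * 2 * _ = e / 8 * (K * 2 * N / (K * 2 * N + 1))); last by field; rewrite gt_eqF.
    by rewrite ler_piMr//; [exact: ltW|rewrite ler_pdivrMr// mul1r lerDl].
  exact: aux1 (le_trans h2 h3).
have [_ mHn mHL cH] := tH.
have kL : `|ev PL (G \o L) - ev PL (H \o L)| <= e / 4.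
  apply: key => // r rcs; last by have [] := Hk r rcs.
  have /andP[h1 h2] := srange r rcs; apply: bdd_sup_L; first exact: lt_le_trans h1.
  by apply: subset_trans (bcs r rcs); exact: le_ball.
have kn : \forall n \near \oo, `|ev (P n) (G \o d n) - ev (P n) (H \o d n)| <= e / 4.
  have : \forall n \near \oo, forall r, r \in cs ->
      ev (P n) (fun w => C (ball_sup r (s r) (d n w)) - C (grid_max k r (s r) (d n w))) <= tau.
    by apply: near_seq => r rcs; have [] := Hk r rcs.
  by apply: filterS => n hn; apply: key => // r rcs; exact: hn.
have e4 : 0 < e / 4 by rewrite divr_gt0.
move/cvgrPdist_lt: cH => /(_ _ e4); move: kn; apply: filterS2 => n h1 h2.
exact: aux2 kL h1 h2.
Qed.

End lipschitz_functional.

(** Minorants that converge to [F] only pointwise give one inequality, as in Fatou's lemma; the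
    other one comes from [- F]. *)
Lemma hypo_lower (F : (R4 -> \bar R) -> R) (B : R) : (forall f, `|F f| <= B) -> hypo_continuous F ->
  [/\ forall n, measurable_fun setT (F \o d n), measurable_fun setT (F \o L) &
    forall e, 0 < e -> \forall n \near \oo, ev PL (F \o L) - e < ev (P n) (F \o d n)].
Proof.
move=> FB cF; have tF (j : nat) : conv_test P PL d L (hypo_minorant F j%:R).
  apply: (hypo_lip_conv (K := j%:R) (B := B)) => // [f|e f g e0].
    exact: hypo_minorant_bound.
  exact: (hypo_minorant_lip FB).
have mF d' (T : measurableType d') (x : T -> R4 -> \bar R) :
    (forall j : nat, measurable_fun setT (hypo_minorant F j%:R \o x)) -> measurable_fun setT (F \o x).
  move=> mx; apply: (measurable_fun_cvg (h := fun j => hypo_minorant F j%:R \o x)) => // w _.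
  exact: (hypo_minorant_cvg FB cF).
have mn n : measurable_fun setT (F \o d n) by apply: mF => j; have [] := tF j.
have mL : measurable_fun setT (F \o L) by apply: mF => j; have [] := tF j.
split => // e e0; have e2 : 0 < e / 2 by rewrite divr_gt0.
have aux (x y z t : R) : x - e / 2 < y -> y - z < e / 2 -> z <= t -> x - e < t by lra.
have : ev PL (hypo_minorant F j%:R \o L) @[j --> \oo] --> ev PL (F \o L).
  apply: (ev_dominated_cvg (M := B)) => // [j|j w|].
  - by have [] := tF j.
  - exact: (hypo_minorant_bound FB).
  - by apply: aeW => w; exact: (hypo_minorant_cvg FB cF).
move/cvgr_gt => /(_ (ev PL (F \o L) - e / 2)); rewrite ltrBlDr ltrDl => /(_ e2) /filter_ex[j hj].
have [_ _ _ /cvgrPdist_lt /(_ _ e2)] := tF j; apply: filterS => n.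
rewrite ltr_norml => /andP[_ h1].
have [bn _] := conv_test_bdd (tF j).
have h2 : ev (P n) (hypo_minorant F j%:R \o d n) <= ev (P n) (F \o d n).
  apply: ev_le => // [|w]; first by split => //; exists B => w; exact: FB.
  exact: (hypo_minorant_le FB).
exact: aux hj h1 h2.
Qed.

Lemma hypo_conv (F : (R4 -> \bar R) -> R) : hypo_continuous F ->
  (exists B, forall f, `|F f| <= B) -> conv_test P PL d L F.
Proof.
move=> cF [B FB]; have [mn mL lower] := hypo_lower FB cF.
have [||_ _ upper] := @hypo_lower (fun f => - F f) B; first by move=> f; rewrite normrN.
  move=> f e e0; have [q q0 Hq] := cF f e e0; exists q => // g fg.
  by rewrite -opprD normrN; exact: Hq.
split => //; first by exists B.
have bn n : bdd_meas (F \o d n) by split => //; exists B => w; exact: FB.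
have bL : bdd_meas (F \o L) by split => //; exists B => w; exact: FB.
have evN d' (T : measurableType d') (Q : probability T R) (f : T -> R) : bdd_meas f ->
    ev Q (fun w => - f w) = - ev Q f.
  move=> bf; rewrite -mulN1r -(evZ Q (-1) bf); congr (ev Q _).
  by apply/funext => w; rewrite mulN1r.
apply/cvgrPdist_lt => e e0.
have aux (x y : R) : x - e < y -> - x - e < - y -> `|x - y| < e.
  by move=> h1 h2; rewrite ltr_norml; apply/andP; split; lra.
move: (lower e e0) (upper e e0); apply: filterS2 => n h1.
by rewrite (evN _ _ PL _ bL) (evN _ _ (P n) _ (bn n)); exact: aux h1.
Qed.

End convergence_in_law.

Unset Implicit Arguments.

Theorem theorem1p16 (R : realType)
  (dO : nat -> measure_display) (Omega : forall n, measurableType (dO n))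
  (P : forall n, probability (Omega n) R)
  (X : forall n, Omega n -> int * int -> R)
  (m a b c : nat -> R) (h : nat -> int * int -> R)
  (dL : measure_display) (OmegaL : measurableType dL)
  (PL : probability OmegaL R)
  (L : OmegaL -> (R * R) * (R * R) -> \bar R)
  (X_iid : forall n, iid_array (P n) (X n))
  (X_ge0 : forall n w z, 0 <= X n w z)
  (m_gt0 : forall n, 0 < m n)
  (L_landscape : directed_landscape PL L) :
  let d n (w : Omega n) : (R * R) * (R * R) -> \bar R :=
    rescaled_lpp (X n w) (m n) (a n) (b n) (c n) (h n) in
  (* mobile Tracy-Widom convergence *)
  (forall (u_ : nat -> (R * R) * (R * R)) (u : (R * R) * (R * R)),
     R4up u -> u_ n @[n --> \oo] --> u ->
     cvg_in_distribution [set F : \bar R -> R | continuous F]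
       P (fun n w => d n w (u_ n)) PL (fun w => L w u)) ->
  (* Airy sheet convergence *)
  (forall s t : R, s < t ->
     cvg_in_distribution (@graph_continuous R)
       P (fun n w => time_slice s t (d n w)) PL
       (fun w => time_slice s t (L w))) ->
  cvg_in_distribution (@hypo_continuous R) P d PL L.
Proof.
move=> d mobile sheet; apply: conv_test_cvg_in_distribution => F cF bF.
exact: (hypo_conv X_iid m_gt0 L_landscape mobile sheet cF bF).
Qed.
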